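(* Let $\alpha,\beta\in(0,2\wedge d)$, let $U,V:\mathbb{R}^d\to(0,\infty)$ be measurable, and let $p_1,q_2\ge0$, $p_2,q_1>0$. Consider the problem $$(-\Delta)^{\alpha/2}u\ge U(x)u^{p_1}v^{p_2}\ \text{ in }B^c,\qquad (-\Delta)^{\beta/2}v\ge V(x)u^{q_1}v^{q_2}\ \text{ in }B^c,\qquad u,v\ge0\ \text{ in }\mathbb{R}^d,$$ and suppose that $$\lim_{r\to\infty}\max\left\{\frac{r^{d-\alpha}}{\Phi_U(r)},\frac{r^{d-\beta}}{\Phi_V(r)}\right\}=0.$$ Then the problem has only trivial (classical) solutions (i.e. either $u=0$ or $v=0$ in $\mathbb{R}^d$) if all of the following hold. (i) If $p_2q_1+p_1<1$, then $$\liminf_{r\to\infty}\left[\frac{\Phi_V(r)}{r^{(d-\beta)(1+q_2)}}\right]^{p_2}\frac{\Phi_U(r)}{r^{d-\alpha}}>0.$$ (ii) If $p_2q_1+q_2<1$, then $$\liminf_{r\to\infty}\left[\frac{\Phi_U(r)}{r^{(d-\alpha)(1+p_1)}}\right]^{q_1}\frac{\Phi_V(r)}{r^{d-\beta}}>0.$$ (iii) If $p_2q_1+p_1\ge1$, then $$\lim_{r\to\infty}\frac{1}{r^{(d-\alpha)(p_2q_1+p_1)}}\frac{1}{r^{(d-\beta)(p_2q_2+p_2)}}\Phi_V^{p_2}(r)\,\Phi_U(r)=\infty.$$ (iv) If $p_2q_1+q_2\ge1$, then $$\lim_{r\to\infty}\frac{1}{r^{(d-\beta)(p_2q_1+q_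2)}}\frac{1}{r^{(d-\alpha)(p_1q_1+q_1)}}\Phi_V(r)\,\Phi_U^{q_1}(r)=\infty.$$
   Context: $d\ge1$; $B=\overline{B(0,1)}$ is the closed unit ball of $\mathbb{R}^d$, $B^c$ its (open) complement, and $B(x,r)$ is the ball of radius $r$ centered at $x$. For $\alpha\in(0,2)$, $(-\Delta)^{\alpha/2}u(x)=c_{d,\alpha}\,\mathrm{P.V.}\int_{\mathbb{R}^d}\frac{u(x)-u(y)}{|x-y|^{d+\alpha}}\,dy$ is the fractional Laplacian, with the usual normalizing constant $c_{d,\alpha}>0$. For $U,V:\mathbb{R}^d\to(0,\infty)$ define $$\Phi_U(r)=\inf_{\frac r2\le|x|\le\frac{3r}2}\int_{B(x,r/4)}U(y)\,dy,\qquad \Phi_V(r)=\inf_{\frac r2\le|x|\le\frac{3r}2}\int_{B(x,r/4)}V(y)\,dy,$$ and write $\Phi_U^{a}(r)=(\Phi_U(r))^a$, and similarly for $V$. Solutions (super-solutions) are classical: $u\in\mathcal{C}^{\alpha+}(B^c)\cap\mathcal{C}(\mathbb{R}^d)\cap L^1(\mathbb{R}^d,\omega_\alpha)$ and $v\in\mathcal{C}^{\beta+}(B^c)\cap\mathcal{C}(\mathbb{R}^d)\cap L^1(\mathbb{R}^d,\omega_\beta)$, with the inequalities holding pointwise. Here $h\in\mathcal{C}^{\alpha+}(D)$ means that for every compact $K\Subset D$ there is $\gamma>0$ with $h\in\mathcal{C}^{\alpha+\gamma}(K)$, and $L^1(\mathbb{R}^d,\omega_\alpha)$ is the class of functions integrable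 with respect to the weight $\omega_\alpha(x)=\frac{1}{1+|x|^{d+\alpha}}$. *)

(* Defs.v *)
From HB Require Import structures.
From mathcomp Require Import all_boot all_order all_algebra.
From mathcomp Require Import all_classical all_reals all_analysis.

Set Implicit Arguments.
Unset Strict Implicit.
Unset Printing Implicit Defensive.

Import Order.TTheory GRing.Theory Num.Theory.
Import numFieldNormedType.Exports.

Local Open Scope classical_set_scope.
Local Open Scope ring_scope.

Section borel_row.
Context {R : realType}.

(* The Borel sigma-algebra of R^n, generated by the coordinates, and the n-fold
   product on it of the Lebesgue measure of R. *)
Definition row_coord n (i : 'I_n) (x : 'rV[R]_n) : measurableTypeR R :=
  x ord0 i.

Definition borel_rV n : Type := 'rV[R]_n.

Definition borel_rV_display : measure_display.
Proof. exact: default_measure_display. Qed.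

Let borel_rV0 n : g_sigma_preimage (@row_coord n) set0.
Proof. exact: sigma_algebra0. Qed.

Let borel_rVC n A : g_sigma_preimage (@row_coord n) A ->
  g_sigma_preimage (@row_coord n) (~` A).
Proof. exact: sigma_algebraC. Qed.

Let borel_rV_bigcup n (F : (set 'rV[R]_n)^nat) :
  (forall k, g_sigma_preimage (@row_coord n) (F k)) ->
  g_sigma_preimage (@row_coord n) (\bigcup_k F k).
Proof. exact: sigma_algebra_bigcup. Qed.

HB.instance Definition _ n := Pointed.on (borel_rV n).
HB.instance Definition _ n := @isMeasurable.Build borel_rV_display
  (borel_rV n) (g_sigma_preimage (@row_coord n))
  (@borel_rV0 n) (@borel_rVC n) (@borel_rV_bigcup n).

Definition row_cons n (p : measurableTypeR R * borel_rV n) : borel_rV n.+1 :=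
  \row_i oapp ((p.2 : 'rV[R]_n) ord0) p.1 (unlift ord0 i).

Definition row_split n (x : borel_rV n.+1) : measurableTypeR R * borel_rV n :=
  ((x : 'rV[R]_n.+1) ord0 ord0, \row_i (x : 'rV[R]_n.+1) ord0 (lift ord0 i)).

Lemma row_consK n : cancel (@row_cons n) (@row_split n).
Proof.
move=> [a y]; rewrite /row_split /row_cons; congr (_, _).
  by rewrite mxE unlift_none.
by apply/rowP => i; rewrite !mxE liftK.
Qed.

Lemma measurable_row_coord n (i : 'I_n) :
  measurable_fun [set: borel_rV n] (@row_coord n i).
Proof.
move=> _ Y mY; rewrite setTI; apply: sub_sigma_algebra => /=.
rewrite -bigcup_seq/=; exists i => /=; first by rewrite mem_index_enum.
by exists Y => //; rewrite setTI.
Qed.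

Lemma measurable_to_row d (T : measurableType d) n (f : T -> borel_rV n) :
  (forall i, measurable_fun setT (fun t => row_coord i (f t))) ->
  measurable_fun setT f.
Proof.
move=> mf _ B mB.
suff /(_ B mB) : measurable `<=` image_set_system setT f measurable by [].
apply: smallest_sub; first exact/sigma_algebra_image/sigma_algebra_measurable.
move=> C; rewrite -bigcup_seq => -[i _] [D mD <-].
by rewrite /image_set_system/= [X in f @^-1` X]setTI; exact: mf.
Qed.

Lemma measurable_row_cons n : measurable_fun setT (@row_cons n).
Proof.
apply: measurable_to_row => i.
have [j ->|->] := unliftP ord0 i.
  rewrite (_ : (fun _ => _) = row_coord j \o snd).
    exact: (measurableT_comp (measurable_row_coord j)).
  by apply/funext => p; rewrite /row_coord /= mxE liftK.
rewrite (_ : (fun _ => _) = fst); first exact: measurable_fst.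
by apply/funext => p; rewrite /row_coord /= mxE unlift_none.
Qed.

Lemma measurable_row_split n : measurable_fun setT (@row_split n).
Proof.
apply/measurable_fun_pairP; split; first exact: (measurable_row_coord ord0).
apply: measurable_to_row => i.
rewrite (_ : (fun _ => _) = row_coord (lift ord0 i)).
  exact: measurable_row_coord.
by apply/funext => x; rewrite /row_coord /= mxE.
Qed.

Section succ.
Context n (m : {sigma_finite_measure set (borel_rV n) -> \bar R}).

Definition lebesgue_rV_succ : set (borel_rV n.+1) -> \bar R :=
  pushforward (lebesgue_measure \x m)%E (@row_cons n).

Let lebesgue_rV_succ0 : lebesgue_rV_succ set0 = 0%E.
Proof. by rewrite /lebesgue_rV_succ /pushforward preimage_set0 measure0. Qed.

Let lebesgue_rV_succ_ge0 A : (0 <= lebesgue_rV_succ A)%E.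
Proof. by apply: integral_ge0 => a _ /=; exact: measure_ge0. Qed.

Let lebesgue_rV_succ_sigma_additive : semi_sigma_additive lebesgue_rV_succ.
Proof.
move=> F mF tF mUF; rewrite /lebesgue_rV_succ /pushforward preimage_bigcup.
have mpre A : measurable A -> measurable (@row_cons n @^-1` A).
  by move=> mA; rewrite -(setTI (_ @^-1` _)); exact: measurable_row_cons.
apply: measure_semi_sigma_additive.
- by move=> k; exact: mpre.
- apply/trivIsetP => /= i j _ _ ij; rewrite -preimage_setI.
  by move/trivIsetP : tF => /(_ _ _ _ _ ij) ->//; rewrite preimage_set0.
- by rewrite -preimage_bigcup; exact: mpre.
Qed.

HB.instance Definition _ := isMeasure.Build _ _ _ lebesgue_rV_succ
  lebesgue_rV_succ0 lebesgue_rV_succ_ge0 lebesgue_rV_succ_sigma_additive.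

Let lebesgue_rV_succ_sigma_finite : sigma_finite setT lebesgue_rV_succ.
Proof.
have /sigma_finiteP[F [FT ndF Foo]] := sigma_finiteT (@lebesgue_measure R).
have /sigma_finiteP[G [GT ndG Goo]] := sigma_finiteT m.
exists (fun k => @row_split n @^-1` (F k `*` G k)).
  rewrite -preimage_bigcup (_ : \bigcup_k _ = setT) ?preimage_setT//.
  rewrite -setXTT FT GT predeqE => -[a y]; split=> [[k _ []/= ? ?]|].
    by split; exists k.
  move=> [/= [k _ Fka] [l _ Gly]]; exists (maxn k l) => //; split.
    by move: Fka; exact/subsetPset/ndF/leq_maxl.
  by move: Gly; exact/subsetPset/ndG/leq_maxr.
move=> k; have [mFk Fk] := Foo k; have [mGk Gk] := Goo k; split.
  rewrite -(setTI (_ @^-1` _)).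
  by apply: measurable_row_split => //; exact: measurableX.
rewrite /lebesgue_rV_succ /pushforward -comp_preimage.
rewrite (_ : _ \o _ = id) ?preimage_id; last first.
  by apply/funext => p; exact: row_consK.
by rewrite /= product_measure1E// lte_mul_pinfty// ge0_fin_numE.
Qed.

HB.instance Definition _ := @Measure_isSigmaFinite.Build _ _ _
  lebesgue_rV_succ lebesgue_rV_succ_sigma_finite.

End succ.

Fixpoint borel_lebesgue_rV n :
    {sigma_finite_measure set (borel_rV n) -> \bar R} :=
  match n with
  | 0 => dirac ((0 : 'rV[R]_0) : borel_rV 0)
  | n'.+1 => lebesgue_rV_succ (borel_lebesgue_rV n')
  end.

End borel_row.

(* R^d with its Lebesgue sigma-algebra: the Caratheodory-measurable sets of the
   outer measure induced by the Borel-Lebesgue measure. *)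
Definition leb_rV (R : realType) (d : nat) :=
  caratheodory_type ((@borel_lebesgue_rV R d)^*)%mu.

Definition lebesgue_rV (R : realType) (d : nat) :
    {measure set (leb_rV R d) -> \bar R} :=
  @completed_measure_extension _ _ R (@borel_lebesgue_rV R d).

Section definitions.
Context {R : realType} {d : nat}.
Implicit Types (x y : 'rV[R]_d) (u v h U V : 'rV[R]_d -> R).

(* The library norm on 'rV[R]_d is the sup norm; it gives the same topology. *)
Definition enorm x : R := Num.sqrt (\sum_(i < d) x ord0 i ^+ 2).

Definition eball x (r : R) : set 'rV[R]_d := [set y | enorm (y - x) < r].

Definition exterior : set 'rV[R]_d := ~` [set x | enorm x <= 1].

Definition lebesgue_measurable U :=
  measurable_fun [set: leb_rV R d] (U : leb_rV R d -> R).

(* Extended-real valued, since U is not assumed to be locally integrable. *)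
Definition Phi U (r : R) : \bar R :=
  ereal_inf [set (\int[@lebesgue_rV R d]_(y in eball x (r / 4)) (U y)%:E)%E
            | x in [set x | r / 2 <= enorm x <= 3 * r / 2]].

Definition Gamma (z : R) : R :=
  \int[lebesgue_measure]_(t in `]0, +oo[) (t `^ (z - 1) * expR (- t)).

(* 2^a Gamma((d+a)/2) / (pi^(d/2) |Gamma(-a/2)|),
   with |Gamma(-a/2)| = 2 Gamma(1-a/2) / a for 0 < a < 2. *)
Definition fraclap_const (a : R) : R :=
  a * 2 `^ (a - 1) * Gamma ((d%:R + a) / 2) /
  (pi `^ (d%:R / 2) * Gamma (1 - a / 2)).

(* (-Delta)^(a/2) u (x); the principal value exists for the functions u
   of [classical_space a] below and x in the exterior domain. *)
Definition fraclap (a : R) u x : R :=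
  fraclap_const a *
  lim ((\int[@lebesgue_rV R d]_(y in [set y | (e < enorm (x - y))%R])
          ((u x - u y) / enorm (x - y) `^ (d%:R + a))) @[e --> 0^'+]).

Definition partial_derivative (s : seq 'I_d) h : 'rV[R]_d -> R :=
  foldr (fun i g x => 'D_(delta_mx ord0 i) g x) h s.

(* h is in C^{k,theta}(K). *)
Definition Ck_holder (K : set 'rV[R]_d) (k : nat) (theta : R) h : Prop :=
  [/\ forall (s : seq 'I_d) (i : 'I_d) x, (size s < k)%N -> K x ->
        derivable (partial_derivative s h) x (delta_mx ord0 i),
      forall s : seq 'I_d, (size s <= k)%N ->
        {within K, continuous (partial_derivative s h)} &
      forall s : seq 'I_d, size s = k -> exists C : R, forall x y,
        K x -> K y ->
        `|partial_derivative s h x - partial_derivative s h y|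
          <= C * enorm (x - y) `^ theta].

(* C^s(K) for s > 0 is C^{k,theta}(K) with s = k + theta and 0 < theta <= 1. *)
Definition holder (K : set 'rV[R]_d) (s : R) h : Prop :=
  exists (k : nat) (theta : R),
    [/\ 0 < theta <= 1, s = k%:R + theta & Ck_holder K k theta h].

Definition holder_plus (D : set 'rV[R]_d) (a : R) h : Prop :=
  forall K, compact K -> K `<=` D -> exists2 g : R, 0 < g & holder K (a + g) h.

Definition weighted_L1 (a : R) u : Prop :=
  (@lebesgue_rV R d).-integrable setT
    (fun x => (u x / (1 + enorm x `^ (d%:R + a)))%:E).

Definition classical_space (a : R) u : Prop :=
  [/\ holder_plus exterior a u, continuous u & weighted_L1 a u].

(* On nonnegative bases, `^ is the usual power, with 0 `^ 0 = 1. *)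
Definition classical_supersolution (alpha beta p1 p2 q1 q2 : R) U V u v : Prop :=
  [/\ classical_space alpha u /\ classical_space beta v,
      forall x, 0 <= u x /\ 0 <= v x,
      forall x, exterior x -> U x * u x `^ p1 * v x `^ p2 <= fraclap alpha u x &
      forall x, exterior x -> V x * u x `^ q1 * v x `^ q2 <= fraclap beta v x].

End definitions.

(* Main.v *)
(* Write I_e u (x) for the integral of (u(x) - u(y)) |x - y|^(-d-a) over
   |x - y| > e, so that (-Delta)^(a/2) u is a constant times lim I_e u, and
   A_u(r) = r^(-d) int_{B(0,4r)} u.  If u and v are not trivial they are positive
   in B^c, and:
   - touching u from below by a paraboloid of size r gives the weak Harnack bound
     u >= c A_u(r) on r/4 <= |x| <= 2r;
   - testing the inequality for u with a paraboloid centred at |x| = r, and using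
     the Harnack bounds in the source term, gives
     A_u >= c r^(alpha-d) Phi_U A_u^p1 A_v^p2, and symmetrically for v;
   - testing with a truncation of u, and comparing with the capacity of a large
     cube, gives A_u >= c r^(alpha-d); the same energy method shows that u does
     not tend to infinity at infinity.
   Eliminating A_v between these scalar inequalities contradicts (iii), and under
   (i) bounds A_u below by a positive constant; likewise for A_v by (iv) and (ii).
   Feeding these bounds back, r^(alpha-d) Phi_U -> oo forces A_u -> oo, hence
   u -> oo, a contradiction. *)

Require Import Defs.
From HB Require Import structures.
From mathcomp Require Import all_boot all_order all_algebra.
From mathcomp Require Import all_classical all_reals all_analysis.
From mathcomp Require Import measurable_realfun.
From mathcomp Require Import ring lra.
Set Implicit Arguments.
Unset Strict Implicit.
Unset Printing Implicit Defensive.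
Import Order.TTheory GRing.Theory Num.Theory.
Import numFieldNormedType.Exports.
Local Open Scope classical_set_scope.
Local Open Scope ring_scope.

(** * Lebesgue measure and the Euclidean norm on row vectors *)

(** The equation is available only through a principal value, with no control on its rate of
    convergence. Touching arguments are therefore run at one fixed small e, where I_e u inherits the
    sign of its limit. Integral arguments use that the kernel cut off at e is symmetric and bounded,
    so that integration by parts is exact at level e, and then let e -> 0 by Fatou's lemma; Hoelder
    regularity supplies the lower bound on I_e u, uniform in e, that Fatou requires. Only one-sided
    inequalities come out, which is enough. No fundamental solution is used: the decay bound on A_u
    rests on the positive capacity of a cube, obtained by comparing averages over cubes that go off
    to infinity; this is where alpha < d enters. In the unit ball nothing is known about the
    operator of u, so test functions vanish for |x| < 2, and cutting them off there has a cost: in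
    the bound on A_u it is beaten by the capacity of a large cube, in the blow-up argument it is an
    energy whose constant does not depend on the level T. *)

Section borel_lebesgue.
Context {R : realType}.
Implicit Types n : nat.

Definition rect n (A : 'I_n -> set R) : set 'rV[R]_n :=
  [set y | forall i, A i (y ord0 i)].

Lemma measurable_rect n (A : 'I_n -> set R) :
  (forall i, measurable (A i : set (measurableTypeR R))) ->
  measurable (rect A : set (@borel_rV R n)).
Proof.
move=> mA; rewrite (_ : rect A = \bigcap_i (@row_coord R n i @^-1` A i)).
  apply: fin_bigcap_measurable => // i _; rewrite -[X in measurable X]setTI.
  exact: measurable_row_coord.
by apply/seteqP; split=> y /= yA i; [move=> _|]; exact: yA.
Qed.

Lemma borel_lebesgue_rect n (A : 'I_n -> set R) :
  (forall i, measurable (A i : set (measurableTypeR R))) ->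
  borel_lebesgue_rV n (rect A) = (\prod_(i < n) lebesgue_measure (A i))%E.
Proof.
elim: n A => [|n IH] A mA.
  by rewrite big_ord0 /= diracE mem_set// => -[].
rewrite big_ord_recl -IH//= /lebesgue_rV_succ /pushforward.
rewrite (_ : _ @^-1` _ = A ord0 `*` rect (fun i => A (lift ord0 i))).
  by rewrite product_measure1E//; exact: measurable_rect.
apply/seteqP; split => [[a y]/= H|[a y]/= [Ha Hy] i].
  split; first by have := H ord0; rewrite mxE unlift_none.
  by move=> i; have := H (lift ord0 i); rewrite mxE liftK.
by rewrite mxE; have [j ->|->] := unliftP ord0 i => //=; exact: Hy.
Qed.

(** [borel_rV] and [leb_rV] are one space with two sigma-algebras. Explicit functions are shown
    measurable for the smaller one and transferred by this lemma; [U] and [V] are measurable only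
    for the larger one. *)
Lemma measurable_borel_lebesgue n d (T : measurableType d) (f : @borel_rV R n -> T) :
  measurable_fun setT f -> measurable_fun setT (f : leb_rV R n -> T).
Proof.
move=> mf _ B mB; apply: sub_caratheodory; apply: sub_sigma_algebra.
exact: mf.
Qed.

Lemma measurable_set_borel_lebesgue n (A : set (@borel_rV R n)) :
  measurable A -> measurable (A : set (leb_rV R n)).
Proof. by move=> mA; apply: sub_caratheodory; apply: sub_sigma_algebra. Qed.

Lemma lebesgue_rVE n (A : set (@borel_rV R n)) : measurable A ->
  lebesgue_rV R n A = borel_lebesgue_rV n A.
Proof. exact: measurable_mu_extE. Qed.

Lemma lebesgue_rV_rect n (A : 'I_n -> set R) :
  (forall i, measurable (A i : set (measurableTypeR R))) ->
  lebesgue_rV R n (rect A) = (\prod_(i < n) lebesgue_measure (A i))%E.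
Proof.
by move=> mA; rewrite lebesgue_rVE ?borel_lebesgue_rect//; exact: measurable_rect.
Qed.

(** Sigma-finiteness gives access to the product measure and Fubini's theorem, on which the
    Dirichlet forms rest. *)
HB.instance Definition _ n := @Measure_isSigmaFinite.Build _ _ _
  (@completed_measure_extension _ _ R (@borel_lebesgue_rV R n))
  (completed_measure_extension_sigma_finite
     (sigma_finiteT (@borel_lebesgue_rV R n))).

(** Rectangles with measurable sides are stable under intersection and generate the Borel sets, and
    the cubes [-k, k]^n exhaust the space with finite measure. *)
Lemma borel_measure_unique n (m : {measure set (@borel_rV R n) -> \bar R}) :
  (forall A : 'I_n -> set R,
    (forall i, measurable (A i : set (measurableTypeR R))) ->
    m (rect A) = borel_lebesgue_rV n (rect A)) ->
  forall A, measurable A -> m A = borel_lebesgue_rV n A.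
Proof.
move=> H A mA.
pose G : set (set (@borel_rV R n)) := [set B | exists2 A : 'I_n -> set R,
  (forall i, measurable (A i : set (measurableTypeR R))) & B = rect A].
pose g k : set (@borel_rV R n) := rect (fun _ => `[- k%:R, k%:R]%classic).
apply: (@measure_unique _ _ _ G g) => //.
- apply/seteqP; split.
    apply: smallest_sub; first exact: smallest_sigma_algebra.
    move=> C; rewrite -bigcup_seq => -[i _] [D mD <-].
    apply: sub_sigma_algebra; exists (fun j => if j == i then D else setT).
      by move=> j; case: eqP.
    apply/seteqP; split=> y /=.
      by move=> [_ Dy] j; case: eqP => // ->.
    by move=> /(_ i); rewrite eqxx.
  apply: smallest_sub; first exact: sigma_algebra_measurable.
  by move=> _ [C mC ->]; exact: measurable_rect.
- move=> _ _ [B mB ->] [C mC ->]; exists (fun i => B i `&` C i).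
    by move=> i; exact: measurableI.
  by apply/seteqP; split=> y /= => [[yB yC] i|yBC]; split => //; move=> i;
    case: (yBC i).
- by move=> k; exists (fun _ => `[- k%:R, k%:R]%classic).
- apply/seteqP; split => // y _.
  exists (Num.truncn (\sum_i `|y ord0 i|)).+1 => // i.
  rewrite /= in_itv/= -ler_norml; apply/ltW/(le_lt_trans _ (truncnS_gt _)).
  by rewrite (bigD1 i)//= lerDl sumr_ge0.
- by move=> B [C mC ->]; exact: H.
- move=> k; rewrite [ltLHS]H// borel_lebesgue_rect//.
  rewrite ltey_eq; apply/orP; left.
  elim/big_ind: _ => //= [x y|i _]; first exact: fin_numM.
  by rewrite lebesgue_measure_itv/=; case: ifP.
Qed.

(** The image measure under [phi] is identified on rectangles, hence on all Borel sets. With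
    [phi = id] this says that completing the measure does not change the integrals of Borel
    functions. *)
Lemma ge0_integral_lebesgue_rV_image n (phi : 'rV[R]_n -> 'rV[R]_n)
    (g : 'rV[R]_n -> \bar R) :
  measurable_fun setT (phi : @borel_rV R n -> @borel_rV R n) ->
  (forall A : 'I_n -> set R,
    (forall i, measurable (A i : set (measurableTypeR R))) ->
    lebesgue_rV R n (phi @^-1` rect A) = lebesgue_rV R n (rect A)) ->
  measurable_fun setT (g : @borel_rV R n -> \bar R) -> (forall x, 0 <= g x)%E ->
  (\int[lebesgue_rV R n]_x g (phi x) = \int[borel_lebesgue_rV n]_x g x)%E.
Proof.
move=> mphi Hphi mg g0.
have mphi' := measurable_borel_lebesgue mphi.
have := @ge0_integral_pushforward _ _ _ _ _ (phi : leb_rV R n -> @borel_rV R n)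
  mphi' (lebesgue_rV R n) setT g measurableT mg (fun y _ => g0 y).
rewrite preimage_setT => <-.
apply: eq_measure_integral => A mA _.
apply: (@borel_measure_unique n
  (measure_function_pushforward__canonical__measure_function_Measure
    (lebesgue_rV R n) mphi') _ A mA).
move=> B mB; apply: (etrans (Hphi B mB)).
by apply: lebesgue_rVE; exact: measurable_rect.
Qed.

Lemma lebesgue_measure_reflect (a : R) (A : set (measurableTypeR R)) :
  measurable A -> lebesgue_measure ((fun t => a - t) @^-1` A) = lebesgue_measure A.
Proof.
move=> mA.
have mf : measurable_fun [set: measurableTypeR R]
    ((fun t => a - t) : measurableTypeR R -> measurableTypeR R).
  by apply: measurable_funB => //; exact: measurable_id.
apply: esym; apply: (@lebesgue_measure_unique _
  (measure_function_pushforward__canonical__measure_function_Measure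
    lebesgue_measure mf) _ A mA) => _ [[x y]] _ <-.
rewrite /= /pushforward.
rewrite (_ : _ @^-1` _ = `[a - y, a - x[%classic).
  rewrite !lebesgue_measure_itv/= !lte_fin ltrD2l ltrN2.
  by case: ifP => // _; rewrite -!EFinB; congr EFin; ring.
apply/seteqP; split=> t /=; rewrite !in_itv/= => /andP[? ?]; apply/andP; split; lra.
Qed.

(** With a = 2x this is the symmetry y -> 2x - y, which turns first differences into second
    differences. *)
Lemma ge0_integral_reflect n (a : 'rV[R]_n) (g : 'rV[R]_n -> \bar R) :
  measurable_fun setT (g : @borel_rV R n -> \bar R) -> (forall x, 0 <= g x)%E ->
  (\int[lebesgue_rV R n]_x g (a - x)%R = \int[lebesgue_rV R n]_x g x)%E.
Proof.
move=> mg g0.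
rewrite (@ge0_integral_lebesgue_rV_image _ (fun x => a - x))//.
- rewrite -(@ge0_integral_lebesgue_rV_image _ id)//; exact: measurable_id.
- apply: measurable_to_row => i.
  rewrite (_ : (fun _ => _) = fun x => a ord0 i - row_coord i x).
    by apply: measurable_funB => //; exact: measurable_row_coord.
  by apply/funext => x; rewrite /row_coord !mxE.
- move=> A mA.
  rewrite (_ : _ @^-1` _ = rect (fun i => (fun t => a ord0 i - t) @^-1` A i)).
    rewrite !lebesgue_rV_rect//; last first.
      move=> i; rewrite -[X in measurable X]setTI.
      suff : measurable_fun [set: measurableTypeR R]
          ((fun t => a ord0 i - t) : measurableTypeR R -> measurableTypeR R).
        by move=> /(_ measurableT); exact.
      by apply: measurable_funB => //; exact: measurable_id.
    by apply: eq_bigr => i _; rewrite lebesgue_measure_reflect.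
  by apply/seteqP; split=> y /= H i; have := H i; rewrite /= !mxE.
Qed.

Lemma measurable_ball_rV n (x : 'rV[R]_n) e :
  measurable (ball x e : set (@borel_rV R n)).
Proof.
have [e0|e0] := ltP 0 e; last first.
  rewrite (_ : ball x e = set0)//; apply/seteqP; split => // y.
  by rewrite -ball_normE/= => /lt_le_trans -/(_ _ e0); rewrite ltNge normr_ge0.
rewrite (_ : ball x e = rect (fun i => ball (x ord0 i) e)).
  by apply: measurable_rect => i; exact: measurable_ball.
apply/seteqP; split=> y /=.
  by move=> [_ xy] i; exact: xy.
by move=> H; split => // i j; rewrite (ord1 i).
Qed.

(** The sigma-algebra is generated by coordinates, not by open sets, so second countability is used:
    an open set is the union of the sup-norm balls of rational centre and radius 1/(k+1) that it
    contains. *)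
Lemma open_measurable_rV n (A : set 'rV[R]_n) :
  open A -> measurable (A : set (@borel_rV R n)).
Proof.
move=> oA.
pose c (q : 'rV[rat]_n) : 'rV[R]_n := map_mx ratr q.
pose F (p : 'rV[rat]_n * nat) : set (@borel_rV R n) :=
  if `[< ball (c p.1) (p.2.+1%:R^-1) `<=` A >] then ball (c p.1) (p.2.+1%:R^-1)
  else set0.
rewrite (_ : A = \bigcup_p F p).
  apply: countable_bigcupT_measurable; first exact: countableP.
  by move=> p; rewrite /F; case: ifP => // _; exact: measurable_ball_rV.
apply/seteqP; split => [x Ax|x [p _]]; last first.
  by rewrite /F; case: asboolP => // H; exact: H.
have /nbhs_ballP[e/= e0 xeA] : nbhs x A by exact: open_nbhs_nbhs.
pose k := Num.truncn (2 / e).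
have k0 : 0 < k.+1%:R^-1 :> R by rewrite invr_gt0.
have ke : 2 * k.+1%:R^-1 < e.
  by rewrite ltr_pdivrMr// mulrC -ltr_pdivrMr// truncnS_gt.
have /choice[q Hq] : forall i : 'I_n, exists q : rat,
    `|x ord0 i - ratr q| < k.+1%:R^-1.
  move=> i; have : x ord0 i - k.+1%:R^-1 < x ord0 i + k.+1%:R^-1.
    by rewrite ltrBlDr -addrA ltrDl addr_gt0.
  move=> /rat_in_itvoo[q]; rewrite in_itv/= => q12; exists q.
  by rewrite ltr_distlC.
have cx : ball (c (\row_i q i)) k.+1%:R^-1 x.
  split => // i j; rewrite (ord1 i) /c !mxE /ball/= distrC; exact: Hq.
exists (\row_i q i, k) => //; rewrite /F/=; case: asboolP => // -[] y cy.
apply: xeA; apply: (le_ball (ltW ke)).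
rewrite mulr_natl mulr2n; apply: ball_triangle cy; exact: ball_sym.
Qed.

Lemma continuous_measurable_rV n (f : 'rV[R]_n -> R) :
  continuous f -> measurable_fun setT (f : @borel_rV R n -> R).
Proof.
move=> cf; apply: (measurability _ (RGenOpens.measurableE R)).
move=> _ [_ [a [b ->]] <-]; rewrite setTI.
apply: open_measurable_rV; move/continuousP: cf; apply; exact: interval_open.
Qed.

End borel_lebesgue.

Section euclidean_norm.
Context {R : realType} {d : nat}.
Implicit Types x y z : 'rV[R]_d.

Lemma enorm_ge0 x : 0 <= enorm x.
Proof. exact: sqrtr_ge0. Qed.

Lemma enorm_sqr x : enorm x ^+ 2 = \sum_(i < d) x ord0 i ^+ 2.
Proof. by rewrite sqr_sqrtr// sumr_ge0// => i _; exact: sqr_ge0. Qed.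

Lemma enorm0 : enorm (0 : 'rV[R]_d) = 0.
Proof.
by rewrite /enorm big1 ?sqrtr0// => i _; rewrite mxE expr0n.
Qed.

Lemma enormZ (a : R) x : enorm (a *: x) = `|a| * enorm x.
Proof.
rewrite /enorm -sqrtr_sqr -sqrtrM ?sqr_ge0// mulr_sumr; congr Num.sqrt.
by apply: eq_bigr => i _; rewrite mxE exprMn.
Qed.

Lemma enormN x : enorm (- x) = enorm x.
Proof. by rewrite -scaleN1r enormZ normrN1 mul1r. Qed.

Lemma enormB x y : enorm (x - y) = enorm (y - x).
Proof. by rewrite -enormN opprB. Qed.

Lemma le_enorm x y : (forall i, `|x ord0 i| <= `|y ord0 i|) -> enorm x <= enorm y.
Proof.
move=> xy; rewrite ler_wsqrtr// ler_sum// => i _.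
rewrite -(real_normK (num_real (x ord0 i))) -(real_normK (num_real (y ord0 i))).
by rewrite lerXn2r ?nnegrE.
Qed.

Lemma coord_le_enorm x i : `|x ord0 i| <= enorm x.
Proof.
rewrite -sqrtr_sqr ler_wsqrtr// (bigD1 i)//= lerDl sumr_ge0// => j _.
exact: sqr_ge0.
Qed.

Lemma coord_le_norm x i : `|x ord0 i| <= `|x|.
Proof.
rewrite [leRHS]mx_normrE.
exact: (@le_bigmax _ _ _ 0 (fun ij => `|x ij.1 ij.2|) (ord0, i)).
Qed.

Lemma norm_le_enorm x : `|x| <= enorm x.
Proof.
rewrite [leLHS]mx_normrE; apply: bigmax_le; first exact: enorm_ge0.
by move=> [i j] _ /=; rewrite (ord1 i) coord_le_enorm.
Qed.

Lemma enorm_le_norm x : enorm x <= d%:R * `|x|.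
Proof.
rewrite -(@ler_pXn2r _ 2)// ?nnegrE ?enorm_ge0 ?mulr_ge0// enorm_sqr.
apply: (@le_trans _ _ (\sum_(i < d) `|x| ^+ 2)).
  apply: ler_sum => i _; rewrite -(real_normK (num_real (x ord0 i))).
  by rewrite lerXn2r ?nnegrE// coord_le_norm.
rewrite sumr_const card_ord -[leLHS]mulr_natl exprMn ler_wpM2r ?sqr_ge0//.
by rewrite -natrX ler_nat -mulnn; case: (d) => // n; rewrite leq_pmull.
Qed.

Lemma enorm_eq0 x : enorm x = 0 -> x = 0.
Proof.
move=> x0; apply/eqP; rewrite -normr_le0 -x0; exact: norm_le_enorm.
Qed.

Lemma enorm_gt0 x : x != 0 -> 0 < enorm x.
Proof.
by move=> x0; rewrite lt_def enorm_ge0 andbT; apply: contra_neq x0 => /enorm_eq0.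
Qed.

(* Lagrange: (sum a^2)(sum b^2) - (sum ab)^2 = (1/2) sum_ij (a_i b_j - a_j b_i)^2 *)
Lemma enorm_CauchySchwarz x y :
  \sum_(i < d) x ord0 i * y ord0 i <= enorm x * enorm y.
Proof.
have [s0|s0] := leP (\sum_(i < d) x ord0 i * y ord0 i) 0.
  by apply: (le_trans s0); rewrite mulr_ge0// enorm_ge0.
rewrite -(@ler_pXn2r _ 2)// ?nnegrE ?mulr_ge0 ?enorm_ge0 ?(ltW s0)//.
rewrite exprMn !enorm_sqr -subr_ge0.
set A := \sum_(i < d) x ord0 i ^+ 2; set B := \sum_(i < d) y ord0 i ^+ 2.
set C := \sum_(i < d) x ord0 i * y ord0 i.
have : 0 <= \sum_(i < d) \sum_(j < d)
    (x ord0 i * y ord0 j - x ord0 j * y ord0 i) ^+ 2.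
  by do 2 (apply: sumr_ge0 => ? _); exact: sqr_ge0.
rewrite (_ : \sum_(i < d) _ = (A * B - C ^+ 2) *+ 2); first by rewrite pmulrn_lge0.
have E1 : \sum_(i < d) \sum_(j < d) (x ord0 i ^+ 2 * y ord0 j ^+ 2) = A * B.
  by rewrite /A mulr_suml; apply: eq_bigr => i _; rewrite -mulr_sumr.
have E2 : \sum_(i < d) \sum_(j < d) (x ord0 j ^+ 2 * y ord0 i ^+ 2) = A * B.
  by rewrite exchange_big.
have E3 : \sum_(i < d) \sum_(j < d)
    ((x ord0 i * y ord0 i) * (x ord0 j * y ord0 j)) = C ^+ 2.
  by rewrite expr2 {1}/C mulr_suml; apply: eq_bigr => i _; rewrite -mulr_sumr.
transitivity (\sum_(i < d) \sum_(j < d) (x ord0 i ^+ 2 * y ord0 j ^+ 2)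
  + \sum_(i < d) \sum_(j < d) (x ord0 j ^+ 2 * y ord0 i ^+ 2)
  - (\sum_(i < d) \sum_(j < d)
    ((x ord0 i * y ord0 i) * (x ord0 j * y ord0 j))) *+ 2); last first.
  by rewrite E1 E2 E3; ring.
rewrite -sumrMnl -big_split -sumrB/=; apply: eq_bigr => i _.
rewrite -sumrMnl -big_split -sumrB/=; apply: eq_bigr => j _.
by ring.
Qed.

Lemma enormD x y : enorm (x + y) <= enorm x + enorm y.
Proof.
rewrite -(@ler_pXn2r _ 2)// ?nnegrE ?addr_ge0 ?enorm_ge0//.
have -> : enorm (x + y) ^+ 2 = enorm x ^+ 2 + enorm y ^+ 2 +
    (\sum_(i < d) x ord0 i * y ord0 i) *+ 2.
  rewrite !enorm_sqr -sumrMnl -!big_split/=; apply: eq_bigr => i _.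
  by rewrite mxE; ring.
have := enorm_CauchySchwarz x y; rewrite sqrrD; lra.
Qed.

Lemma enorm_sub_le x y z : enorm (x - z) <= enorm (x - y) + enorm (y - z).
Proof. by rewrite (le_trans _ (enormD _ _))// subrKA. Qed.

Lemma enorm_sub_ge x y : enorm x - enorm y <= enorm (x - y).
Proof.
by rewrite lerBlDr (le_trans _ (enormD _ _))// subrK.
Qed.

Lemma continuous_enorm : continuous (@enorm R d).
Proof.
move=> x; apply: (@continuous_comp _ _ _ _ Num.sqrt); last exact: sqrt_continuous.
move: x; apply: continuous_big => [|i _ x]; first exact: add_continuous.
apply: (@continuous_comp _ _ _ (fun x : 'rV[R]_d => x ord0 i) (@GRing.exp R ^~ 2%N)).
  exact: coord_continuous.
exact: exprn_continuous.
Qed.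

Lemma parallelogram_enorm x h :
  enorm (x + h) ^+ 2 + enorm (x - h) ^+ 2 = (enorm x ^+ 2 + enorm h ^+ 2) *+ 2.
Proof.
rewrite !enorm_sqr -big_split -[in RHS]big_split -sumrMnl /=.
by apply: eq_bigr => i _; rewrite !mxE; ring.
Qed.

Lemma measurable_enorm : measurable_fun [set: @borel_rV R d] (@enorm R d).
Proof. by apply: continuous_measurable_rV; exact: continuous_enorm. Qed.

Lemma measurable_enormB : measurable_fun [set: leb_rV R d * leb_rV R d]
  (fun p => enorm ((p.1 : 'rV[R]_d) - p.2)).
Proof.
pose g (p : leb_rV R d * leb_rV R d) : @borel_rV R d := (p.1 : 'rV[R]_d) - p.2.
have mg : measurable_fun setT g.
  apply: measurable_to_row => i.
  rewrite (_ : (fun _ => _) = fun p : leb_rV R d * leb_rV R d =>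
      row_coord i (p.1 : @borel_rV R d) - row_coord i (p.2 : @borel_rV R d)).
    have mi := measurable_borel_lebesgue (@measurable_row_coord R d i).
    apply: measurable_funB.
      exact: (measurableT_comp mi measurable_fst).
    exact: (measurableT_comp mi measurable_snd).
  by apply/funext => p; rewrite /g /row_coord !mxE.
exact: (measurableT_comp measurable_enorm mg).
Qed.

Lemma compact_enorm_le (r : R) : compact [set x : 'rV[R]_d | enorm x <= r].
Proof.
apply: (@subclosed_compact _ _ (rect (fun _ => `[- r, r]%classic))).
- rewrite (_ : mkset _ = @enorm R d @^-1` [set t | t <= r])//.
  by apply: closed_comp => // x _; exact: continuous_enorm.
- by apply: rV_compact => i; exact: segment_compact.
- move=> x /= xr i /=; rewrite in_itv/= -ler_norml.
  exact: le_trans (coord_le_enorm _ _) xr.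
Qed.

Lemma compact_annulus (a b : R) : compact [set x : 'rV[R]_d | a <= enorm x <= b].
Proof.
apply: (@subclosed_compact _ _ [set x : 'rV[R]_d | enorm x <= b]).
- rewrite (_ : mkset _ = @enorm R d @^-1` `[a, b]%classic).
    apply: closed_comp => [x _|]; first exact: continuous_enorm.
    exact: itv_closed.
  by apply/seteqP; split=> x /=; rewrite in_itv.
- exact: compact_enorm_le.
- by move=> x /= /andP[].
Qed.

Lemma measurable_enorm_sub x :
  measurable_fun [set: @borel_rV R d] (fun y => enorm (x - y)).
Proof.
apply: continuous_measurable_rV => y.
apply: (@continuous_comp _ _ _ (fun y => x - y) (@enorm R d)).
  by apply: continuousB; [exact: cst_continuous|].
exact: continuous_enorm.
Qed.

Lemma measurable_eball x r : measurable (eball x r : set (leb_rV R d)).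
Proof.
apply: measurable_set_borel_lebesgue.
rewrite (_ : eball x r = (fun y => enorm (x - y)) @^-1` `]-oo, r[%classic).
  by rewrite -[X in measurable X]setTI; exact: measurable_enorm_sub.
by apply/seteqP; split=> y; rewrite /eball/= in_itv/= enormB.
Qed.

Lemma lebesgue_rV_cube x r : 0 <= r ->
  lebesgue_rV R d (rect (fun i => ball (x ord0 i) r)) = ((r *+ 2) ^+ d)%:E.
Proof.
move=> r0; rewrite lebesgue_rV_rect; last by move=> i; exact: measurable_ball.
under eq_bigr do rewrite lebesgue_measure_ball//.
by rewrite prodEFin prodr_const card_ord.
Qed.

(** The circumscribed cube has volume of the right order r^d, so the exact volume of a Euclidean
    ball is not computed. *)
Lemma lebesgue_rV_eball_le x r : 0 <= r ->
  (lebesgue_rV R d (eball x r) <= ((r *+ 2) ^+ d)%:E)%E.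
Proof.
move=> r0; rewrite -(lebesgue_rV_cube x)//; apply: le_measure; rewrite ?inE.
- exact: measurable_eball.
- apply: measurable_set_borel_lebesgue; apply: measurable_rect => i.
  exact: measurable_ball.
- move=> y xy i; rewrite /ball/= distrC.
  apply: le_lt_trans xy; rewrite (le_trans _ (coord_le_enorm _ i))//.
  by rewrite !mxE.
Qed.

End euclidean_norm.

(** * The fractional kernel *)

Section geometric_cover.
Context d (T : measurableType d) (R : realType)
  (mu : {measure set T -> \bar R}).
Local Open Scope ereal_scope.

(** The sum of the functions c_k 1_{B_k} dominates f, whatever the overlaps. In the applications the
    B_k are dyadic balls or intervals, used in place of disjoint shells. *)
Lemma integral_le_geometric (D : set T) (f : T -> \bar R) (B : nat -> set T)
    (c : nat -> R) (A q : R) :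
  measurable D -> measurable_fun D f -> (forall x, D x -> 0 <= f x) ->
  (forall k, measurable (B k)) -> (forall k, (0 <= c k)%R) -> (0 <= A)%R ->
  (0 < q < 1)%R -> (forall k, (c k)%:E * mu (B k) <= (A * q ^+ k)%:E) ->
  (forall x, D x -> f x != 0 -> exists2 k, B k x & f x <= (c k)%:E) ->
  \int[mu]_(x in D) f x <= (A / (1 - q))%:E.
Proof.
move=> mD mf f0 mB c0 A0 /andP[q0 q1] cB fB.
pose g k x : \bar R := (c k)%:E * (\1_(B k) x)%:E.
have mg k : measurable_fun D (g k).
  by apply: measurable_funeM; apply/measurable_EFinP; exact: measurable_indic.
have g0 k x : 0 <= g k x by rewrite mule_ge0// lee_fin.
apply: (@le_trans _ _ (\int[mu]_(x in D) \sum_(0 <= k <oo) g k x)).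
  apply: ge0_le_integral => //.
    by apply: ge0_emeasurable_sum => //.
  move=> x Dx; have [->|/(fB x Dx)[k Bkx fk]] := eqVneq (f x) 0.
    by apply: nneseries_ge0.
  apply: (le_trans fk); apply: le_trans (nneseries_lim_ge k.+1 _) => //.
  rewrite big_nat_recr//= -[leLHS]add0e; apply: leeD; first by rewrite sume_ge0.
  by rewrite /g indicE mem_set// mule1.
rewrite integral_nneseries//.
apply: (@le_trans _ _ (\sum_(0 <= k <oo) (A * q ^+ k)%:E)).
  apply: lee_nneseries => k _; first by rewrite integral_ge0.
  rewrite ge0_integralZl//; last by rewrite lee_fin.
  - rewrite integral_indic//; apply: le_trans (cB k).
    rewrite lee_wpmul2l ?lee_fin//; apply: le_measure; rewrite ?inE//.
    exact: measurableI.
  - by apply/measurable_EFinP; exact: measurable_indic.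
apply: lime_le.
  by apply: is_cvg_nneseries => k _ _; rewrite lee_fin mulr_ge0// exprn_ge0// ltW.
apply: nearW => n /=; rewrite sumEFin lee_fin.
have := @geometric_le_lim R n A q A0 q0; rewrite gtr0_norm// => /(_ q1).
by rewrite /series/= /geometric.
Qed.

End geometric_cover.

Section powers_of_two.
Context {R : realType}.
Implicit Types s t : R.

Lemma dyadic_ge1 s : 1 <= s -> exists k : nat, 2 ^+ k <= s < 2 ^+ k.+1.
Proof.
move=> s1.
have ex : exists k : nat, s < 2 ^+ k.+1.
  exists (Num.truncn s); apply: (lt_le_trans (truncnS_gt s)).
  by rewrite -natrX ler_nat ltnW// ltn_expl.
have := ex_minnP ex; case=> -[|m] sm min.
  by exists 0%N; rewrite expr0 s1.
exists m.+1; rewrite sm andbT leNgt; apply/negP => sm'.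
by have := min _ sm'; rewrite ltnn.
Qed.

Lemma dyadic_le1 s : 0 < s <= 1 -> exists k : nat, 2 ^- k.+1 <= s <= 2 ^- k.
Proof.
move=> /andP[s0 s1]; have : 1 <= s^-1 by rewrite invf_ge1.
move=> /dyadic_ge1[k /andP[ks sk]]; exists k.
rewrite -[s]invrK !lef_pV2 ?posrE ?exprn_gt0 ?invr_gt0//.
by rewrite (ltW sk) ks.
Qed.

Lemma powR_exp s t (k : nat) : (s `^ t) ^+ k = s `^ (t * k%:R).
Proof. by rewrite powRrM powR_mulrn// powR_ge0. Qed.

Lemma exp_powR2 t (k : nat) : (2 ^+ k) `^ t = (2 `^ t) ^+ k :> R.
Proof. by rewrite powR_exp -powR_mulrn// -powRrM mulrC. Qed.

End powers_of_two.

Section kernel.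
Context {R : realType} {d : nat}.
Implicit Types x y : 'rV[R]_d.

(** For d + a > 0 the kernel takes the default value 0 on the diagonal; lower bounds on it therefore
    ask for 0 < |x - y|. *)
Definition kern (a : R) x y : R := (enorm (x - y) `^ (d%:R + a))^-1.

Lemma kern_ge0 a x y : 0 <= kern a x y.
Proof. by rewrite invr_ge0 powR_ge0. Qed.

Lemma kernC a x y : kern a x y = kern a y x.
Proof. by rewrite /kern enormB. Qed.

Lemma kern_reflect a x y : kern a x (x + x - y) = kern a x y.
Proof. by rewrite /kern opprB addrA [X in enorm X](_ : _ = y - x) 1?enormB//;
  apply/rowP => i; rewrite !mxE; ring. Qed.

Lemma measurable_kern2 a : measurable_fun [set: leb_rV R d * leb_rV R d]
  (fun p => kern a p.1 p.2).
Proof.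
rewrite /kern (_ : (fun _ => _) = (@powR R ^~ (- (d%:R + a))) \o
   (fun p : leb_rV R d * leb_rV R d => enorm ((p.1 : 'rV[R]_d) - p.2))).
  by apply: measurableT_comp; [exact: measurable_powR|exact: measurable_enormB].
by apply/funext => p /=; rewrite powRN.
Qed.

Lemma measurable_kern a x : measurable_fun [set: @borel_rV R d] (kern a x).
Proof.
rewrite /kern (_ : (fun _ => _) =
    (@powR R ^~ (- (d%:R + a))) \o (fun y => enorm (x - y))).
  apply: measurableT_comp; first exact: measurable_powR.
  exact: measurable_enorm_sub.
by apply/funext => p /=; rewrite powRN.
Qed.

Lemma kern_le a x y (w : R) : 0 <= d%:R + a -> 0 < w -> w <= enorm (x - y) ->
  kern a x y <= (w `^ (d%:R + a))^-1.
Proof.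
move=> da w0 wxy; have xy0 := lt_le_trans w0 wxy.
rewrite lef_pV2 ?posrE ?powR_gt0// ge0_ler_powR// nnegrE; first exact: ltW.
exact: enorm_ge0.
Qed.

Lemma kern_ge a x y (w : R) : 0 <= d%:R + a -> 0 < enorm (x - y) ->
  enorm (x - y) <= w -> (w `^ (d%:R + a))^-1 <= kern a x y.
Proof.
move=> da xy0 wxy; have w0 := lt_le_trans xy0 wxy.
rewrite lef_pV2 ?posrE ?powR_gt0// ge0_ler_powR// nnegrE; last exact: ltW.
exact: enorm_ge0.
Qed.

Lemma powR_volume (a w : R) : 0 < w -> (w `^ (d%:R + a))^-1 * w ^+ d = w `^ (- a).
Proof.
move=> w0; rewrite powRD; last by rewrite (gt_eqF w0) implybT.
rewrite powR_mulrn ?(ltW w0)// powRN invfM mulrC mulrA divff ?mul1r//.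
by rewrite expf_neq0// gt_eqF.
Qed.

(* The two terms bound the integral over |x - y| >= rho and |x - y| < rho by
   geometric series over dyadic shells. *)
Definition kern_cst (a g : R) : R :=
  4 ^+ d / (1 - 2 `^ (- a)) + 8 ^+ d * 2 `^ a / (1 - 2 `^ (- (g - a))).

Lemma powR2_lt1 (t : R) : 0 < t -> 0 < (2 : R) `^ (- t) < 1.
Proof.
move=> t0; rewrite powR_gt0//= powRN invf_lt1 ?powR_gt0//.
have := @gt0_ltr_powR R t t0 1 2; rewrite !nnegrE powR1.
by apply => //; rewrite ltr1n.
Qed.

Lemma kern_cst_gt0 a g : 0 < a -> a < g -> 0 < kern_cst a g.
Proof.
move=> a0 ag; have /andP[_ a1] := powR2_lt1 a0.
have /andP[_ g1] : 0 < (2 : R) `^ (- (g - a)) < 1 by apply: powR2_lt1; lra.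
by rewrite addr_gt0// ?divr_gt0 ?mulr_gt0 ?exprn_gt0 ?powR_gt0//; lra.
Qed.

(** The common majorant of second differences at scale rho: of order g near the diagonal, where g >
    a beats the singularity of the kernel, and bounded far away, where the kernel is integrable. *)
Definition trunc_pow (g rho : R) x y : R :=
  Num.min 1 ((enorm (x - y) / rho) `^ g).

Lemma trunc_pow_ge0 g rho x y : 0 <= trunc_pow g rho x y.
Proof. by rewrite /trunc_pow le_min ler01 powR_ge0. Qed.

Lemma measurable_trunc_pow g rho x :
  measurable_fun [set: @borel_rV R d] (trunc_pow g rho x).
Proof.
apply: measurable_minr => //.
rewrite (_ : (fun _ => _) =
    (@powR R ^~ g) \o (fun y => enorm (x - y) * rho^-1))//.
apply: measurableT_comp; first exact: measurable_powR.
by apply: measurable_funM => //; exact: measurable_enorm_sub.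
Qed.

Lemma measurable_trunc_kern a g rho x :
  measurable_fun [set: @borel_rV R d]
    (fun y => (trunc_pow g rho x y * kern a x y)%:E).
Proof.
apply/measurable_EFinP; apply: measurable_funM.
  exact: measurable_trunc_pow.
exact: measurable_kern.
Qed.

Lemma integral_trunc_kern_le (a g : R) x (rho : R) : 0 < a -> a < g -> 0 < rho ->
  (\int[lebesgue_rV R d]_y (trunc_pow g rho x y * kern a x y)%:E
    <= (kern_cst a g * rho `^ (- a))%:E)%E.
Proof.
move=> a0 ag rho0; have da : 0 <= d%:R + a by rewrite addr_ge0// ltW.
pose D : set (leb_rV R d) := [set y | rho <= enorm (x - y)].
have mD : measurable D.
  apply: measurable_set_borel_lebesgue.
  rewrite (_ : D = (fun y => enorm (x - y)) @^-1` `[rho, +oo[%classic).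
    by rewrite -[X in measurable X]setTI; exact: measurable_enorm_sub.
  by apply/seteqP; split=> y; rewrite /D/= in_itv/= andbT.
have mf := measurable_borel_lebesgue (measurable_trunc_kern a g rho x).
have f0 y : (0 <= (trunc_pow g rho x y * kern a x y)%:E)%E.
  by rewrite lee_fin mulr_ge0 ?trunc_pow_ge0 ?kern_ge0.
rewrite -(setUv D) ge0_integral_setU//; first last.
- by rewrite disj_set2E setICr.
- by rewrite setUv.
- exact: measurableC.
rewrite /kern_cst mulrDl EFinD; apply: leeD.
- rewrite mulrAC; apply: (@integral_le_geometric _ _ _ (lebesgue_rV R d) _
    (fun y => (trunc_pow g rho x y * kern a x y)%:E)
    (fun k => eball x (2 ^+ k.+1 * rho))
    (fun k => ((2 ^+ k * rho) `^ (d%:R + a))^-1)) => //.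
  + exact: measurable_funTS.
  + by move=> k; exact: measurable_eball.
  + by move=> k; rewrite invr_ge0 powR_ge0.
  + by rewrite mulr_ge0 ?exprn_ge0 ?powR_ge0.
  + exact: powR2_lt1.
  + move=> k; have w0 : 0 < 2 ^+ k * rho by rewrite mulr_gt0 ?exprn_gt0.
    apply: le_trans (lee_wpmul2l _ (lebesgue_rV_eball_le _ _)) _.
    * by rewrite lee_fin invr_ge0 powR_ge0.
    * by rewrite mulr_ge0 ?exprn_ge0// ltW.
    rewrite -EFinM lee_fin.
    rewrite (_ : (2 ^+ k.+1 * rho) *+ 2 = 4 * (2 ^+ k * rho)); last by rewrite exprS; ring.
    rewrite exprMn mulrCA powR_volume// -mulrA ler_pM2l ?exprn_gt0//.
    by rewrite powRM ?exprn_ge0 ?(ltW rho0)// exp_powR2 mulrC.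
  + move=> y Dy _; have s1 : 1 <= enorm (x - y) / rho by rewrite ler_pdivlMr// mul1r.
    have [k /andP[sk ks]] := dyadic_ge1 s1; exists k.
      by rewrite /eball/= enormB -ltr_pdivrMr.
    rewrite lee_fin; apply: (@le_trans _ _ (kern a x y)).
      by rewrite ler_piMl ?kern_ge0// /trunc_pow ge_min lexx.
    by apply: kern_le => //; rewrite ?mulr_gt0 ?exprn_gt0// -ler_pdivlMr.
(* [dyadic_le1] bounds |x - y| / rho by 2^-k without strictness, hence open balls of radius 4 *
   2^-(k+1) = 2 * 2^-k. *)
- rewrite mulrAC; apply: (@integral_le_geometric _ _ _ (lebesgue_rV R d) _
    (fun y => (trunc_pow g rho x y * kern a x y)%:E)
    (fun k => eball x (4 * (2 ^- k.+1 * rho)))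
    (fun k => (2 ^- k) `^ g * ((2 ^- k.+1 * rho) `^ (d%:R + a))^-1)) => //.
  + exact: measurableC.
  + exact: measurable_funTS.
  + by move=> k; exact: measurable_eball.
  + by move=> k; rewrite mulr_ge0// ?invr_ge0 powR_ge0.
  + by rewrite !mulr_ge0 ?exprn_ge0 ?powR_ge0.
  + by apply: powR2_lt1; lra.
  + move=> k; have w0 : 0 < 2 ^- k.+1 * rho by rewrite mulr_gt0 ?invr_gt0 ?exprn_gt0.
    apply: le_trans (lee_wpmul2l _ (lebesgue_rV_eball_le _ _)) _.
    * by rewrite lee_fin mulr_ge0// ?invr_ge0 powR_ge0.
    * by rewrite mulr_ge0// ltW.
    rewrite -EFinM lee_fin.
    rewrite (_ : (4 * (2 ^- k.+1 * rho)) *+ 2 = 8 * (2 ^- k.+1 * rho)); last by ring.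
    rewrite exprMn -mulrA [X in _ * X]mulrCA powR_volume//.
    rewrite mulrCA -!mulrA ler_pM2l ?exprn_gt0//.
    rewrite powRM ?invr_ge0 ?exprn_ge0 ?(ltW rho0)//.
    have inv2 (n : nat) t : (2 ^- n) `^ t = 2 `^ (- t * n%:R) :> R.
      by rewrite -powR_inv1 ?exprn_ge0// -powRrM mulN1r -powR_mulrn// -powRrM;
        congr (_ `^ _); ring.
    rewrite !inv2 powR_exp [leLHS]mulrA [leRHS]mulrA [leRHS]mulrAC.
    rewrite ler_pM2r ?powR_gt0// -!powRD; try by rewrite pnatr_eq0 implybT.
    by apply: ler_powR; [lra|rewrite -natr1; lra].
  + move=> y /negP; rewrite -ltNge => Dy; rewrite eqe mulf_eq0 negb_or => /andP[fy _].
    have s0 : 0 < enorm (x - y).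
      rewrite lt_def enorm_ge0 andbT; apply: contra_neq fy => xy0.
      by rewrite /trunc_pow xy0 mul0r powR0 ?min_r ?gt_eqF//; lra.
    have s1 : 0 < enorm (x - y) / rho <= 1.
      by rewrite divr_gt0//= ler_pdivrMr// mul1r ltW.
    have [k /andP[sk ks]] := dyadic_le1 s1; exists k.
      rewrite /eball/= enormB mulrA -ltr_pdivrMr//; apply: le_lt_trans ks _.
      rewrite exprS invfM mulrA ltr_pMl ?invr_gt0 ?exprn_gt0//; lra.
    rewrite lee_fin ler_pM ?trunc_pow_ge0 ?kern_ge0//.
      rewrite /trunc_pow ge_min; apply/orP; right.
      have g0 : 0 <= g by lra.
      by rewrite ge0_ler_powR ?nnegrE ?invr_ge0 ?exprn_ge0// ltW//; case/andP: s1.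
    by apply: kern_le => //; rewrite ?mulr_gt0 ?invr_gt0 ?exprn_gt0// -ler_pdivlMr.
Qed.

End kernel.

(** * Positivity of the normalizing constant *)

Section gamma.
Context {R : realType}.
Implicit Types z t : R.

Let gammaf z t : R := t `^ (z - 1) * expR (- t).

Let gammaf_ge0 z t : (0 <= (gammaf z t)%:E)%E.
Proof. by rewrite lee_fin mulr_ge0 ?powR_ge0 ?expR_ge0. Qed.

Let measurable_gammaf z : measurable_fun [set: measurableTypeR R]
  (fun t => (gammaf z t)%:E).
Proof.
apply/measurable_EFinP; apply: measurable_funM; first exact: measurable_powR.
apply: measurableT_comp; first exact: measurable_expR.
by apply: measurable_funN; exact: measurable_id.
Qed.

Let gammaf_near0 z : 0 < z ->
  (\int[lebesgue_measure]_(t in `]0%R, 1%R]) (gammaf z t)%:E < +oo)%E.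
Proof.
move=> z0; apply: (@le_lt_trans _ _ (2 / (1 - 2 `^ (- z)))%:E); last exact: ltry.
apply: (@integral_le_geometric _ _ _ lebesgue_measure _
    (fun t => (gammaf z t)%:E) (fun k => `]0%R, (2 ^- k)%R]%classic)
    (fun k => (2 ^- k) `^ z * 2 ^+ k.+1)) => //.
- by apply: measurable_funTS; exact: measurable_gammaf.
- exact: powR2_lt1.
- move=> k; rewrite /= lebesgue_measure_itv/= lte_fin invr_gt0 exprn_gt0//.
  rewrite -EFinB -EFinM lee_fin subr0 powR_exp.
  rewrite -mulrA exprS -[2 * _ / _]mulrA divff ?expf_neq0// mulr1 mulrC ler_pM2l//.
  by rewrite -powR_inv1 ?exprn_ge0// -powR_mulrn// -!powRrM ler_powR//; lra.
- move=> t /=; rewrite in_itv/= => /andP[t0 t1] _.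
  have [k /andP[sk ks]] := dyadic_le1 (introT andP (conj t0 t1)); exists k.
    by rewrite /= in_itv/= t0.
  rewrite lee_fin /gammaf.
  apply: (@le_trans _ _ (t `^ (z - 1))).
    by rewrite ler_piMr ?powR_ge0// -expR0 ler_expR oppr_le0 ltW.
  rewrite powRD ?(gt_eqF t0) ?implybT// ler_pM ?powR_ge0//.
    by rewrite ge0_ler_powR ?nnegrE ?invr_ge0 ?exprn_ge0 ?(ltW t0) ?(ltW z0).
  by rewrite powR_inv1 ?(ltW t0)// -[leRHS]invrK lef_pV2 ?posrE ?invr_gt0 ?exprn_gt0.
Qed.

(** From t^(n+1) <= (n+1)! e^t with n + 1 > z + 1, the integrand is at most (n+1)! / t^2 for t >
    1. *)
Let gammaf_neary z : 0 < z ->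
  (\int[lebesgue_measure]_(t in `]1%R, +oo[) (gammaf z t)%:E < +oo)%E.
Proof.
move=> z0; pose n := Num.truncn (z + 1).
pose C : R := (n.+1)`!%:R.
have C0 : 0 < C by rewrite ltr0n fact_gt0.
apply: (@le_lt_trans _ _ ((2 * C) / (1 - 2^-1))%:E); last exact: ltry.
apply: (@integral_le_geometric _ _ _ lebesgue_measure _
    (fun t => (gammaf z t)%:E) (fun k => `]0%R, (2 ^+ k.+1)%R]%classic)
    (fun k => C * (2 ^- k * 2 ^- k))) => //.
- by apply: measurable_funTS; exact: measurable_gammaf.
- by move=> k; rewrite !mulr_ge0 ?invr_ge0 ?exprn_ge0// ltW.
- by rewrite mulr_ge0// ltW.
- by apply/andP; split; lra.
- move=> k; rewrite /= lebesgue_measure_itv/= lte_fin exprn_gt0//.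
  rewrite -EFinB -EFinM lee_fin subr0 exprVn exprS.
  have w0 : 2 ^+ k != 0 :> R by rewrite expf_neq0.
  by rewrite le_eqVlt; apply/orP; left; apply/eqP; field.
- move=> t /=; rewrite in_itv/= andbT => t1 _.
  have [k /andP[sk ks]] := dyadic_ge1 (ltW t1); exists k.
    by rewrite /= in_itv/= (lt_trans _ t1)//= ltW.
  have t0 : 0 < t by apply: lt_trans t1.
  rewrite lee_fin /gammaf.
  have -> : z - 1 = (z + 1) - 2%:R by ring.
  rewrite powRB ?(gt_eqF t0) ?implybT// powR_mulrn ?(ltW t0)//.
  rewrite mulrAC; apply: ler_pM.
  + by rewrite mulr_ge0 ?powR_ge0 ?expR_ge0.
  + by rewrite invr_ge0 exprn_ge0// ltW.
  + rewrite expRN ler_pdivrMr ?expR_gt0//.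
    apply: (@le_trans _ _ (t ^+ n.+1)).
      rewrite -powR_mulrn ?(ltW t0)// ler_powR ?(ltW t1)//.
      exact/ltW/truncnS_gt.
    have := @expR_ge1Dxn R t n (ltW t0).
    rewrite -/C -[in X in _ -> X]ler_pdivrMl// mulrC; lra.
  + rewrite -invfM lef_pV2 ?posrE ?exprn_gt0 ?mulr_gt0 ?exprn_gt0//.
    by rewrite expr2 ler_pM// ?exprn_ge0.
Qed.

(** A real-valued integral is 0 by default when the extended one is infinite, so positivity needs
    convergence at both ends besides a lower bound on [1, 2]. *)
Lemma Gamma_gt0 z : 0 < z -> 0 < Gamma z.
Proof.
move=> z0; rewrite /Gamma /Rintegral fine_gt0//; apply/andP; split.
  apply: (@lt_le_trans _ _ (\int[lebesgue_measure]_(t in `[1%R, 2%R]) (expR (- 2) / 2)%:E)%E).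
    rewrite integral_cst//= lebesgue_measure_itv/= lte_fin ltr1n -EFinB -EFinM lte_fin.
    by rewrite mulr_gt0 ?divr_gt0 ?expR_gt0//; lra.
  apply: (@le_trans _ _ (\int[lebesgue_measure]_(t in `[1%R, 2%R]) (gammaf z t)%:E)%E).
    apply: ge0_le_integral => //.
    - by apply: measurable_funTS; exact: measurable_gammaf.
    - move=> t /=; rewrite in_itv/= => /andP[t1 t2].
      rewrite lee_fin mulrC ler_pM ?expR_ge0//; last by rewrite ler_expR; lra.
      apply: (@le_trans _ _ (t `^ (-1))).
        by rewrite powR_inv1 ?lef_pV2 ?posrE//; lra.
      by rewrite ler_powR//; lra.
  apply: ge0_subset_integral => //; first by apply: measurable_funTS; exact: measurable_gammaf.
  by move=> t /=; rewrite !in_itv/= andbT => /andP[t1 _]; lra.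
have -> : `]0, +oo[%classic = `]0, 1]%classic `|` `]1, +oo[%classic :> set R.
  by rewrite -itv_bndbnd_setU// bnd_simp.
rewrite ge0_integral_setU//=; last first.
- rewrite disj_set2E; apply/eqP/seteqP; split=> // t /= []; rewrite !in_itv/= andbT.
  by move=> /andP[_ t1]; rewrite ltNge t1.
- by move=> t _; exact: gammaf_ge0.
- by apply: measurable_funTS; exact: (measurable_gammaf z).
by rewrite lte_add_pinfty// ?gammaf_near0 ?gammaf_neary.
Qed.

Lemma fraclap_const_gt0 (d : nat) (a : R) : 0 < a < 2 -> 0 < @fraclap_const R d a.
Proof.
move=> /andP[a0 a2]; rewrite /fraclap_const.
have dd : 0 <= d%:R :> R by [].
apply: divr_gt0; apply: mulr_gt0; rewrite ?powR_gt0 ?pi_gt0//.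
- by rewrite mulr_gt0// powR_gt0.
- by apply: Gamma_gt0; lra.
- by apply: Gamma_gt0; lra.
Qed.

End gamma.

(** * Second differences of Hoelder functions *)

Section coordinate_paths.
Context {R : realType} {d : nat}.
Implicit Types (x h y : 'rV[R]_d) (f : 'rV[R]_d -> R).

Local Notation e_ j := (delta_mx ord0 j : 'rV[R]_d).

Lemma directional_MVT f y j (s : R) :
  (forall t : R, `|t| <= `|s| -> derivable f (y + t *: e_ j) (e_ j)) ->
  exists2 c, `|c| <= `|s| &
    f (y + s *: e_ j) - f y = s * 'D_(e_ j) f (y + c *: e_ j).
Proof.
move=> df; pose phi t := f (y + t *: e_ j).
have shiftE (t : R) : (fun h : R => h^-1 *: ((phi \o shift t) (h *: (1 : R)) - phi t)) =
    (fun h : R => h^-1 *: ((f \o shift (y + t *: e_ j)) (h *: e_ j)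
      - f (y + t *: e_ j))).
  apply/funext => h; rewrite /phi /=; congr (_ *: (f _ - _)).
  by rewrite scalerDl [h *: 1]mulr1 addrCA.
have Dphi (t : R) : `|t| <= `|s| -> is_derive t (1 : R) phi ('D_(e_ j) f (y + t *: e_ j)).
  move=> ts; have := df t ts => dft; split.
    by rewrite /derivable shiftE.
  by rewrite /derive shiftE.
have cphi a b : (forall t, a <= t <= b -> `|t| <= `|s|) ->
    {within `[a, b], continuous phi}.
  move=> ab; apply: derivable_within_continuous => t; rewrite in_itv/= => tab.
  by have [] := Dphi t (ab _ tab).
have [s0|s0] := leP 0 s.
  have ab t : 0 <= t <= s -> `|t| <= `|s|.
    by move=> /andP[t0 ts]; rewrite !ger0_norm.
  have [||c] := @MVT_segment R phi (fun t => 'D_(e_ j) f (y + t *: e_ j)) 0 s s0.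
  - by move=> t; rewrite in_itv/= => /andP[/ltW t0 /ltW ts]; apply/Dphi/ab/andP.
  - exact: cphi.
  rewrite in_itv/= => /ab cs E; exists c => //.
  by move: E; rewrite /phi scale0r addr0 subr0 => ->; rewrite mulrC.
have ab t : s <= t <= 0 -> `|t| <= `|s|.
  by move=> /andP[st t0]; rewrite !ler0_norm ?(ltW s0)// lerN2.
have [||c] := @MVT_segment R phi (fun t => 'D_(e_ j) f (y + t *: e_ j)) s 0 (ltW s0).
- by move=> t; rewrite in_itv/= => /andP[/ltW t0 /ltW ts]; apply/Dphi/ab/andP.
- exact: cphi.
rewrite in_itv/= => /ab cs E; exists c => //.
by move: E; rewrite /phi scale0r addr0 sub0r => E; rewrite -opprB E; ring.
Qed.

Definition coord_le (k h : 'rV[R]_d) := forall i, `|k ord0 i| <= `|h ord0 i|.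

(** Only partial derivatives are at hand, so x is joined to x + h by segments parallel to the axes,
    [p n] keeping the first n coordinates of h. The path stays in the box |k_i| <= |h_i|, whence the
    form of the hypothesis. *)
Lemma path_MVT f x h :
  (forall k, coord_le k h -> forall i, derivable f (x + k) (e_ i)) ->
  exists2 xi : 'I_d -> 'rV[R]_d, (forall j, coord_le (xi j - x) h) &
    f (x + h) - f x = \sum_(j < d) h ord0 j * 'D_(e_ j) f (xi j).
Proof.
move=> df; pose p n : 'rV[R]_d := \row_i (if (i < n)%N then h ord0 i else 0).
have pS (j : 'I_d) : p j.+1 = p j + h ord0 j *: e_ j.
  apply/rowP => i; rewrite !mxE eqxx/= ltnS leq_eqVlt.
  have [/val_inj ->|/eqP ij] := eqVneq (i : nat) j.
    by rewrite ltnn eqxx mulr1 add0r.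
  have -> : (i == j) = false by apply/eqP => ij'; apply: ij; rewrite ij'.
  by rewrite mulr0 addr0.
have pc (j : 'I_d) t : `|t| <= `|h ord0 j| -> coord_le (p j + t *: e_ j) h.
  move=> tj i; rewrite !mxE eqxx/=; have [->|ij] := eqVneq i j.
    by rewrite ltnn mulr1 add0r.
  by rewrite mulr0 addr0; case: ifP => // _; rewrite normr0.
have /choice[c Hc] : forall j : 'I_d, exists c, `|c| <= `|h ord0 j| /\
    f (x + p j.+1) - f (x + p j) = h ord0 j * 'D_(e_ j) f (x + p j + c *: e_ j).
  move=> j; have [t tj|c cj E] := @directional_MVT f (x + p j) j (h ord0 j).
    by rewrite -addrA; apply: df; exact: pc.
  by exists c; split => //; rewrite pS addrA.
exists (fun j : 'I_d => x + p j + c j *: e_ j) => [j|].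
  have -> : x + p j + c j *: e_ j - x = p j + c j *: e_ j.
    by apply/rowP => i; rewrite !mxE; ring.
  by apply: pc; case: (Hc j).
under eq_bigr do rewrite -(Hc _).2.
rewrite -(big_mkord xpredT (fun j => f (x + p j.+1) - f (x + p j))).
rewrite telescope_sumr//; congr (f _ - f _).
  by congr (_ + _); apply/rowP => i; rewrite !mxE ltn_ord.
by apply/rowP => i; rewrite !mxE addr0.
Qed.

End coordinate_paths.

Section second_difference.
Context {R : realType} {d : nat}.
Implicit Types (x h y k : 'rV[R]_d) (u : 'rV[R]_d -> R) (K : set 'rV[R]_d).

Local Notation e_ j := (delta_mx ord0 j : 'rV[R]_d).

Lemma coord_leNr k h : coord_le k (- h) <-> coord_le k h.
Proof. by split=> H i; have := H i; rewrite mxE normrN. Qed.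

Lemma coord_le_enorm_le k h : coord_le k h -> enorm k <= enorm h.
Proof. exact: le_enorm. Qed.

Lemma compact_bounded_within K u : compact K -> {within K, continuous u} ->
  exists2 M : R, 0 < M & forall x, K x -> `|u x| <= M.
Proof.
move=> cK cu; have := compact_bounded (continuous_compact cu cK).
move=> /pinfty_ex_gt0[M M0 MK]; exists M => // x Kx.
by apply: MK; exists x.
Qed.

(* On x + {k : |k_i| <= |h_i|}, first derivatives oscillate at rate |h|^g',
   with g' + 1 > a. *)
Lemma holder_gradient K (a g : R) u (k : nat) (theta : R) :
  0 < a < 2 -> 0 < g -> compact K -> 0 < theta <= 1 -> a + g = k.+1%:R + theta ->
  Ck_holder K k.+1 theta u ->
  exists g' C : R, [/\ 0 < g', a < 1 + g', 0 < C &
    forall x h, (forall k, coord_le k h -> K (x + k)) ->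
      forall j k1 k2, coord_le k1 h -> coord_le k2 h ->
      `|'D_(e_ j) u (x + k1) - 'D_(e_ j) u (x + k2)| <= C * enorm h `^ g'].
Proof.
move=> /andP[a0 a2] g0 cK /andP[t0 t1] ag [du cu hu].
case: k ag du cu hu => [|k] ag du cu hu.
  have /choice[C HC] : forall j : 'I_d, exists C : R, forall x y, K x -> K y ->
      `|'D_(e_ j) u x - 'D_(e_ j) u y| <= C * enorm (x - y) `^ theta.
    by move=> j; have [C HC] := hu [:: j] erefl; exists C.
  exists theta, ((\sum_j `|C j| + 1) * 2 `^ theta); split => //; first lra.
    by rewrite mulr_gt0 ?powR_gt0// ltr_wpDl// sumr_ge0.
  move=> x h Kx j k1 k2 k1h k2h.
  apply: (le_trans (HC j _ _ (Kx _ k1h) (Kx _ k2h))).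
  rewrite -mulrA; apply: (@le_trans _ _ (`|C j| * enorm (x + k1 - (x + k2)) `^ theta)).
    by rewrite ler_wpM2r ?powR_ge0// ler_norm.
  apply: ler_pM => //; first exact: powR_ge0.
    by rewrite (bigD1 j)//= -addrA lerDl addr_ge0// sumr_ge0.
  rewrite -powRM ?enorm_ge0// ge0_ler_powR ?nnegrE ?mulr_ge0 ?enorm_ge0 ?(ltW t0)//.
  rewrite (_ : x + k1 - _ = k1 - k2); last by apply/rowP => i; rewrite !mxE; ring.
  rewrite (le_trans (enormD _ _))// enormN.
  have := coord_le_enorm_le k1h; have := coord_le_enorm_le k2h; lra.
(* With at least two derivatives, bounded second derivatives make the gradient Lipschitz: g' = 1 is
   admissible because a < 2. *)
have /choice[M HM] : forall ij : 'I_d * 'I_d, exists M : R, 0 < M /\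
    forall x, K x -> `|'D_(e_ ij.1) ('D_(e_ ij.2) u) x| <= M.
  move=> [i j]; have [M M0 HM] := compact_bounded_within cK (cu [:: i; j] isT).
  by exists M.
exists 1, ((\sum_ij M ij + 1) * d%:R * 2 + 1); split => //.
  have M0 : 0 <= \sum_ij M ij by apply: sumr_ge0 => ij _; case: (HM ij) => /ltW.
  by rewrite ltr_wpDl// !mulr_ge0// addr_ge0.
move=> x h Kx j.
have step k1 : coord_le k1 h ->
   `|'D_(e_ j) u (x + k1) - 'D_(e_ j) u x| <= (\sum_ij M ij + 1) * d%:R * enorm h.
  move=> k1h; have [|xi Hxi ->] := @path_MVT R d ('D_(e_ j) u) x k1.
    move=> k' k'k1 i; apply: (du [:: j] i) => //.
    by apply: Kx => l; exact: le_trans (k1h l).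
  apply: le_trans (ler_norm_sum _ _ _) _.
  apply: (@le_trans _ _ (\sum_(i < d) (\sum_ij M ij + 1) * enorm h)); last first.
    by rewrite sumr_const card_ord -[leLHS]mulr_natr mulrAC.
  apply: ler_sum => i _; rewrite normrM mulrC; apply: ler_pM => //.
    have /(HM (i, j)).2 : K (xi i).
      rewrite -[xi i](subrK x) addrC; apply: Kx => l.
      exact: le_trans (Hxi i l) (k1h l).
    move=> /le_trans; apply; rewrite (bigD1 (i, j))//= -addrA lerDl addr_ge0//.
    by apply: sumr_ge0 => ij _; case: (HM ij) => /ltW.
  by apply: le_trans (k1h i) _; exact: coord_le_enorm.
move=> k1 k2 k1h k2h; have := step _ k1h; have := step _ k2h.
rewrite powRr1 ?enorm_ge0// => /ler_normlP[A1 A2] /ler_normlP[B1 B2].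
have X0 := enorm_ge0 h.
by rewrite ler_norml; apply/andP; split; lra.
Qed.

(** The first-order terms of the increments along h and -h cancel, leaving h_i times an oscillation
    of the gradient. Without a derivative, the Hoelder bound is applied to each increment. The
    regularity is used only through an exponent g' > a. *)
Lemma holder_second_difference K (a g : R) u : 0 < a < 2 -> 0 < g ->
  compact K -> holder K (a + g) u ->
  exists g' C : R, [/\ a < g', 0 < C &
    forall x h, (forall k, coord_le k h -> K (x + k)) ->
      `|u x *+ 2 - u (x + h) - u (x - h)| <= C * enorm h `^ g'].
Proof.
move=> a02 g0 cK [[|k] [theta [t01 ag Hu]]].
  have [_ _ /(_ [::] erefl)[C HC]] := Hu.
  rewrite add0r in ag.
  exists theta, (`|C| * 2 + 1); split; [lra|by rewrite ltr_wpDl ?mulr_ge0|].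
  move=> x h Kx.
  have Kx0 : K x by rewrite -[x]addr0; apply: Kx => i; rewrite mxE normr0.
  have Kxh : K (x + h) by apply: Kx => i.
  have KxNh : K (x - h) by apply: Kx => i; rewrite mxE normrN.
  have /= := HC _ _ Kx0 Kxh; have /= := HC _ _ Kx0 KxNh.
  have -> : x - (x + h) = - h by rewrite opprD addrA subrr add0r.
  have -> : x - (x - h) = h by rewrite opprB addrC subrK.
  rewrite enormN.
  have : C * enorm h `^ theta <= `|C| * enorm h `^ theta.
    by rewrite ler_wpM2r ?powR_ge0// ler_norm.
  have := powR_ge0 (enorm h) theta.
  move=> p0 pC /ler_normlP[A1 A2] /ler_normlP[B1 B2].
  by rewrite ler_norml; apply/andP; split; lra.
have [g' [C [g'0 ag' C0 HC]]] := holder_gradient a02 g0 cK t01 ag Hu.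
exists (1 + g'), (d%:R * C + 1); split => //.
  by rewrite ltr_wpDl// mulr_ge0// ltW.
move=> x h Kx; have [du _ _] := Hu.
have [|xi Hxi Exi] := @path_MVT R d u x h.
  by move=> k' k'h i; apply: (du [::] i) => //; exact: Kx.
have [|eta Heta Eeta] := @path_MVT R d u x (- h).
  by move=> k' /coord_leNr k'h i; apply: (du [::] i) => //; exact: Kx.
have -> : u x *+ 2 - u (x + h) - u (x - h) =
    - ((u (x + h) - u x) + (u (x - h) - u x)) by ring.
rewrite normrN Exi Eeta -big_split/=.
apply: le_trans (ler_norm_sum _ _ _) _.
apply: (@le_trans _ _ (\sum_(i < d) C * enorm h `^ (1 + g'))); last first.
  rewrite sumr_const card_ord -[leLHS]mulr_natl mulrA ler_wpM2r ?powR_ge0//.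
  by rewrite lerDl.
apply: ler_sum => i _; rewrite mxE mulNr -mulrBr normrM.
have [h0|h0] := eqVneq (h ord0 i) 0.
  by rewrite h0 normr0 mul0r mulr_ge0 ?powR_ge0// ltW.
rewrite powRD; last by rewrite gt_eqF//; lra.
rewrite powRr1 ?enorm_ge0// mulrCA; apply: ler_pM => //.
  exact: coord_le_enorm.
rewrite -[xi i](subrK x) -[eta i](subrK x) ![_ - x + x]addrC.
by apply: HC => //; apply/coord_leNr; exact: Heta.
Qed.

Lemma holder_plus_second_difference (a : R) u (r1 r2 : R) : 0 < a < 2 ->
  holder_plus exterior a u -> 1 < r1 ->
  exists g C delta : R, [/\ a < g, 0 < C, 0 < delta &
    forall x h, r1 <= enorm x <= r2 -> enorm h <= delta ->
      `|u x *+ 2 - u (x + h) - u (x - h)| <= C * enorm h `^ g].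
Proof.
move=> a02 hu r11; pose del := (r1 - 1) / 2.
have del0 : 0 < del by rewrite /del; lra.
pose K : set 'rV[R]_d := [set x | r1 - del <= enorm x <= r2 + del].
have cK : compact K by exact: compact_annulus.
have [|g g0 hK] := hu K cK.
  by move=> x /andP[x1 _]; apply/negP; rewrite -ltNge /del in x1 *; lra.
have [g' [C [ag' C0 HC]]] := holder_second_difference a02 g0 cK hK.
exists g', C, del; split => // x h /andP[x1 x2] hd; apply: HC => k /coord_le_enorm_le kh.
have := enorm_sub_ge x (- k); have := enormD x k.
by rewrite opprK enormN => ? ?; apply/andP; split; lra.
Qed.

End second_difference.

(** * Real-valued integrals and the Dirichlet form *)

Section real_integrable.
Context d (T : measurableType d) (R : realType) (mu : {measure set T -> \bar R}).
Implicit Types f g : T -> R.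
Local Notation intg f := (mu.-integrable setT (EFin \o f)).

Lemma intgD f g : intg f -> intg g -> intg (fun x => f x + g x).
Proof. by move=> fi gi; have := integrableD measurableT fi gi; exact. Qed.

Lemma intgB f g : intg f -> intg g -> intg (fun x => f x - g x).
Proof. by move=> fi gi; have := integrableB measurableT fi gi; exact. Qed.

Lemma intgZl (r : R) f : intg f -> intg (fun x => r * f x).
Proof. by move=> fi; have := integrableZl measurableT r fi; exact. Qed.

Lemma intg_measurable f : intg f -> measurable_fun setT f.
Proof. by move=> /(measurable_int mu)/measurable_EFinP. Qed.

Lemma le_intg f g : measurable_fun setT f -> intg g ->
  (forall x, `|f x| <= g x) -> intg f.
Proof.
move=> mf ig fg; apply: (@le_integrable _ _ _ mu setT measurableT _ (EFin \o g)) => //.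
  exact/measurable_EFinP.
by move=> x _ /=; rewrite lee_fin (le_trans (fg x))// ler_norm.
Qed.

Lemma ge0_intg f (C : \bar R) : measurable_fun setT f -> (forall x, 0 <= f x) ->
  (\int[mu]_x (f x)%:E <= C)%E -> (C < +oo)%E -> intg f.
Proof.
move=> mf f0 fC Coo; apply/integrableP; split; first exact/measurable_EFinP.
apply: le_lt_trans Coo; apply: le_trans fC.
by under eq_integral do rewrite /= ger0_norm//.
Qed.

Lemma EFin_Rintegral f : intg f ->
  (\int[mu]_x f x)%:E = (\int[mu]_x (f x)%:E)%E.
Proof. by move=> fi; rewrite /Rintegral fineK//; exact: integrable_fin_num. Qed.

Lemma Rintegral_leP f (C : R) : intg f ->
  (\int[mu]_x (f x)%:E <= C%:E)%E <-> \int[mu]_x f x <= C.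
Proof. by move=> fi; rewrite -EFin_Rintegral// lee_fin. Qed.

Lemma le_Rint f g : intg f -> intg g -> (forall x, f x <= g x) ->
  \int[mu]_x f x <= \int[mu]_x g x.
Proof. by move=> fi gi fg; apply: le_Rintegral. Qed.

(** Undoes the shift by an integrable function that makes integrands nonnegative before Fatou's
    lemma; f is not yet known to be integrable at that point. *)
Lemma ge0_integral_cancel f g (B : R) : measurable_fun setT f ->
  (forall x, 0 <= f x) -> intg g -> (forall x, 0 <= g x) ->
  (\int[mu]_x (f x + g x)%:E <= (B + \int[mu]_x g x)%:E)%E ->
  (\int[mu]_x (f x)%:E <= B%:E)%E.
Proof.
move=> mf f0 ig g0; have mg := intg_measurable ig.
under eq_integral do rewrite EFinD.
rewrite ge0_integralD//; [|by move=> x _; rewrite lee_fin|exact/measurable_EFinP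
  |by move=> x _; rewrite lee_fin|exact/measurable_EFinP].
by rewrite EFinD -(EFin_Rintegral ig) leeD2rE.
Qed.

Lemma ge0_integral_scale f (c B : R) : measurable_fun setT f ->
  (forall x, 0 <= f x) -> 0 < c -> (\int[mu]_x (f x / c)%:E <= B%:E)%E ->
  (\int[mu]_x (f x)%:E <= (c * B)%:E)%E.
Proof.
move=> mf f0 c0 fcB.
rewrite (eq_integral (fun x => c%:E * (f x / c)%:E)%E); last first.
  by move=> x _; rewrite -EFinM mulrC divfK// gt_eqF.
rewrite ge0_integralZl//.
- by rewrite EFinM lee_wpmul2l// lee_fin ltW.
- by apply/measurable_EFinP; exact: measurable_funM.
- by move=> x _; rewrite lee_fin divr_ge0// ltW.
- by rewrite lee_fin ltW.
Qed.

End real_integrable.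

Section dirichlet.
Context d (T : measurableType d) (R : realType)
  (mu : {sigma_finite_measure set T -> \bar R}).
Implicit Types (f g u psi : T -> R) (F G : T * T -> R).
Local Notation intg f := (mu.-integrable setT (EFin \o f)).
Local Notation intg2 F := ((mu \x mu)%E.-integrable setT (EFin \o F)).

Lemma Rintegral_prod F : intg2 F -> (forall x, intg (fun y => F (x, y))) ->
  intg (fun x => \int[mu]_y F (x, y)) /\
  \int[mu]_x \int[mu]_y F (x, y) = \int[(mu \x mu)%E]_z F z.
Proof.
move=> iF iFx.
have E : (fun x => (\int[mu]_y F (x, y))%:E) = fubini_F mu (EFin \o F).
  by apply/funext => x; rewrite EFin_Rintegral.
split; first by rewrite /comp E; exact: integrable_fubini_F.
by rewrite {1}/Rintegral E integral12_prod_meas1.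
Qed.

Let swapF F : T * T -> R := fun z => F (z.2, z.1).

Lemma measurable_swapF F : measurable_fun setT F -> measurable_fun setT (swapF F).
Proof.
move=> mF; rewrite /swapF.
apply: (@measurableT_comp _ _ _ _ _ _ F _ (fun z : T * T => (z.2, z.1))) => //.
by apply/measurable_fun_pairP; split; [exact: measurable_snd|exact: measurable_fst].
Qed.

Lemma intg2_swap F : intg2 F -> intg2 (swapF F).
Proof.
move=> iF; have mF := intg_measurable iF.
apply/integrable21ltyP; first by apply/measurable_EFinP; exact: (measurable_swapF mF).
by have /integrable12ltyP := iF; apply; exact/measurable_EFinP.
Qed.

Lemma Rintegral_swap F : intg2 F ->
  \int[(mu \x mu)%E]_z swapF F z = \int[(mu \x mu)%E]_z F z.
Proof.
move=> iF; rewrite /Rintegral -[in LHS]integral21_prod_meas1//; last exact: intg2_swap.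
by rewrite -[in RHS]integral12_prod_meas1.
Qed.

Context (K : T -> T -> R).
Hypothesis K0 : forall x y, 0 <= K x y.
Hypothesis KC : forall x y, K x y = K y x.
Hypothesis mK : measurable_fun setT (fun z : T * T => K z.1 z.2).

(** Exchanging the variables in f(x) (g(x) - g(y)) K(x, y) and adding gives the symmetric form,
    whence the factor 2. The exchange rests on integrability over the product, which the truncation
    of the kernel provides in the applications. *)
Lemma dirichlet f g :
  intg2 (fun z => f z.1 * (g z.1 - g z.2) * K z.1 z.2) ->
  (forall x, intg (fun y => (g x - g y) * K x y)) ->
  intg2 (fun z => (f z.1 - f z.2) * (g z.1 - g z.2) * K z.1 z.2) /\
  \int[(mu \x mu)%E]_z ((f z.1 - f z.2) * (g z.1 - g z.2) * K z.1 z.2) =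
  2 * \int[mu]_x (f x * \int[mu]_y ((g x - g y) * K x y)).
Proof.
move=> iF iFx; set F := fun z : T * T => _ in iF.
have -> : (fun z => (f z.1 - f z.2) * (g z.1 - g z.2) * K z.1 z.2) =
    fun z => F z + swapF F z.
  by apply/funext => -[x y]; rewrite /swapF /F /= (KC y x); ring.
split; first by apply: intgD => //; exact: intg2_swap.
rewrite RintegralD//; last exact: intg2_swap.
rewrite Rintegral_swap//.
have iF' x : intg (fun y => F (x, y)).
  have := intgZl (f x) (iFx x); congr (integrable _ _ _).
  by apply/funext => y; rewrite /F/= mulrA.
rewrite -(Rintegral_prod iF iF').2.
have -> : (fun x => \int[mu]_y F (x, y)) =
    (fun x => f x * \int[mu]_y ((g x - g y) * K x y)).
  apply/funext => x; rewrite -RintegralZl//.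
  by apply: eq_Rintegral => y _; rewrite /F /= mulrA.
by ring.
Qed.

(** By Tonelli, 1_B(x) K(x, y) has integral at most kappa mu(B); the other indicator gives the
    swapped copy. *)
Lemma intg2_mulK (B : set T) (kappa c : R) F : measurable B -> (mu B < +oo)%E ->
  (forall x, \int[mu]_y (K x y)%:E <= kappa%:E)%E ->
  measurable_fun setT F -> 0 <= kappa -> 0 <= c ->
  (forall z, `|F z| <= c * (\1_B z.1 + \1_B z.2)) ->
  intg2 (fun z => F z * K z.1 z.2).
Proof.
move=> mB Boo Kk mF k0 c0 FB.
pose Q (z : T * T) := \1_B z.1 * K z.1 z.2 : R.
have mQ : measurable_fun setT Q.
  apply: measurable_funM => //.
  exact: measurableT_comp (measurable_indic _) measurable_fst.
have Q0 z : 0 <= Q z by rewrite mulr_ge0.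
have iQ : intg2 Q.
  apply: (@ge0_intg _ _ _ _ _ (kappa%:E * mu B)) => //.
    rewrite fubini_tonelli1//; last exact/measurable_EFinP.
    rewrite /fubini_F/=.
    apply: (@le_trans _ _ (\int[mu]_x (kappa%:E * (\1_B x)%:E))%E).
      apply: ge0_le_integral => //.
      - by move=> x _; apply: integral_ge0 => y _; rewrite lee_fin.
      - apply: (measurable_fun_fubini_tonelli_F (EFin \o Q)) => //; exact/measurable_EFinP.
      - by apply: measurable_funeM; (by apply/measurable_EFinP; exact: measurable_indic).
      - move=> x _; rewrite /Q /=; under eq_integral do rewrite EFinM.
        rewrite ge0_integralZl//.
        + by rewrite muleC lee_wpmul2r// lee_fin.
        + by apply/measurable_EFinP; exact: (measurableT_comp mK (pair1_measurable x)).
        + by move=> y _; rewrite lee_fin.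
    rewrite ge0_integralZl//; last (by apply/measurable_EFinP; exact: measurable_indic).
    by rewrite integral_indic// setIT.
  by rewrite lte_mul_pinfty// ?lee_fin.
have iQ2 := intg2_swap iQ.
apply: (le_intg (g := fun z => c * (Q z + swapF Q z))).
- exact: measurable_funM.
- by apply: intgZl; apply: intgD.
move=> z; rewrite normrM (ger0_norm (K0 _ _)) /Q /swapF/= (KC z.2).
by rewrite -mulrDl mulrA ler_wpM2r.
Qed.

End dirichlet.

Section product_integrals.
Context d (T : measurableType d) (R : realType)
  (mu : {sigma_finite_measure set T -> \bar R}).
Implicit Types (f h : T -> R).
Local Notation intg f := (mu.-integrable setT (EFin \o f)).
Local Notation intg2 F := ((mu \x mu)%E.-integrable setT (EFin \o F)).

Lemma intg_indic (A : set T) : measurable A -> (mu A < +oo)%E -> intg (\1_A : T -> R).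
Proof.
move=> mA Aoo; apply: (ge0_intg (C := mu A)) => //.
- by rewrite integral_indic// setIT.
Qed.

Lemma Rint_tensor f h : intg f -> intg h ->
  intg2 (fun z => f z.1 * h z.2) /\
  \int[(mu \x mu)%E]_z (f z.1 * h z.2) = (\int[mu]_x f x) * (\int[mu]_y h y).
Proof.
move=> fi hi.
have mf := intg_measurable fi; have mh := intg_measurable hi.
have i2 : intg2 (fun z => f z.1 * h z.2).
  apply/integrable12ltyP.
    apply/measurable_EFinP; apply: measurable_funM.
      exact: (measurableT_comp mf measurable_fst).
    exact: (measurableT_comp mh measurable_snd).
  have nh : intg (fun y => `|h y|) by exact: (integrable_abse hi).
  have nf : intg (fun y => `|f y|) by exact: (integrable_abse fi).
  have E x : (\int[mu]_y `|(EFin \o (fun z => (f z.1 * h z.2)%R)) (x, y)| =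
      (\int[mu]_y `|h y| * `|f x|)%:E)%E.
    rewrite -RintegralZr// EFin_Rintegral//.
      by apply: eq_integral => y _; rewrite /= normrM mulrC.
    have := intgZl `|f x| nh; congr (integrable _ _ _).
    by apply/funext => y /=; rewrite mulrC.
  under eq_integral do rewrite E.
  have nhf := intgZl (\int[mu]_y `|h y|) nf.
  by rewrite -EFin_Rintegral// ltry.
split => //.
have ix x : intg (fun y => f x * h y) by exact: intgZl.
rewrite -(Rintegral_prod i2 ix).2 /=.
under eq_Rintegral do rewrite RintegralZl//.
by rewrite RintegralZr.
Qed.

End product_integrals.

(** * Truncated fractional Laplacian *)

Section truncated_kernel.
Context {R : realType} {d : nat}.
Implicit Types (x y h : 'rV[R]_d) (a e g rho : R).
Local Notation mu := (lebesgue_rV R d).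
Local Notation intg f := (mu.-integrable setT (EFin \o f)).

Definition tkern a e x y : R := if e < enorm (x - y) then kern a x y else 0.

Lemma tkern_ge0 a e x y : 0 <= tkern a e x y.
Proof. by rewrite /tkern; case: ifP => // _; exact: kern_ge0. Qed.

Lemma tkern_le_kern a e x y : tkern a e x y <= kern a x y.
Proof. by rewrite /tkern; case: ifP => // _; exact: kern_ge0. Qed.

Lemma tkernC a e x y : tkern a e x y = tkern a e y x.
Proof. by rewrite /tkern enormB kernC. Qed.

Lemma reflect_sub x y : x - (x + x - y) = y - x.
Proof. by apply/rowP => i; rewrite !mxE; ring. Qed.

Lemma tkern_reflect a e x y : tkern a e x (x + x - y) = tkern a e x y.
Proof. by rewrite /tkern kern_reflect reflect_sub enormB. Qed.

Lemma measurable_tkern2 a e : measurable_fun [set: leb_rV R d * leb_rV R d]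
  (fun p => tkern a e p.1 p.2).
Proof.
apply: measurable_fun_ifT => //; last exact: measurable_kern2.
by apply: measurable_fun_ltr => //; exact: measurable_enormB.
Qed.

Lemma measurable_tkern a e x : measurable_fun [set: @borel_rV R d] (tkern a e x).
Proof.
apply: measurable_fun_ifT => //; last exact: measurable_kern.
by apply: measurable_fun_ltr => //; exact: measurable_enorm_sub.
Qed.

Lemma measurable_tkernL a e x : measurable_fun [set: leb_rV R d] (tkern a e x).
Proof. exact: (measurable_borel_lebesgue (measurable_tkern a e x)). Qed.

Lemma integral_tkern_le a e x : 0 < a -> a < 2 -> 0 < e ->
  (\int[mu]_y (tkern a e x y)%:E <= (@kern_cst R d a 2 * e `^ (- a))%:E)%E.
Proof.
move=> a0 a2 e0; apply: le_trans (integral_trunc_kern_le x a0 a2 e0).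
apply: ge0_le_integral => //.
- by move=> y _; rewrite lee_fin tkern_ge0.
- by apply/measurable_EFinP; exact: measurable_tkernL.
- exact: (measurable_borel_lebesgue (measurable_trunc_kern a 2 e x)).
move=> y _; rewrite lee_fin /tkern; case: ifPn => ey; last first.
  by rewrite mulr_ge0 ?trunc_pow_ge0 ?kern_ge0.
rewrite /trunc_pow min_l ?mul1r//.
have : (1 : R) `^ 2 <= (enorm (x - y) / e) `^ 2.
  rewrite ge0_ler_powR ?nnegrE ?divr_ge0 ?enorm_ge0 ?(ltW e0)//.
  by rewrite ler_pdivlMr// mul1r ltW.
by rewrite powR1.
Qed.

Lemma intg_tkern a e x : 0 < a -> a < 2 -> 0 < e -> intg (tkern a e x).
Proof.
move=> a0 a2 e0; apply: (ge0_intg (C := (@kern_cst R d a 2 * e `^ (- a))%:E)).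
- exact: measurable_tkernL.
- exact: tkern_ge0.
- exact: integral_tkern_le.
- exact: ltry.
Qed.

Definition weight_cst a e (M : R) : R :=
  (e `^ (d%:R + a))^-1 + (1 + M / e) `^ (d%:R + a).

(** If |x - y| > e and |x| <= M then |y| <= (1 + M / e) |x - y|, which is the origin of
    [weight_cst]. *)
Lemma tkern_le_weight a e M x y : 0 < a -> 0 < e -> enorm x <= M ->
  tkern a e x y <= weight_cst a e M / (1 + enorm y `^ (d%:R + a)).
Proof.
move=> a0 e0 xM; have M0 : 0 <= M := le_trans (enorm_ge0 x) xM.
have s0 : 0 <= d%:R + a by rewrite addr_ge0// ltW.
have y1 : 0 < 1 + enorm y `^ (d%:R + a) by rewrite ltr_pwDl// powR_ge0.
have w0 : 0 <= weight_cst a e M.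
  by rewrite addr_ge0 ?invr_ge0 ?powR_ge0.
rewrite /tkern; case: ifPn => exy; last by rewrite divr_ge0// ltW.
have xy0 : 0 < enorm (x - y) := lt_trans e0 exy.
rewrite ler_pdivlMr// /kern mulrC ler_pdivrMr ?powR_gt0// mulrDl; apply: lerD.
  rewrite -ler_pdivrMl ?invr_gt0 ?powR_gt0// invrK mulr1.
  by rewrite ge0_ler_powR ?nnegrE ?(ltW e0) ?(ltW exy)// ltW.
rewrite -powRM ?addr_ge0 ?divr_ge0 ?(ltW e0) ?enorm_ge0//.
rewrite ge0_ler_powR ?nnegrE ?enorm_ge0//.
  by rewrite mulr_ge0 ?addr_ge0 ?divr_ge0 ?(ltW e0) ?enorm_ge0.
have := enorm_sub_le y x 0; rewrite !subr0 enormB => /le_trans; apply.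
rewrite mulrDl mul1r lerD2l; apply: (le_trans xM).
by rewrite -mulrAC ler_pdivlMr// ler_wpM2l// ltW.
Qed.

Definition trunc_fraclap a e (u : 'rV[R]_d -> R) x : R :=
  \int[mu]_y ((u x - u y) * tkern a e x y).

Lemma fraclapE a (u : 'rV[R]_d -> R) x :
  fraclap a u x = @fraclap_const R d a * lim (trunc_fraclap a e u x @[e --> 0^'+]).
Proof.
rewrite /fraclap.
set f := (X in lim (fmap X _)); rewrite (_ : f = fun e => trunc_fraclap a e u x)//.
apply/funext => e; rewrite /f Rintegral_mkcond; congr fine.
apply: eq_integral => y _; congr EFin.
rewrite /patch /tkern /kern; case: ifPn => [|yD].
  by rewrite inE/= => ->.
by move: yD; rewrite notin_setE/= => /negP/negbTE ->; rewrite mulr0.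
Qed.

Section reflection.
Variables (x : 'rV[R]_d) (k u : 'rV[R]_d -> R).
Hypotheses (mk : measurable_fun [set: @borel_rV R d] k)
  (mu_ : measurable_fun [set: @borel_rV R d] u).
Hypotheses (k0 : forall y, 0 <= k y) (u0 : forall y, 0 <= u y).
Hypothesis kx : forall y, k (x + x - y) = k y.
Hypotheses (ik : intg k) (iuk : intg (fun y => u y * k y)).

Lemma intg_diff_kern : intg (fun y => (u x - u y) * k y).
Proof.
rewrite (_ : (fun _ => _) = fun y => u x * k y - u y * k y).
  by apply: intgB => //; exact: intgZl.
by apply/funext => y; rewrite mulrBl.
Qed.

(** The kernel and the measure are invariant under y -> 2x - y, so the integrand may be added to its
    reflection: this is where second differences enter. *)
Lemma reflect_diff : intg (fun y => (u x *+ 2 - u y - u (x + x - y)) * k y) /\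
  2 * \int[mu]_y ((u x - u y) * k y) =
  \int[mu]_y ((u x *+ 2 - u y - u (x + x - y)) * k y).
Proof.
have mruk : measurable_fun [set: @borel_rV R d] (fun y => u y * k y).
  exact: measurable_funM.
have E : (\int[mu]_y (u (x + x - y) * k y)%:E = \int[mu]_y (u y * k y)%:E)%E.
  have := @ge0_integral_reflect R d (x + x) (fun y => (u y * k y)%:E).
  move=> <-; last by move=> y; rewrite lee_fin mulr_ge0.
    by apply: eq_integral => y _; rewrite kx.
  exact/measurable_EFinP.
have mru : measurable_fun [set: leb_rV R d] (fun y => u (x + x - y)).
  have mr : measurable_fun [set: @borel_rV R d] (fun y => (x + x - y) : @borel_rV R d).
    apply: measurable_to_row => i.
    rewrite (_ : (fun _ => _) = fun y => (x + x) ord0 i - row_coord i y).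
      by apply: measurable_funB => //; exact: measurable_row_coord.
    by apply/funext => y; rewrite /row_coord !mxE.
  exact: (measurable_borel_lebesgue (measurableT_comp mu_ mr)).
have iru : intg (fun y => u (x + x - y) * k y).
  apply: (ge0_intg (C := (\int[mu]_y (u y * k y)%:E)%E)).
  - by apply: measurable_funM => //; exact: (measurable_borel_lebesgue mk).
  - by move=> y; rewrite mulr_ge0.
  - by rewrite E.
  - by rewrite -EFin_Rintegral// ltry.
have H := intg_diff_kern.
have -> : (fun y => (u x *+ 2 - u y - u (x + x - y)) * k y) =
    fun y => (u x - u y) * k y + (u x * k y - u (x + x - y) * k y).
  by apply/funext => y; ring.
have iuxk : intg (fun y => u x * k y) by exact: intgZl.
split; first by apply: intgD => //; exact: intgB.
rewrite RintegralD//; last exact: intgB.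
rewrite (RintegralB measurableT iuxk iru) mulr2n mulrDl mul1r.
congr (_ + _).
under eq_Rintegral do rewrite mulrBl.
by rewrite RintegralB//; congr (_ - _); rewrite /Rintegral E.
Qed.

End reflection.

End truncated_kernel.

(** * The truncated paraboloid, used both as barrier and as cutoff *)

Section paraboloid.
Context {R : realType} {d : nat}.
Implicit Types (x y h : 'rV[R]_d) (a e g rho : R).
Local Notation mu := (lebesgue_rV R d).

(** The positive part leaves this bump only Lipschitz, but the operator is only bounded from above
    on it or on its square, and the convex kink is harmless there. *)
Definition paraboloid (x0 : 'rV[R]_d) rho y : R :=
  Num.max 0 (1 - (enorm (y - x0) / rho) ^+ 2).

Lemma paraboloid_ge0 x0 rho y : 0 <= paraboloid x0 rho y.
Proof. by rewrite /paraboloid le_max lexx. Qed.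

Lemma paraboloid_le1 x0 rho y : paraboloid x0 rho y <= 1.
Proof. by rewrite /paraboloid ge_max ler01/= gerBl sqr_ge0. Qed.

Lemma paraboloid_center x0 rho : paraboloid x0 rho x0 = 1.
Proof. by rewrite /paraboloid subrr enorm0 mul0r expr0n subr0 max_r. Qed.

Lemma paraboloid_eq0 x0 rho y : 0 < rho -> rho <= enorm (y - x0) -> paraboloid x0 rho y = 0.
Proof.
move=> r0 ry; rewrite /paraboloid max_l// subr_le0 -[leLHS](expr1n _ 2).
by rewrite lerXn2r ?nnegrE ?divr_ge0 ?enorm_ge0 ?(ltW r0)// ler_pdivlMr// mul1r.
Qed.

Lemma paraboloid_ge x0 rho y (t : R) : 0 < rho -> 0 <= t -> enorm (y - x0) <= t * rho ->
  1 - t ^+ 2 <= paraboloid x0 rho y.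
Proof.
move=> r0 t0 yt; rewrite /paraboloid le_max; apply/orP; right.
rewrite lerD2l lerN2 lerXn2r ?nnegrE ?divr_ge0 ?enorm_ge0 ?(ltW r0)//.
by rewrite ler_pdivrMr.
Qed.

Lemma continuous_paraboloid x0 rho : continuous (paraboloid x0 rho).
Proof.
rewrite (_ : paraboloid x0 rho =
    (fun t => Num.max 0 (1 - (t / rho) ^+ 2)) \o (fun y => enorm (y - x0))); last first.
  by apply/funext.
move=> y; apply: continuous_comp.
  apply: (@continuous_comp _ _ _ (fun y => y - x0) (@enorm R d)).
    by apply: continuousB => //; exact: cst_continuous.
  exact: continuous_enorm.
set t := enorm (y - x0); pose g (t : R) : R^o := 1 - (t / rho) ^+ 2.
suff cg : {for t, continuous g}.
  by have := @continuous_max _ _ (cst 0) g t _ cg; apply; exact: cst_continuous.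
apply: continuousB; first exact: cst_continuous.
apply: (@continuous_comp _ _ _ (fun t : R => t / rho) (@GRing.exp R ^~ 2%N)).
  exact: mulrr_continuous.
exact: exprn_continuous.
Qed.

Lemma measurable_paraboloid x0 rho : measurable_fun [set: @borel_rV R d] (paraboloid x0 rho).
Proof. by apply: continuous_measurable_rV; exact: continuous_paraboloid. Qed.

Lemma reflectE x y : x + x - y = x - (y - x).
Proof. by apply/rowP => i; rewrite !mxE; ring. Qed.

(* The reflected second difference of 1 - |.|^2/rho^2 is exactly 2|h|^2/rho^2,
   and taking the positive part can only decrease it at points where it is
   positive. *)
Lemma paraboloid_second_difference x0 rho x y : 0 < rho ->
  paraboloid x0 rho x *+ 2 - paraboloid x0 rho y - paraboloid x0 rho (x + x - y) <=
    2 * trunc_pow 2 rho x y.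
Proof.
move=> r0; rewrite /trunc_pow minr_pMr// le_min mulr1; apply/andP; split.
  have := paraboloid_le1 x0 rho x; have := paraboloid_ge0 x0 rho y.
  have := paraboloid_ge0 x0 rho (x + x - y); lra.
rewrite powR_mulrn ?divr_ge0 ?enorm_ge0 ?(ltW r0)//.
have := paraboloid_ge0 x0 rho y; have := paraboloid_ge0 x0 rho (x + x - y).
have [->|bx] := eqVneq (paraboloid x0 rho x) 0.
  by have := sqr_ge0 (enorm (x - y) / rho); lra.
have E : paraboloid x0 rho x = 1 - (enorm (x - x0) / rho) ^+ 2.
  by move: bx; rewrite /paraboloid; case: leP => //; rewrite eqxx.
rewrite E => _ _.
have B z : 1 - (enorm (z - x0) / rho) ^+ 2 <= paraboloid x0 rho z.
  by rewrite /paraboloid le_max lexx orbT.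
have := B y; have := B (x + x - y); rewrite !expr_div_n.
have := parallelogram_enorm (x - x0) (y - x).
have -> : x - x0 + (y - x) = y - x0 by apply/rowP => i; rewrite !mxE; ring.
have -> : x - x0 - (y - x) = x + x - y - x0 by apply/rowP => i; rewrite !mxE; ring.
rewrite (enormB y x).
set A := enorm (y - x0) ^+ 2; set A' := enorm (x + x - y - x0) ^+ 2.
move=> P B1 B2; have {}P : A / rho ^+ 2 + A' / rho ^+ 2 =
   (enorm (x - x0) ^+ 2 / rho ^+ 2 + enorm (x - y) ^+ 2 / rho ^+ 2) *+ 2.
  by rewrite -!mulrDl P mulrnAl.
by move: P B1 B2; rewrite mulr2n; lra.
Qed.

(** By convexity of the square, 2b^2 - b1^2 - b2^2 <= 2b (2b - b1 - b2), the defect being (b - b1)^2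
    + (b - b2)^2; this reduces to the second difference of the paraboloid itself. *)
Lemma paraboloid2_second_difference x0 rho x y : 0 < rho ->
  paraboloid x0 rho x ^+ 2 *+ 2 - paraboloid x0 rho y ^+ 2 - paraboloid x0 rho (x + x - y) ^+ 2 <=
    4 * trunc_pow 2 rho x y.
Proof.
move=> r0; have := paraboloid_second_difference x0 x y r0.
have := paraboloid_ge0 x0 rho x; have := paraboloid_le1 x0 rho x.
have := trunc_pow_ge0 2 rho x y.
set b := paraboloid _ _ x; set b1 := paraboloid _ _ y; set b2 := paraboloid _ _ (x + x - y).
move=> t0 b_1 b_0 H.
have : b ^+ 2 *+ 2 - b1 ^+ 2 - b2 ^+ 2 <= 2 * b * (b *+ 2 - b1 - b2).
  by have := sqr_ge0 (b - b1); have := sqr_ge0 (b - b2); rewrite !expr2 !mulr2n; lra.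
move=> /le_trans; apply.
apply: (@le_trans _ _ (2 * b * (2 * trunc_pow 2 rho x y))).
  by rewrite ler_wpM2l// mulr_ge0.
by nra.
Qed.

(** The profile 1 - s^2 is 2-Lipschitz on [0, 1], hence the factor 4 after squaring. *)
Lemma paraboloid_lipschitz x0 rho x y : 0 < rho ->
  (paraboloid x0 rho x - paraboloid x0 rho y) ^+ 2 <= 4 * trunc_pow 2 rho x y.
Proof.
move=> r0; rewrite /trunc_pow minr_pMr// le_min mulr1; apply/andP; split.
  have := paraboloid_ge0 x0 rho x; have := paraboloid_le1 x0 rho x.
  have := paraboloid_ge0 x0 rho y; have := paraboloid_le1 x0 rho y.
  by nra.
rewrite powR_mulrn ?divr_ge0 ?enorm_ge0 ?(ltW r0)//.
rewrite (_ : 4 = 2 ^+ 2 :> R); last by ring.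
rewrite -exprMn.
wlog xy : x y / paraboloid x0 rho y <= paraboloid x0 rho x.
  move=> W; have [xy|/ltW yx] := leP (paraboloid x0 rho y) (paraboloid x0 rho x); first exact: W.
  by rewrite -sqrrN opprB enormB; exact: W.
have s0 : 0 <= enorm (x - y) / rho by rewrite divr_ge0 ?enorm_ge0 ?(ltW r0).
rewrite lerXn2r ?nnegrE ?subr_ge0 ?(mulr_ge0 _ s0)//.
have [bx|bx] := eqVneq (paraboloid x0 rho x) 0.
  by have := paraboloid_ge0 x0 rho y; rewrite bx; lra.
have E : paraboloid x0 rho x = 1 - (enorm (x - x0) / rho) ^+ 2.
  by move: bx; rewrite /paraboloid; case: leP => //; rewrite eqxx.
have sx : enorm (x - x0) / rho < 1.
  rewrite ltNge; apply/negP => h; move: bx; rewrite paraboloid_eq0 ?eqxx//.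
  by move: h; rewrite ler_pdivlMr// mul1r.
have t0 : 0 <= enorm (y - x0) / rho by rewrite divr_ge0 ?enorm_ge0 ?(ltW r0).
have t1 : 0 <= enorm (x - x0) / rho by rewrite divr_ge0 ?enorm_ge0 ?(ltW r0).
have st : enorm (y - x0) / rho <= enorm (x - y) / rho + enorm (x - x0) / rho.
  rewrite -mulrDl ler_pM2r ?invr_gt0// (enormB x y).
  exact: enorm_sub_le.
have [y1|y1] := leP 1 (enorm (y - x0) / rho).
  have -> : paraboloid x0 rho y = 0.
    by rewrite paraboloid_eq0//; move: y1; rewrite ler_pdivlMr// mul1r.
  by rewrite E; nra.
have : 1 - (enorm (y - x0) / rho) ^+ 2 <= paraboloid x0 rho y.
  by rewrite /paraboloid le_max lexx orbT.
by rewrite E; nra.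
Qed.

(** After reflection the integrand is at most L min(1, |x - y|^2 / rho^2) times the untruncated
    kernel, integrable since a < 2; the bound is thus uniform in e. *)
Lemma trunc_fraclap_le a e rho (L : R) (f : 'rV[R]_d -> R) x : 0 < a < 2 -> 0 < e -> 0 < rho ->
  measurable_fun [set: @borel_rV R d] f -> (forall y, 0 <= f y <= 1) -> 0 <= L ->
  (forall y, f x *+ 2 - f y - f (x + x - y) <= L * trunc_pow 2 rho x y) ->
  trunc_fraclap a e f x <= L / 2 * @kern_cst R d a 2 * rho `^ (- a).
Proof.
move=> /andP[a0 a2] e0 r0 mf f01 L0 fL.
have ik := @intg_tkern R d a e x a0 a2 e0.
have ifk : mu.-integrable setT (EFin \o (fun y => f y * tkern a e x y)).
  apply: (le_intg _ ik).
    apply: measurable_funM; last exact: measurable_tkernL.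
    exact: (measurable_borel_lebesgue mf).
  move=> y; have /andP[f0 f1] := f01 y.
  by rewrite ger0_norm ?mulr_ge0 ?tkern_ge0// ler_piMl// tkern_ge0.
have [i2 E] := @reflect_diff R d x (tkern a e x) f (measurable_tkern a e x) mf
  (tkern_ge0 a e x) (fun y => (andP (f01 y)).1) (tkern_reflect a e x) ik ifk.
rewrite -(@ler_pM2l _ 2)// {1}/trunc_fraclap E.
have -> : 2 * (L / 2 * @kern_cst R d a 2 * rho `^ (- a)) = L * (@kern_cst R d a 2 * rho `^ (- a)).
  by field.
have mtk := measurable_borel_lebesgue (@measurable_trunc_kern R d a 2 rho x).
have /measurable_EFinP mtk' := mtk.
have it : mu.-integrable setT (EFin \o (fun y => trunc_pow 2 rho x y * kern a x y)).
  apply: (ge0_intg mtk' _ (integral_trunc_kern_le x a0 a2 r0)); last exact: ltry.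
  by move=> y; rewrite mulr_ge0 ?trunc_pow_ge0 ?kern_ge0.
apply: (@le_trans _ _ (\int[mu]_y (L * (trunc_pow 2 rho x y * kern a x y)))).
  apply: le_Rint => //; first exact: intgZl.
  move=> y; apply: (@le_trans _ _ (L * trunc_pow 2 rho x y * tkern a e x y)).
    by rewrite ler_wpM2r// tkern_ge0.
  by rewrite -mulrA !ler_wpM2l ?trunc_pow_ge0 ?tkern_le_kern.
rewrite RintegralZl//; apply: ler_wpM2l => //.
by apply/Rintegral_leP => //; exact: integral_trunc_kern_le.
Qed.

End paraboloid.

Section nonnegative_weighted.
Context {R : realType} {d : nat}.
Implicit Types (x y h : 'rV[R]_d) (e g rho : R).
Local Notation mu := (lebesgue_rV R d).
Local Notation intg f := (mu.-integrable setT (EFin \o f)).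
Variables (a : R) (u : 'rV[R]_d -> R).
Hypotheses (a02 : 0 < a < 2) (cu : continuous u) (u0 : forall x, 0 <= u x)
  (wu : weighted_L1 a u).

Let a0 : 0 < a. Proof. by case/andP: a02. Qed.
Let a2 : a < 2. Proof. by case/andP: a02. Qed.

Lemma continuous_measurable_borel_rV : measurable_fun [set: @borel_rV R d] u.
Proof. exact: continuous_measurable_rV. Qed.

Lemma continuous_measurable_leb_rV : measurable_fun [set: leb_rV R d] u.
Proof. exact: (measurable_borel_lebesgue continuous_measurable_borel_rV). Qed.

Let wi : intg (fun y => u y / (1 + enorm y `^ (d%:R + a))).
Proof. exact: wu. Qed.

Definition wint : R := \int[mu]_y (u y / (1 + enorm y `^ (d%:R + a))).

Lemma u_tkern_le e M x y : 0 < e -> enorm x <= M ->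
  u y * tkern a e x y <= @weight_cst R d a e M * (u y / (1 + enorm y `^ (d%:R + a))).
Proof.
move=> e0 xM; rewrite mulrCA ler_wpM2l//.
exact: tkern_le_weight.
Qed.

Lemma intg_u_tkern e x : 0 < e -> intg (fun y => u y * tkern a e x y).
Proof.
move=> e0; have := intgZl (@weight_cst R d a e (enorm x)) wi => H.
apply: (le_intg _ H).
  by apply: measurable_funM; [exact: continuous_measurable_leb_rV|exact: measurable_tkernL].
move=> y; rewrite ger0_norm ?mulr_ge0 ?tkern_ge0//.
exact: u_tkern_le.
Qed.

Lemma Rint_u_tkern_le e M x : 0 < e -> enorm x <= M ->
  \int[mu]_y (u y * tkern a e x y) <= @weight_cst R d a e M * wint.
Proof.
move=> e0 xM; rewrite /wint -(RintegralZl _ measurableT wi).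
apply: le_Rint; first exact: intg_u_tkern.
  exact: (intgZl (@weight_cst R d a e M) wi).
by move=> y; exact: u_tkern_le.
Qed.

Lemma intg_trunc_fraclap e x : 0 < e -> intg (fun y => (u x - u y) * tkern a e x y).
Proof.
move=> e0; apply: intg_diff_kern; first exact: intg_tkern.
exact: intg_u_tkern.
Qed.

Lemma trunc_fraclapE e x : 0 < e ->
  trunc_fraclap a e u x = u x * \int[mu]_y tkern a e x y - \int[mu]_y (u y * tkern a e x y).
Proof.
move=> e0; have ik := @intg_tkern R d a e x a0 a2 e0.
rewrite -RintegralZl// -RintegralB//; [|exact: intgZl|exact: intg_u_tkern].
by apply: eq_Rintegral => y _; rewrite mulrBl.
Qed.

Lemma trunc_fraclap_split e del x : 0 < e -> e <= del ->
  trunc_fraclap a e u x = trunc_fraclap a del u x +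
    \int[mu]_y ((u x - u y) * (tkern a e x y - tkern a del x y)).
Proof.
move=> e0 ed; have d0 : 0 < del := lt_le_trans e0 ed.
have -> : (fun y => (u x - u y) * (tkern a e x y - tkern a del x y)) =
    fun y => (u x - u y) * tkern a e x y - (u x - u y) * tkern a del x y.
  by apply/funext => y; rewrite mulrBr.
rewrite RintegralB//; [|exact: intg_trunc_fraclap|exact: intg_trunc_fraclap].
by rewrite addrC subrK.
Qed.

Lemma tkern_anti e del x y : e <= del -> tkern a del x y <= tkern a e x y.
Proof.
move=> ed; rewrite /tkern; case: ifPn => [dxy|_].
  by rewrite (le_lt_trans ed dxy).
by case: ifP => // _; exact: kern_ge0.
Qed.

(** Since u >= 0, jumps longer than del cost at most the weighted L^1 norm of u; shorter ones are
    symmetrized and controlled by the second difference, integrable because g > a. Neither bound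
    depends on e. *)
Lemma trunc_fraclap_ge e del g C M x : 0 < e -> e <= del -> a < g -> 0 < C ->
  enorm x <= M ->
  (forall h, enorm h <= del ->
    `|u x *+ 2 - u (x + h) - u (x - h)| <= C * enorm h `^ g) ->
  - (@weight_cst R d a del M * wint +
     C * del `^ g * (@kern_cst R d a g * del `^ (- a))) <= trunc_fraclap a e u x.
Proof.
move=> e0 ed ag C0 xM Hu; have d0 : 0 < del := lt_le_trans e0 ed.
rewrite (trunc_fraclap_split x e0 ed) opprD; apply: lerD.
  rewrite trunc_fraclapE// lerBrDr addrC.
  apply: (@le_trans _ _ 0); last by rewrite mulr_ge0// Rintegral_ge0// => y _; exact: tkern_ge0.
  by rewrite subr_le0; exact: Rint_u_tkern_le.
pose k y := tkern a e x y - tkern a del x y.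
have k0 y : 0 <= k y by rewrite subr_ge0 tkern_anti.
have mk : measurable_fun [set: @borel_rV R d] k.
  by apply: measurable_funB; exact: measurable_tkern.
have kr y : k (x + x - y) = k y by rewrite /k !tkern_reflect.
have ik : intg k by apply: intgB; apply: intg_tkern.
have iuk : intg (fun y => u y * k y).
  have := intgB (intg_u_tkern x e0) (intg_u_tkern x d0).
  by congr (integrable _ _ _); apply/funext => y /=; rewrite /k mulrBr.
have [i2 E] := reflect_diff mk continuous_measurable_borel_rV k0 u0 kr ik iuk.
rewrite -(@ler_pM2l _ 2)// E mulrN.
have mtk := measurable_borel_lebesgue (@measurable_trunc_kern R d a g del x).
have /measurable_EFinP mtk' := mtk.
have it : intg (fun y => trunc_pow g del x y * kern a x y).
  apply: (ge0_intg mtk' _ (integral_trunc_kern_le x a0 ag d0)); last exact: ltry.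
  by move=> y; rewrite mulr_ge0 ?trunc_pow_ge0 ?kern_ge0.
have Cd0 : 0 <= C * del `^ g by rewrite mulr_ge0 ?powR_ge0// ltW.
have it2 := intgZl (- (C * del `^ g)) it.
apply: (@le_trans _ _ (\int[mu]_y (- (C * del `^ g) * (trunc_pow g del x y * kern a x y)))).
  rewrite RintegralZl// mulNr lerN2.
  have /Rintegral_leP H := integral_trunc_kern_le x a0 ag d0.
  have {}H := H it.
  apply: (@le_trans _ _ (C * del `^ g * (@kern_cst R d a g * del `^ (- a)))).
    by rewrite ler_wpM2l.
  by rewrite ler_peMl ?ler1n// mulr_ge0// mulr_ge0 ?powR_ge0// ltW// kern_cst_gt0.
apply: le_Rint => //= y.
rewrite mulNr mulrA.
have [yd|yd] := ltP del (enorm (x - y)).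
  rewrite /k /tkern yd (le_lt_trans ed yd) subrr mulr0 oppr_le0.
  by rewrite mulr_ge0 ?kern_ge0// mulr_ge0// trunc_pow_ge0.
have -> : k y = tkern a e x y by rewrite /k {2}/tkern ltNge yd subr0.
have := Hu (y - x); rewrite enormB => /(_ yd).
have -> : x + (y - x) = y by rewrite addrC subrK.
rewrite -reflectE => /ler_normlP[H1 _].
have -> : C * del `^ g * trunc_pow g del x y = C * enorm (x - y) `^ g.
  rewrite -mulrA; congr (_ * _).
  have g0 : 0 < g by apply: lt_trans ag.
  have xd : enorm (x - y) / del <= 1 by rewrite ler_pdivrMr// mul1r.
  rewrite /trunc_pow min_r.
    by rewrite -powRM ?(ltW d0) ?divr_ge0 ?enorm_ge0 ?(ltW d0)// mulrCA divff ?mulr1// gt_eqF.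
  have : (enorm (x - y) / del) `^ g <= 1 `^ g.
    by rewrite ge0_ler_powR ?nnegrE ?divr_ge0 ?enorm_ge0 ?(ltW d0) ?(ltW g0).
  by rewrite powR1.
apply: (@le_trans _ _ (- (C * enorm (x - y) `^ g * tkern a e x y))).
  rewrite lerN2 ler_wpM2l ?tkern_le_kern// mulr_ge0 ?powR_ge0// ltW//.
by rewrite -mulNr ler_wpM2r ?tkern_ge0// lerNl.
Qed.

End nonnegative_weighted.

(** * Strong maximum principle and weak Harnack inequality *)

Section superharmonic.
Context {R : realType} {d : nat}.
Implicit Types (x y h : 'rV[R]_d) (e g rho r : R).
Local Notation mu := (lebesgue_rV R d).
Local Notation intg f := (mu.-integrable setT (EFin \o f)).

Lemma lebesgue_rV_eball_gt0 x r : 0 < r -> (0 < mu (eball x r))%E.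
Proof.
(* The Euclidean norm is at most d times the sup norm, so the cube of half-side r / (d + 1) lies
   strictly inside the ball; adding 1 also covers d = 0. *)
move=> r0; pose s := r / (d%:R + 1).
have d1 : 0 < d%:R + 1 :> R by rewrite ltr_wpDl.
have s0 : 0 < s by rewrite divr_gt0.
apply: (@lt_le_trans _ _ (mu (rect (fun i => ball (x ord0 i) s)))).
  by rewrite lebesgue_rV_cube ?(ltW s0)// lte_fin exprn_gt0// mulrn_wgt0.
apply: le_measure; rewrite ?inE.
- apply: measurable_set_borel_lebesgue; apply: measurable_rect => i.
  exact: measurable_ball.
- exact: measurable_eball.
move=> y xy; rewrite /eball /=; apply: le_lt_trans (enorm_le_norm _) _.
apply: (@le_lt_trans _ _ (d%:R * s)).
  rewrite ler_wpM2l// [leLHS]mx_normrE; apply: bigmax_le; first exact: ltW.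
  move=> [i j] _ /=; rewrite (ord1 i) !mxE distrC.
  by have := xy j; rewrite /ball/= => /ltW.
by rewrite /s mulrCA gtr_pMr// ltr_pdivrMr// mul1r ltrDl.
Qed.

Lemma intg_eball x r : 0 <= r -> intg (\1_(eball x r) : 'rV[R]_d -> R).
Proof.
move=> r0; have mB := measurable_eball x r.
apply: (ge0_intg (C := mu (eball x r))).
- exact: measurable_indic.
- by move=> y; rewrite indicE.
- by rewrite integral_indic// setIT.
- by apply: le_lt_trans (lebesgue_rV_eball_le _ r0) _; exact: ltry.
Qed.

Lemma Rint_eball x r : 0 <= r ->
  \int[mu]_y (\1_(eball x r) y) = fine (mu (eball x r)).
Proof.
by move=> r0; rewrite /Rintegral integral_indic ?setIT//; exact: measurable_eball.
Qed.

Variables (a : R) (u : 'rV[R]_d -> R).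
Hypotheses (a02 : 0 < a < 2) (cu : continuous u) (u0 : forall x, 0 <= u x)
  (wu : weighted_L1 a u) (hu : holder_plus exterior a u).

Let a0 : 0 < a. Proof. by case/andP: a02. Qed.
Let a2 : a < 2. Proof. by case/andP: a02. Qed.

Lemma trunc_fraclap_lower_bound (r1 r2 : R) : 1 < r1 -> exists C e0 : R, 0 < e0 /\
  forall x e, r1 <= enorm x <= r2 -> 0 < e -> e <= e0 -> - C <= trunc_fraclap a e u x.
Proof.
move=> r11; have [g [C [del [ag C0 d0 H]]]] :=
  holder_plus_second_difference r2 a02 hu r11.
exists (@weight_cst R d a del r2 * wint a u +
  C * del `^ g * (@kern_cst R d a g * del `^ (- a))), del; split => //.
move=> x e xr e0 ed; apply: trunc_fraclap_ge => //; first by case/andP: xr.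
by move=> h; exact: H.
Qed.

(* The library's [lim] of a divergent filter is 0, so a positive value of
   [fraclap] witnesses that the principal value converges. *)
Lemma fraclap_gt0_cvg x : 0 < fraclap a u x ->
  trunc_fraclap a e u x @[e --> 0^'+] --> fraclap a u x / @fraclap_const R d a.
Proof.
have c0 := @fraclap_const_gt0 R d a a02.
rewrite fraclapE; set L := lim _; set c := fraclap_const a.
have -> : c * L / c = L by rewrite mulrC mulKf// gt_eqF.
rewrite pmulr_rgt0// => L0.
have [//|ncv] := pselect (cvg (trunc_fraclap a e u x @[e --> 0^'+])).
suff L00 : L = 0 by rewrite L00 ltxx in L0.
by apply: getPN => l Hl; apply: ncv; apply/cvg_ex; exists l.
Qed.

Lemma exterior_gt1 x : exterior x <-> 1 < enorm x.
Proof. by rewrite /exterior/= ltNge; split=> /negP. Qed.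

Lemma Rint_u_tkern_gt0 x y e : 0 < e -> e < enorm (x - y) -> 0 < u y ->
  0 < \int[mu]_z (u z * tkern a e x z).
Proof.
move=> e0 exy uy.
have : \forall z \near y, u y / 2 < u z.
  have := @cu y; move/cvgrPdist_lt => /(_ (u y / 2)).
  rewrite divr_gt0// => /(_ isT); apply: filterS => z.
  by move=> /ltr_normlP[]; lra.
move=> /nbhs_ballP[s/= s0 sy].
pose t := Num.min s ((enorm (x - y) - e) / 2).
have t0 : 0 < t by rewrite /t lt_min s0/= divr_gt0// subr_gt0.
pose c := u y / 2 * ((enorm (x - y) + t) `^ (d%:R + a))^-1.
have xy0 : 0 < enorm (x - y) by apply: lt_trans exy.
have c0 : 0 < c by rewrite mulr_gt0 ?divr_gt0// invr_gt0 powR_gt0// addr_gt0.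
have s1 : 0 <= d%:R + a by rewrite addr_ge0// ltW.
apply: (@lt_le_trans _ _ (\int[mu]_z (c * \1_(eball y t) z))).
  rewrite RintegralZl//; last exact/intg_eball/ltW.
  rewrite mulr_gt0// Rint_eball ?(ltW t0)// fine_gt0// lebesgue_rV_eball_gt0//=.
  by apply: le_lt_trans (lebesgue_rV_eball_le _ (ltW t0)) _; exact: ltry.
apply: le_Rint.
- by apply: intgZl; exact/intg_eball/ltW.
- exact: intg_u_tkern.
move=> z /=; rewrite indicE; have [|_] := boolP (z \in _); last first.
  by rewrite mulr0 mulr_ge0// tkern_ge0.
rewrite inE /eball/= mulr1 => zy.
have zys : ball y s z.
  rewrite -ball_normE/=; apply: le_lt_trans (norm_le_enorm _) _.
  by rewrite enormB; apply: lt_le_trans zy _; rewrite /t ge_min lexx.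
have tt : t <= (enorm (x - y) - e) / 2 by rewrite /t ge_min lexx orbT.
have xz1 : e < enorm (x - z).
  have := enorm_sub_le x z y; lra.
have xz2 : enorm (x - z) <= enorm (x - y) + t.
  by have := enorm_sub_le x y z; rewrite (enormB y z); lra.
rewrite /c ler_pM ?invr_ge0 ?powR_ge0 ?divr_ge0//.
  by apply/ltW/sy.
by rewrite /tkern xz1; apply: kern_ge => //; exact: lt_trans xz1.
Qed.

(** At a zero of u the truncated operator is minus the integral of u against the kernel, hence
    monotone in e. Since 0 is also the default value of a divergent limit, convergence has to be
    proved: it follows from monotonicity and the uniform lower bound. A nonnegative limit then
    leaves no room for a point where u > 0. *)
Lemma strong_maximum_principle x : exterior x -> 0 <= fraclap a u x -> u x = 0 ->
  forall y, u y = 0.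
Proof.
move=> /exterior_gt1 x1 Lx ux.
have [C [e0 [e00 H]]] := trunc_fraclap_lower_bound (enorm x) x1.
have xx : enorm x <= enorm x <= enorm x by rewrite lexx.
have E e : 0 < e -> trunc_fraclap a e u x = - \int[mu]_y (u y * tkern a e x y).
  by move=> ep; rewrite trunc_fraclapE// ux mul0r sub0r.
pose f e := trunc_fraclap a e u x.
have hb : has_lbound [set f e | e in `]0, e0[%classic].
  exists (- C) => _ [e + <-]; rewrite /= in_itv/= => /andP[ep ee0].
  by apply: H => //; exact: ltW.
have cf : f e @[e --> 0^'+] --> inf [set f e | e in `]0, e0[%classic].
  apply: nondecreasing_at_right_cvgr => //.
  move=> e e'; rewrite !in_itv/= => /andP[ep _] /andP[e'p _] ee'.
  rewrite /f !E// lerN2; apply: le_Rint; [exact: intg_u_tkern..|move=> y].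
  by rewrite ler_wpM2l// tkern_anti.
have L0 : 0 <= inf [set f e | e in `]0, e0[%classic].
  move: Lx; rewrite fraclapE (cvg_lim _ cf)// pmulr_rge0//.
  exact: fraclap_const_gt0.
have f0 e : 0 < e -> e < e0 -> 0 <= f e.
  move=> ep ee; apply: (le_trans L0); apply: ge_inf => //.
  by exists e => //=; rewrite in_itv/= ep.
move=> y; apply/eqP; rewrite eq_le u0 andbT leNgt; apply/negP => uy.
have xy : 0 < enorm (x - y).
  apply: enorm_gt0; rewrite subr_eq0; apply/eqP => xy.
  by move: uy; rewrite -xy ux ltxx.
pose e := Num.min e0 (enorm (x - y)) / 2.
have m0 : 0 < Num.min e0 (enorm (x - y)) by rewrite lt_min e00.
have e1 : e < e0.
  by rewrite /e ltr_pdivrMr// (@le_lt_trans _ _ e0) ?ge_min ?lexx// ltr_pMr// ltr1n.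
have e2 : e < enorm (x - y).
  rewrite /e ltr_pdivrMr// (@le_lt_trans _ _ (enorm (x - y))) ?ge_min ?lexx ?orbT//.
  by rewrite ltr_pMr// ltr1n.
have ep : 0 < e by rewrite /e divr_gt0.
by have := Rint_u_tkern_gt0 ep e2 uy; have := f0 e ep e1; rewrite /f E//; lra.
Qed.

End superharmonic.

Section weak_harnack.
Context {R : realType} {d : nat}.
Implicit Types (x y h : 'rV[R]_d) (e g rho r : R).
Local Notation mu := (lebesgue_rV R d).
Local Notation intg f := (mu.-integrable setT (EFin \o f)).

Definition mass (u : 'rV[R]_d -> R) r : R :=
  \int[mu]_y (u y * \1_(eball 0 r) y).

Variables (a : R) (u : 'rV[R]_d -> R).
Hypotheses (d1 : (1 <= d)%N) (a02 : 0 < a < 2) (cu : continuous u)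
  (u0 : forall x, 0 <= u x) (wu : weighted_L1 a u).

Let a0 : 0 < a. Proof. by case/andP: a02. Qed.
Let a2 : a < 2. Proof. by case/andP: a02. Qed.

Lemma bounded_on_eball (M : R) : exists2 S : R, 0 < S & forall x, enorm x <= M -> u x <= S.
Proof.
have [S S0 HS] := @compact_bounded_within R d _ u (@compact_enorm_le R d M)
  (continuous_subspaceT cu).
by exists S => // x /HS; exact/le_trans/ler_norm.
Qed.

Lemma intg_mass x r : 0 <= r -> intg (fun y => u y * \1_(eball x r) y).
Proof.
move=> r0; have [S S0 HS] := bounded_on_eball (enorm x + r).
have iS := intgZl S (intg_eball x r0).
apply: (le_intg _ iS).
- apply: measurable_funM; first exact: continuous_measurable_leb_rV.
  by apply: measurable_indic; exact: measurable_eball.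
have i0 y : 0 <= \1_(eball x r) y :> R by rewrite indicE.
move=> y; rewrite ger0_norm ?mulr_ge0// indicE; have [|_] := boolP (y \in _);
  rewrite ?mulr0// !mulr1 inE /eball/= => yr.
apply: HS; have := enorm_sub_ge y x; lra.
Qed.

Lemma mass_gt0 r x : enorm x < r -> 0 < u x -> 0 < mass u r.
Proof.
move=> xr ux; have r0 : 0 < r := le_lt_trans (enorm_ge0 x) xr.
have : \forall z \near x, u x / 2 < u z.
  have := @cu x; move/cvgrPdist_lt => /(_ (u x / 2)).
  rewrite divr_gt0// => /(_ isT); apply: filterS => z.
  by move=> /ltr_normlP[]; lra.
move=> /nbhs_ballP[s/= s0 sy].
pose t := Num.min s (r - enorm x).
have t0 : 0 < t by rewrite /t lt_min s0/= subr_gt0.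
apply: (@lt_le_trans _ _ (\int[mu]_z (u x / 2 * \1_(eball x t) z))).
  rewrite RintegralZl//; last exact/intg_eball/ltW.
  rewrite mulr_gt0 ?divr_gt0// Rint_eball ?(ltW t0)// fine_gt0// lebesgue_rV_eball_gt0//=.
  by apply: le_lt_trans (lebesgue_rV_eball_le _ (ltW t0)) _; exact: ltry.
apply: le_Rint; [exact/intgZl/intg_eball/ltW|exact/intg_mass/ltW|move=> z].
rewrite !indicE; have [|_] := boolP (z \in eball x t); last first.
  by rewrite mulr0 mulr_ge0.
rewrite inE /eball/= mulr1 => zx.
have -> : z \in eball 0 r.
  rewrite inE /eball/= subr0.
  have : t <= r - enorm x by rewrite /t ge_min lexx orbT.
  by have := enorm_sub_ge z x; lra.
rewrite mulr1; apply/ltW/sy; rewrite -ball_normE/=.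
apply: le_lt_trans (norm_le_enorm _) _.
by rewrite enormB; apply: lt_le_trans zx _; rewrite /t ge_min lexx.
Qed.

Lemma weighted_L1_paraboloid x1 rho : 0 < rho -> weighted_L1 a (paraboloid x1 rho).
Proof.
move=> rho0; have ie := intg_eball x1 (ltW rho0).
have w1 y : 1 <= 1 + enorm (y : 'rV[R]_d) `^ (d%:R + a).
  by rewrite lerDl powR_ge0.
have w0 y : 0 < 1 + enorm (y : 'rV[R]_d) `^ (d%:R + a).
  exact: lt_le_trans (w1 y).
apply: (le_intg _ ie).
  apply: measurable_funM.
    exact: (measurable_borel_lebesgue (measurable_paraboloid x1 rho)).
  have mw : measurable_fun [set: @borel_rV R d]
      (fun y => (1 + enorm (y : 'rV[R]_d) `^ (d%:R + a)) `^ (- 1)).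
    apply: (@measurableT_comp _ _ _ _ _ _ (@powR R ^~ (- 1))).
      exact: measurable_powR.
    apply: measurable_funD => //.
    apply: (@measurableT_comp _ _ _ _ _ _ (@powR R ^~ (d%:R + a))).
      exact: measurable_powR.
    exact: measurable_enorm.
  have := measurable_borel_lebesgue mw; congr (measurable_fun _ _).
  by apply/funext => y; rewrite powR_inv1// ltW.
move=> y; rewrite ger0_norm ?divr_ge0 ?paraboloid_ge0 ?(ltW (w0 _))//.
rewrite ler_pdivrMr// indicE; have [|] := boolP (y \in _).
  by move=> _; rewrite mul1r (le_trans (paraboloid_le1 _ _ _)).
rewrite notin_setE /eball/= => /negP; rewrite -leNgt => h.
by rewrite paraboloid_eq0// mul0r.
Qed.

(* Touch u from below by t * paraboloid at its minimum contact point xm: there the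
   truncated operator of u is controlled by that of the paraboloid, minus the
   contribution of the mass of u. *)
Lemma trunc_fraclap_touching x1 xm r rho t e : 0 < r -> 0 < rho -> 0 < e -> 0 <= t ->
  enorm xm <= 3 * r ->
  (forall y, u xm - t * paraboloid x1 rho xm <= u y - t * paraboloid x1 rho y) ->
  u xm - t * paraboloid x1 rho xm < 0 ->
  trunc_fraclap a e u xm <= t * (@kern_cst R d a 2 * rho `^ (- a)) -
    ((7 * r) `^ (d%:R + a))^-1 *
    (mass u (4 * r) - \int[mu]_y (u y * \1_(eball xm (2 * e)) y) - t * (8 * r) ^+ d).
Proof.
move=> r0 rho0 e0 t0 xmr minw negw.
pose b := paraboloid x1 rho.
(* With |xm| <= 3r and |y| < 4r, every jump from xm into the ball has length at most 7r. *)
pose w7 := ((7 * r) `^ (d%:R + a))^-1.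
have w70 : 0 <= w7 by rewrite invr_ge0 powR_ge0.
have s0 : 0 <= d%:R + a by rewrite addr_ge0// ltW.
have r40 : 0 <= 4 * r by rewrite mulr_ge0// ltW.
have e20 : 0 <= 2 * e by rewrite mulr_ge0// ltW.
have mb : measurable_fun [set: @borel_rV R d] b := measurable_paraboloid x1 rho.
have wb : weighted_L1 a b := weighted_L1_paraboloid x1 rho0.
have ib := intg_trunc_fraclap a02 (@continuous_paraboloid R d x1 rho)
  (paraboloid_ge0 x1 rho) wb xm e0.
(* A ball around xm is removed because the truncated kernel vanishes there; its radius is 2e so that
   points on its boundary still satisfy the strict inequality e < |xm - y|. The term t accounts for
   the paraboloid, whose height is at most t. *)
pose G y := u y * \1_(eball 0 (4 * r)) y - u y * \1_(eball xm (2 * e)) y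
   - t * \1_(eball 0 (4 * r)) y.
have iG1 := intg_mass 0 r40.
have iG2 := intg_mass xm e20.
have iG3 : intg (fun y => t * \1_(eball 0 (4 * r)) y : R) by exact/intgZl/intg_eball.
have iG12 := intgB iG1 iG2.
have iG : intg G := intgB iG12 iG3.
have pw y : (u xm - u y) * tkern a e xm y <=
    t * ((b xm - b y) * tkern a e xm y) - w7 * G y.
  have w1 := minw y; have by1 := paraboloid_le1 x1 rho y; have by0 := paraboloid_ge0 x1 rho y.
  have k0 := tkern_ge0 a e xm y.
  have u00 := u0 y.
  have key : (u xm - t * b xm - (u y - t * b y)) * tkern a e xm y <= - (w7 * G y).
    rewrite -lerN2 opprK -mulNr opprB.
    have W0 : 0 <= u y - t * b y - (u xm - t * b xm) by rewrite subr_ge0.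
    have WK0 := mulr_ge0 W0 k0.
    rewrite /G !indicE.
    have [y2|] := boolP (y \in eball xm (2 * e)).
      apply: le_trans WK0; rewrite mulr_ge0_le0//.
      by case: (y \in eball 0 (4 * r)) => /=; nra.
    rewrite notin_setE /eball/= => /negP; rewrite -leNgt enormB => y2.
    have [|_] := boolP (y \in eball 0 (4 * r)); last first.
      by rewrite !mulr0 !subr0 mulr0.
    rewrite inE /eball/= subr0 => y4.
    rewrite !mulr1 mulr0 subr0.
    have ey : e < enorm (xm - y) by lra.
    have kw : w7 <= tkern a e xm y.
      rewrite /tkern ey; apply: kern_ge => //; first exact: lt_trans ey.
      by have := enormD xm (- y); rewrite enormN; lra.
    have [ut|ut] := leP (u y) t.
      by apply: le_trans WK0; rewrite mulr_ge0_le0// subr_le0.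
    rewrite mulrC ler_pM//; first by rewrite subr_ge0 ltW.
    have : t * b y <= t by rewrite ler_piMr.
    by rewrite /b; lra.
  rewrite -/b in w1 negw.
  by move: key; rewrite !mulrBl; lra.
have iT := intgZl t ib.
have iW := intgZl w7 iG.
have : trunc_fraclap a e u xm <= \int[mu]_y (t * ((b xm - b y) * tkern a e xm y) - w7 * G y).
  apply: le_Rint => //; first exact: intg_trunc_fraclap.
  exact: (intgB iT iW).
move=> /le_trans; apply.
rewrite (RintegralB measurableT iT iW) (RintegralZl _ measurableT ib)
  (RintegralZl _ measurableT iG).
apply: lerB.
  apply: ler_wpM2l => //.
  have := @trunc_fraclap_le R d a e rho 2 b xm a02 e0 rho0 mb.
  rewrite divff ?mul1r//; apply => //.
    by move=> y; rewrite paraboloid_ge0 paraboloid_le1.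
  by move=> y; exact: paraboloid_second_difference.
apply: ler_wpM2l => //.
rewrite (RintegralB measurableT iG12 iG3) (RintegralB measurableT iG1 iG2).
rewrite RintegralZl//; last exact: intg_eball.
rewrite lerD2l lerN2 ler_wpM2l// Rint_eball//.
rewrite -lee_fin fineK.
  apply: le_trans (lebesgue_rV_eball_le _ r40) _; rewrite lee_fin.
  by rewrite lerXn2r ?nnegrE ?mulrn_wge0 ?mulr_ge0 ?(ltW r0)//; lra.
rewrite ge0_fin_numE//.
by apply: le_lt_trans (lebesgue_rV_eball_le _ r40) _; exact: ltry.
Qed.

Hypotheses (su : forall x, exterior x -> 0 < fraclap a u x)
  (up : forall x, exterior x -> 0 < u x).

(** Read off from the touching inequality with rho = r / 8 and t = 2 u(x): half of the mass is at
    most t r^d times the sum in parentheses. *)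
Definition harnack_cst : R :=
  (4 * (8 `^ a * @kern_cst R d a 2 * 7 `^ (d%:R + a) + 8 ^+ d))^-1.

Lemma harnack_cst_gt0 : 0 < harnack_cst.
Proof.
rewrite invr_gt0 mulr_gt0// ltr_wpDl ?exprn_gt0// !mulr_ge0 ?powR_ge0//.
by rewrite ltW// kern_cst_gt0.
Qed.

Lemma weak_harnack r x : 16 <= r -> r / 4 <= enorm x <= 2 * r ->
  harnack_cst * (mass u (4 * r) / r ^+ d) <= u x.
Proof.
move=> r16 /andP[rx xr]; have r0 : 0 < r by lra.
have x1 : exterior x by apply/exterior_gt1; lra.
have ux := up x1.
(* Twice the value at x makes w(x) = - u(x) < 0, while w = u >= 0 outside the ball of radius rho:
   the minimum of w over that ball is a global one. *)
pose t := 2 * u x; have t0 : 0 < t by rewrite mulr_gt0.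
(* The contact point then satisfies r / 8 <= |xm| <= 3r, and r >= 16 puts it in the exterior of the
   unit ball. *)
pose rho := r / 8; have rho0 : 0 < rho by rewrite divr_gt0.
pose b := paraboloid x rho.
pose w y := u y - t * b y.
have cw : continuous w.
  move=> y; have cb := @continuous_paraboloid R d x rho y.
  exact: (cvgB (cu (x := y)) (cvgM (cvg_cst t) cb)).
pose A : set 'rV[R]_d := [set y | enorm (y - x) <= rho].
have cA : compact A.
  apply: (@subclosed_compact _ _ [set y | enorm y <= enorm x + rho]).
  - rewrite (_ : A = (fun y => enorm (y - x)) @^-1` [set s | s <= rho])//.
    apply: closed_comp => // y _.
    apply: (@continuous_comp _ _ _ (fun y => y - x) (@enorm R d)).
      by apply: continuousB => //; exact: cst_continuous.
    exact: continuous_enorm.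
  - exact: compact_enorm_le.
  - rewrite /A => y /= yx; have := enorm_sub_ge y x; lra.
have [||xm xmA Hxm] := @EVT_min_rV R d w A _ cA.
- by exists x; rewrite /A/= subrr enorm0 ltW.
- exact: continuous_subspaceT.
move: xmA; rewrite inE /A/= => xmx.
have wx : w x = - u x by rewrite /w /b paraboloid_center /t; lra.
have wxm : w xm <= - u x.
  by rewrite -wx Hxm// inE /A/= subrr enorm0 ltW.
have wneg : w xm < 0 by apply: le_lt_trans wxm _; rewrite oppr_lt0.
have wmin y : w xm <= w y.
  have [yA|yA] := leP (enorm (y - x)) rho; first by apply: Hxm; rewrite inE.
  by apply: (le_trans (ltW wneg)); rewrite /w /b paraboloid_eq0 ?mulr0 ?subr0// ltW.
have xm1 : exterior xm.
  apply/exterior_gt1; have := enorm_sub_ge x xm; rewrite enormB /rho in xmx *; lra.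
have xm3 : enorm xm <= 3 * r.
  by have := enorm_sub_ge xm x; rewrite /rho in xmx *; lra.
have M0 : 0 < mass u (4 * r) by apply: (mass_gt0 (x := x)) => //; lra.
have [S S0 HS] := bounded_on_eball (enorm xm + 2).
(* e is small enough for the ball removed around xm to carry at most half of the mass *)
have near_e : \forall e \near 0^'+, S * (2 * e *+ 2) ^+ d <= mass u (4 * r) / 2 /\ e <= 1.
  near=> e.
  have e1 : e <= 1 by near: e; apply: nbhs_right_le.
  have e0 : 0 < e by near: e; exact: nbhs_right_gt.
  split => //.
  have -> : 2 * e *+ 2 = 4 * e by ring.
  rewrite exprMn.
  have ed : e ^+ d <= e.
    by rewrite -[leRHS]expr1 ler_wiXn2l// ltW.
  apply: (@le_trans _ _ (S * (4 ^+ d * e))).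
    by rewrite !ler_wpM2l// ?exprn_ge0// ltW.
  rewrite mulrA mulrC -ler_pdivlMr ?mulr_gt0 ?exprn_gt0//.
  by near: e; apply: nbhs_right_le; rewrite !divr_gt0// mulr_gt0// exprn_gt0.
have c0 := @fraclap_const_gt0 R d a a02.
(* The truncated operator inherits the sign of its positive limit, so a single small e serves and no
   passage to the limit is made. *)
have near_pos : \forall e \near 0^'+, 0 < trunc_fraclap a e u xm.
  have := fraclap_gt0_cvg a02 (su xm1).
  move=> /cvgrPdist_lt /(_ (fraclap a u xm / @fraclap_const R d a)).
  rewrite divr_gt0 ?su// => /(_ isT); apply: filterS => e /ltr_normlP[]; lra.
have [e [[[Se e1] Le] e0]] : exists e, (((S * (2 * e *+ 2) ^+ d <= mass u (4 * r) / 2 /\ e <= 1) /\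
    0 < trunc_fraclap a e u xm) /\ 0 < e).
  apply: (@filter_ex _ (0:R)^'+).
  by apply: filterI; [exact: filterI|exact: nbhs_right_gt].
have := trunc_fraclap_touching r0 rho0 e0 (ltW t0) xm3 wmin wneg.
move=> /(lt_le_trans Le); rewrite subr_gt0.
have ball_e : \int[mu]_y (u y * \1_(eball xm (2 * e)) y) <= mass u (4 * r) / 2.
  apply: le_trans Se; have e20 : 0 <= 2 * e by rewrite mulr_ge0// ltW.
  apply: (@le_trans _ _ (\int[mu]_y (S * \1_(eball xm (2 * e)) y))).
    apply: le_Rint; [exact: intg_mass|exact/intgZl/intg_eball|move=> y].
    rewrite indicE; have [|_] := boolP (y \in _); rewrite ?mulr0// !mulr1 inE /eball/= => yr.
    by apply: HS; have := enorm_sub_ge y xm; lra.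
  rewrite RintegralZl//; last exact: intg_eball.
  rewrite ler_wpM2l ?(ltW S0)// Rint_eball//.
  have le2 := lebesgue_rV_eball_le xm e20.
  by rewrite -lee_fin fineK// ge0_fin_numE//; apply: le_lt_trans le2 _; exact: ltry.
move=> H.
have W0 : 0 < (7 * r) `^ (d%:R + a) by rewrite powR_gt0// mulr_gt0.
have {}H : ((7 * r) `^ (d%:R + a))^-1 * (mass u (4 * r) / 2 - t * (8 * r) ^+ d) <=
    t * (@kern_cst R d a 2 * rho `^ (- a)).
  apply/ltW; apply: le_lt_trans H; rewrite ler_wpM2l ?invr_ge0 ?(ltW W0)//; lra.
rewrite mulrC ler_pdivrMr// in H.
have rhoE : rho `^ (- a) * (7 * r) `^ (d%:R + a) = 8 `^ a * 7 `^ (d%:R + a) * r ^+ d.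
  rewrite !powRM ?ler0n ?(ltW r0) ?invr_ge0// -[8^-1]powR_inv1// -powRrM.
  rewrite mulrN mulN1r opprK.
  rewrite (powRD (x := r)); last by rewrite (gt_eqF r0) implybT.
  rewrite powR_mulrn ?(ltW r0)// powRN.
  by field; rewrite gt_eqF// powR_gt0.
have {}H : mass u (4 * r) / 2 <=
   t * r ^+ d * (8 `^ a * @kern_cst R d a 2 * 7 `^ (d%:R + a) + 8 ^+ d).
  rewrite -!mulrA rhoE exprMn in H; rewrite mulrDr; move: H; rewrite /t; lra.
rewrite /harnack_cst mulrC ler_pdivrMr; last first.
  rewrite mulr_gt0// ltr_wpDl ?exprn_gt0// !mulr_ge0 ?powR_ge0//.
  by rewrite ltW// kern_cst_gt0.
rewrite ler_pdivrMr ?exprn_gt0//; move: H; rewrite /t; lra.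
Unshelve. all: by end_near. Qed.

End weak_harnack.

(** * Testing with cutoffs; capacity *)

Section duality.
Context {R : realType} {d : nat}.
Implicit Types (x y h : 'rV[R]_d) (e g rho r : R).
Local Notation mu := (lebesgue_rV R d).
Local Notation intg f := (mu.-integrable setT (EFin \o f)).
Local Notation intg2 F := ((mu \x mu)%E.-integrable setT (EFin \o F)).

Variables (a : R) (u : 'rV[R]_d -> R).
Hypotheses (d1 : (1 <= d)%N) (a02 : 0 < a < 2) (cu : continuous u)
  (u0 : forall x, 0 <= u x) (wu : weighted_L1 a u).

Let a0 : 0 < a. Proof. by case/andP: a02. Qed.
Let a2 : a < 2. Proof. by case/andP: a02. Qed.

Lemma measurable_fst_fun (f : 'rV[R]_d -> R) : measurable_fun [set: leb_rV R d] f ->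
  measurable_fun [set: leb_rV R d * leb_rV R d] (fun z => f z.1).
Proof. by move=> mf; exact: (measurableT_comp mf measurable_fst). Qed.

Lemma measurable_snd_fun (f : 'rV[R]_d -> R) : measurable_fun [set: leb_rV R d] f ->
  measurable_fun [set: leb_rV R d * leb_rV R d] (fun z => f z.2).
Proof. by move=> mf; exact: (measurableT_comp mf measurable_snd). Qed.

Lemma intg2_mul_tkern e M (c : R) (F : leb_rV R d * leb_rV R d -> R) :
  0 < e -> 0 <= M -> measurable_fun setT F -> 0 <= c ->
  (forall z, `|F z| <= c * (\1_(eball 0 M) z.1 + \1_(eball 0 M) z.2)) ->
  intg2 (fun z => F z * tkern a e z.1 z.2).
Proof.
move=> e0 M0 mF c0 HF.
have Boo : (mu (eball (0 : 'rV[R]_d) M) < +oo)%E.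
  by apply: le_lt_trans (lebesgue_rV_eball_le _ M0) _; exact: ltry.
have k0 : 0 <= @kern_cst R d a 2 * e `^ (- a).
  by rewrite mulr_ge0 ?powR_ge0// ltW// kern_cst_gt0.
have Kk x : (\int[mu]_y (tkern a e x y)%:E <= (@kern_cst R d a 2 * e `^ (- a))%:E)%E.
  exact: integral_tkern_le.
have := @intg2_mulK _ _ _ mu (tkern a e) (@tkern_ge0 R d a e) (@tkernC R d a e)
  (@measurable_tkern2 R d a e) (eball 0 M) _ c F (measurable_eball _ _) Boo Kk mF k0 c0 HF.
exact.
Qed.

Section cutoff.
Variables (psi : 'rV[R]_d -> R) (M : R).
Hypotheses (mpsi : measurable_fun [set: leb_rV R d] psi)
  (psi01 : forall x, 0 <= psi x <= 1) (psiM : forall x, M <= enorm x -> psi x = 0)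
  (M0 : 0 <= M).

Let psi_le x : psi x <= \1_(eball 0 M) x.
Proof.
rewrite indicE; have [_|] := boolP (x \in _).
  by have /andP[_] := psi01 x.
rewrite notin_setE /eball/= subr0 => /negP; rewrite -leNgt => /psiM ->//.
Qed.

Lemma intg_cutoff : intg psi.
Proof.
apply: (le_intg _ (intg_eball 0 M0)) => // x.
by have /andP[p0 _] := psi01 x; rewrite ger0_norm//; exact: psi_le.
Qed.

Lemma intg2_cutoff e : 0 < e ->
  intg2 (fun z : leb_rV R d * leb_rV R d =>
    psi z.1 * (u z.1 - u z.2) * tkern a e z.1 z.2).
Proof.
move=> e0; have [S S0 HS] := bounded_on_eball cu M.
have mB := measurable_eball (0 : 'rV[R]_d) M.
have Boo : (mu (eball 0 M) < +oo)%E.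
  by apply: le_lt_trans (lebesgue_rV_eball_le _ M0) _; exact: ltry.
pose w y := u y / (1 + enorm (y : 'rV[R]_d) `^ (d%:R + a)).
have w0 y : 0 <= w y by rewrite divr_ge0// addr_ge0// powR_ge0.
have mw : measurable_fun [set: leb_rV R d] w := intg_measurable wu.
have mI : measurable_fun [set: leb_rV R d] (\1_(eball 0 M) : 'rV[R]_d -> R).
  exact: measurable_indic.
have i1 : intg2 (fun z : leb_rV R d * leb_rV R d =>
    \1_(eball 0 M) z.1 * tkern a e z.1 z.2).
  apply: (intg2_mul_tkern (c := 1) e0 M0) => //; first exact: measurable_fst_fun.
  by move=> z; rewrite mul1r ger0_norm !indicE//= lerDl.
have iw : intg w := wu.
have iB : intg (\1_(eball 0 M) : 'rV[R]_d -> R) := intg_eball 0 M0.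
have i2 := (Rint_tensor iB iw).1.
have i12 := intgD (intgZl S i1) (intgZl (@weight_cst R d a e M) i2).
apply: (le_intg _ i12).
  apply: measurable_funM; last exact: measurable_tkern2.
  apply: measurable_funM; first exact: measurable_fst_fun.
  have muu := continuous_measurable_leb_rV cu.
  by apply: measurable_funB; [exact: measurable_fst_fun|exact: measurable_snd_fun].
move=> [x y] /=; rewrite !normrM (ger0_norm (tkern_ge0 _ _ _ _)).
have /andP[p0 p1] := psi01 x; rewrite (ger0_norm p0).
rewrite !indicE; have [|] := boolP (x \in eball 0 M); last first.
  rewrite notin_setE /eball/= subr0 => /negP; rewrite -leNgt => /psiM ->.
  by rewrite !mul0r !mulr0 add0r.
rewrite inE /eball/= subr0 => xM; rewrite !mul1r.
have k0 := tkern_ge0 a e x y.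
apply: (@le_trans _ _ ((S + u y) * tkern a e x y)).
  rewrite ler_wpM2r//; apply: (@le_trans _ _ `|u x - u y|).
    by rewrite ler_piMl.
  apply: (le_trans (ler_normB _ _)); rewrite !ger0_norm//.
  by rewrite lerD2r HS// ltW.
rewrite mulrDl lerD2l; apply: u_tkern_le => //; exact: ltW.
Qed.

Lemma dirichlet_cutoff e : 0 < e ->
  intg2 (fun z : leb_rV R d * leb_rV R d =>
    (psi z.1 - psi z.2) * (u z.1 - u z.2) * tkern a e z.1 z.2) /\
  \int[(mu \x mu)%E]_z ((psi z.1 - psi z.2) * (u z.1 - u z.2) * tkern a e z.1 z.2) =
  2 * \int[mu]_x (psi x * trunc_fraclap a e u x).
Proof.
move=> e0; exact: (@dirichlet _ _ _ mu (tkern a e) (@tkernC R d a e) psi u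
  (intg2_cutoff e0) (fun x => intg_trunc_fraclap a02 cu u0 wu x e0)).
Qed.

Lemma intg_psi_trunc_fraclap e : 0 < e -> intg (fun x => psi x * trunc_fraclap a e u x).
Proof.
move=> e0; have iF := intg2_cutoff e0.
have iFx x : intg (fun y => psi x * (u x - u y) * tkern a e x y).
  have := intgZl (psi x) (@intg_trunc_fraclap R d a u a02 cu u0 wu e x e0).
  by congr (integrable _ _ _); apply/funext => y /=; rewrite mulrA.
have [H _] := Rintegral_prod iF iFx.
suff -> : (fun x => psi x * trunc_fraclap a e u x) =
    (fun x => \int[mu]_y (psi x * (u x - u y) * tkern a e x y)) by exact: H.
apply/funext => x; rewrite /trunc_fraclap.
rewrite -(RintegralZl (psi x) measurableT (intg_trunc_fraclap a02 cu u0 wu x e0)).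
by apply: eq_Rintegral => y _; rewrite mulrA.
Qed.

Hypotheses (hu : holder_plus exterior a u)
  (su : forall x, exterior x -> 0 < fraclap a u x).

(* Fatou's lemma along e = 1/(n+1), the truncated operators being bounded
   below on the support of psi. *)
Lemma fatou_cutoff (r1 B : R) (f : 'rV[R]_d -> R) :
  1 < r1 -> (forall x, enorm x < r1 -> psi x = 0) ->
  measurable_fun [set: leb_rV R d] f -> (forall x, 0 <= f x) ->
  (forall x, exterior x -> f x <= fraclap a u x) ->
  (exists2 e1, 0 < e1 & forall e, 0 < e -> e < e1 ->
    \int[mu]_x (psi x * trunc_fraclap a e u x) <= B) ->
  (\int[mu]_x (psi x * f x)%:E <= (@fraclap_const R d a * B)%:E)%E.
Proof.
move=> r11 psir1 mf f0 fL [e1 e10 HB].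
have c0 := @fraclap_const_gt0 R d a a02; set c := @fraclap_const R d a in c0 *.
have [C [e0 [e00 HC]]] := trunc_fraclap_lower_bound a02 cu u0 wu hu M r11.
pose e2 := Num.min e0 e1.
have e20 : 0 < e2 by rewrite lt_min e00.
(* Dividing by n + 2 keeps e_n strictly below e2 already at n = 0. *)
pose e_ (n : nat) := e2 / n.+2%:R.
have e_0 n : 0 < e_ n by rewrite divr_gt0.
have e_lt n : e_ n < e2.
  by rewrite /e_ ltr_pdivrMr// ltr_pMr// ltr1n.
(* The shift by [|C|] makes the integrands nonnegative; it is taken back by
   [ge0_integral_cancel]. *)
pose h n x : R := psi x * trunc_fraclap a (e_ n) u x + psi x * `|C|.
have h0 n x : 0 <= h n x.
  rewrite /h -mulrDr; have /andP[p0 _] := psi01 x.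
  have [xM|xM] := leP M (enorm x); first by rewrite psiM// mul0r.
  have [xr|xr] := ltP (enorm x) r1; first by rewrite psir1// mul0r.
  rewrite mulr_ge0// -lerBlDr sub0r (@le_trans _ _ (- C)) ?lerN2 ?ler_norm//.
  apply: HC => //; first by rewrite xr ltW.
  by rewrite (le_trans (ltW (e_lt n)))// /e2 ge_min lexx.
have ipsi := intg_cutoff.
have iCpsi : intg (fun x => psi x * `|C|).
  by have := intgZl `|C| ipsi; congr (integrable _ _ _); apply/funext => x /=; rewrite mulrC.
have ih n : intg (h n) := intgD (intg_psi_trunc_fraclap (e_0 n)) iCpsi.
pose P := \int[mu]_x (psi x * `|C|).
have hB n : (\int[mu]_x (h n x)%:E <= (B + P)%:E)%E.
  apply/Rintegral_leP; first exact: ih.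
  rewrite (RintegralD measurableT (intg_psi_trunc_fraclap (e_0 n)) iCpsi) lerD2r.
  by apply: HB => //; rewrite (lt_le_trans (e_lt n))// /e2 ge_min lexx orbT.
have e_cvg : e_ n @[n --> \oo] --> 0.
  rewrite -[X in _ --> X](mulr0 e2).
  apply: cvgM; first exact: cvg_cst.
  have := @cvg_harmonic R; rewrite -(cvg_shiftS (@harmonic R)); exact.
have hlim x : exterior x ->
    (h n x)%:E @[n --> \oo] --> (psi x * (fraclap a u x / c) + psi x * `|C|)%:E.
  move=> xe; apply: cvg_EFin; first by apply: nearW.
  apply: cvgD; last exact: cvg_cst.
  apply: cvgM; first exact: cvg_cst.
  have := fraclap_gt0_cvg a02 (su xe); move/cvg_at_rightP; apply.
  by split.
have hlim0 x : enorm x < r1 -> (h n x)%:E @[n --> \oo] --> 0%E.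
  move=> xr; rewrite (_ : (fun _ => _) = cst 0%E); first exact: cvg_cst.
  by apply/funext => n; rewrite /h psir1// !mul0r addr0.
(* The sequence converges at every point, so its lower limit is also its upper limit, and
   measurability is obtained from the latter. *)
have lim_eq x : limn_einf (fun n => (h n x)%:E) = limn_esup (fun n => (h n x)%:E).
  have [xr|xr] := ltP (enorm x) r1.
    by have [-> ->] := cvg_limn_einf_sup (hlim0 x xr).
  have xe : exterior x by apply/exterior_gt1; exact: lt_le_trans xr.
  by have [-> ->] := cvg_limn_einf_sup (hlim x xe).
have lim_ge x : ((psi x * (f x / c) + psi x * `|C|)%:E <= limn_einf (fun n => (h n x)%:E))%E.
  have /andP[p0 _] := psi01 x.
  have [xr|xr] := ltP (enorm x) r1.
    by rewrite (cvg_limn_einf_sup (hlim0 x xr)).1 psir1// !mul0r addr0.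
  have xe : exterior x by apply/exterior_gt1; exact: lt_le_trans xr.
  rewrite (cvg_limn_einf_sup (hlim x xe)).1 lee_fin lerD2r ler_wpM2l//.
  by rewrite ler_pM2r ?invr_gt0// fL.
have mpf : measurable_fun [set: leb_rV R d] (fun x => psi x * (f x / c)).
  apply: measurable_funM; first exact: mpsi.
  by apply: measurable_funM; [exact: mf|exact: measurable_cst].
have pf0 x : 0 <= psi x * (f x / c).
  by have /andP[p0 _] := psi01 x; rewrite mulr_ge0// divr_ge0// ltW.
have pC0 x : 0 <= psi x * `|C|.
  by have /andP[p0 _] := psi01 x; rewrite mulr_ge0.
have mh n : measurable_fun [set: leb_rV R d] (fun x => (h n x)%:E).
  by apply/measurable_EFinP; exact: (intg_measurable (ih n)).
have F1 : (\int[mu]_x (psi x * (f x / c) + psi x * `|C|)%:E <= (B + P)%:E)%E.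
  apply: (@le_trans _ _ (\int[mu]_x limn_einf (fun n => (h n x)%:E))%E).
    apply: ge0_le_integral.
    - exact: measurableT.
    - by move=> x _; rewrite lee_fin addr_ge0.
    - apply/measurable_EFinP; apply: measurable_funD; first exact: mpf.
      exact: (intg_measurable iCpsi).
    - under eq_fun do rewrite lim_eq.
      exact: measurable_fun_limn_esup.
    - by move=> x _; exact: lim_ge.
  have := @fatou _ _ _ mu setT measurableT (fun n x => (h n x)%:E) mh
    (fun n x _ => h0 n x).
  move=> /le_trans; apply; rewrite limn_einf_lim.
  apply: lime_le; first exact: is_cvg_einfs.
  apply: nearW => n; apply: le_trans (hB n).
  by apply: ereal_inf_lbound; exists n => /=.
have F2 := ge0_integral_cancel mpf pf0 iCpsi pC0 F1.
have mpsif : measurable_fun [set: leb_rV R d] (fun x => psi x * f x).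
  by apply: measurable_funM; [exact: mpsi|exact: mf].
have pf0' x : 0 <= psi x * f x.
  by have /andP[p0 _] := psi01 x; rewrite mulr_ge0.
apply: (ge0_integral_scale mpsif pf0' c0).
by under eq_integral do rewrite -mulrA.
Qed.

End cutoff.
End duality.

(** * Capacity of cubes, from averages at successive scales *)

Section mean_gap.
Context d (T : measurableType d) (R : realType)
  (mu : {sigma_finite_measure set T -> \bar R}).
Implicit Types (f h : T -> R).
Local Notation intg f := (mu.-integrable setT (EFin \o f)).
Local Notation intg2 F := ((mu \x mu)%E.-integrable setT (EFin \o F)).

Lemma intg_mul_indic (A : set T) (g : T -> R) : measurable A -> intg g ->
  intg (fun x => g x * \1_A x).
Proof.
move=> mA ig; have iag : intg (fun x => `|g x|) := integrable_abse ig.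
apply: (le_intg _ iag).
  by apply: measurable_funM; [exact: intg_measurable ig|exact: measurable_indic].
move=> x; rewrite normrM indicE ler_piMr//.
by case: (x \in A); rewrite ?normr1 ?normr0.
Qed.

(* Jensen's inequality for t |-> t^2, in the form of its tangent line at the
   difference of the means. *)
Lemma mean_gap_energy (D E : set T) (g : T -> R) (K : T -> T -> R) (kappa vD vE : R) :
  measurable D -> measurable E -> mu D = vD%:E -> mu E = vE%:E -> 0 < vD -> 0 < vE ->
  intg g -> 0 <= kappa -> (forall x y, 0 <= K x y) ->
  (forall x y, D x -> E y -> kappa <= K x y) ->
  intg2 (fun z => (g z.1 - g z.2) ^+ 2 * K z.1 z.2) ->
  kappa * vD * vE *
    ((\int[mu]_x (g x * \1_D x)) / vD - (\int[mu]_x (g x * \1_E x)) / vE) ^+ 2 <=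
  \int[(mu \x mu)%E]_z ((g z.1 - g z.2) ^+ 2 * K z.1 z.2).
Proof.
move=> mD mE muD muE vD0 vE0 ig k0 K0 Kk i2.
have mg := intg_measurable ig.
have iD : intg (\1_D : T -> R) by apply: intg_indic => //; rewrite muD ltry.
have iE : intg (\1_E : T -> R) by apply: intg_indic => //; rewrite muE ltry.
have igD := intg_mul_indic mD ig; have igE := intg_mul_indic mE ig.
have ID : \int[mu]_x \1_D x = vD.
  by rewrite /Rintegral integral_indic// setIT; exact: (congr1 fine muD).
have IE : \int[mu]_x \1_E x = vE.
  by rewrite /Rintegral integral_indic// setIT; exact: (congr1 fine muE).
set GD := \int[mu]_x (g x * \1_D x); set GE := \int[mu]_x (g x * \1_E x).
set s := GD / vD - GE / vE.
have [t1 e1] := Rint_tensor igD iE; have [t2 e2] := Rint_tensor iD igE.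
have [t3 e3] := Rint_tensor iD iE.
pose F z := kappa * (2 * s * (g z.1 * \1_D z.1 * \1_E z.2) -
   2 * s * (\1_D z.1 * (g z.2 * \1_E z.2)) - s ^+ 2 * (\1_D z.1 * \1_E z.2)).
have i12 := intgB (intgZl (2 * s) t1) (intgZl (2 * s) t2).
have i123 := intgB i12 (intgZl (s ^+ 2) t3).
have iF : intg2 F := intgZl kappa i123.
apply: (@le_trans _ _ (\int[(mu \x mu)%E]_z F z)).
  rewrite /F (RintegralZl _ measurableT i123).
  rewrite (RintegralB measurableT i12 (intgZl (s ^+ 2) t3)).
  rewrite (RintegralB measurableT (intgZl (2 * s) t1) (intgZl (2 * s) t2)).
  rewrite (RintegralZl _ measurableT t1) (RintegralZl _ measurableT t2)
    (RintegralZl _ measurableT t3) e1 e2 e3 ID IE -/GD -/GE.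
  have GDE : GD = GD / vD * vD by rewrite mulfVK// gt_eqF.
  have GEE : GE = GE / vE * vE by rewrite mulfVK// gt_eqF.
  have : forall A B : R, GD = A * vD -> GE = B * vE -> s = A - B ->
    kappa * vD * vE * s ^+ 2 <=
    kappa * (2 * s * (GD * vE) - 2 * s * (vD * GE) - s ^+ 2 * (vD * vE)).
    move=> A B -> -> ->; rewrite le_eqVlt; apply/orP; left; apply/eqP; ring.
  by apply; [exact: GDE|exact: GEE|].
apply: le_Rint => // -[x y]; rewrite /F /= !indicE.
have P0 : 0 <= (g x - g y) ^+ 2 * K x y by rewrite mulr_ge0// sqr_ge0.
have [|_] := boolP (x \in D); last by rewrite !(mulr0, mul0r, subr0).
have [|_] := boolP (y \in E); last by rewrite !(mulr0, mul0r, subr0).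
rewrite !inE !mulr1 !mul1r => yE xD.
apply: (@le_trans _ _ ((g x - g y) ^+ 2 * kappa)); last first.
  by rewrite ler_wpM2l ?sqr_ge0// Kk.
by rewrite mulrC ler_wpM2r//; have := sqr_ge0 (g x - g y - s); rewrite !expr2; lra.
Qed.

End mean_gap.

Section pigeonhole.
Context {R : realType}.

(** The quantities (1 - theta) / 4 * theta^k sum to 1/4: if every drop were smaller than its own, m
    would stay above 1/4. *)
Lemma telescoping_gap (m : nat -> R) (theta : R) : 0 < theta < 1 -> 1 / 2 <= m 0%N ->
  (exists k, m k <= 1 / 4) -> exists k, (1 - theta) / 4 * theta ^+ k <= m k - m k.+1.
Proof.
move=> /andP[t0 t1] m0 [n mn]; apply: contrapT => /forallNP H.
have {}H k : m k - m k.+1 < (1 - theta) / 4 * theta ^+ k by rewrite ltNge; exact/negP.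
have G k : 1 / 4 + theta ^+ k / 4 <= m k.
  elim: k => [|k IH]; first by rewrite expr0; lra.
  by have := H k; rewrite exprS; lra.
have := G n; have : 0 < theta ^+ n by rewrite exprn_gt0.
lra.
Qed.

End pigeonhole.

Section capacity.
Context {R : realType} {d : nat}.
Implicit Types (x y : 'rV[R]_d) (rho w : R).
Local Notation mu := (lebesgue_rV R d).
Local Notation intg f := (mu.-integrable setT (EFin \o f)).
Local Notation intg2 F := ((mu \x mu)%E.-integrable setT (EFin \o F)).

(** The centre (w, ..., w) moves with the scale, so that points of the cubes of scales w and 2w are
    at distance between w / 2 and 2dw; the kernel between the two cubes is then of order
    w^(-d-a). *)
Definition cube w : set 'rV[R]_d := rect (fun _ => ball w (w / 8)).

Lemma measurable_cube w : measurable (cube w : set (leb_rV R d)).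
Proof.
apply: measurable_set_borel_lebesgue; apply: measurable_rect => i.
exact: measurable_ball.
Qed.

Lemma lebesgue_rV_cube_diag w : 0 < w -> mu (cube w) = ((w / 4) ^+ d)%:E.
Proof.
move=> w0; have w80 : 0 <= w / 8 by rewrite divr_ge0// ltW.
have := @lebesgue_rV_cube R d (const_mx w) (w / 8) w80.
have -> : w / 8 *+ 2 = w / 4 by rewrite mulr2n; lra.
by rewrite (_ : (fun i => ball _ _) = fun=> ball w (w / 8))//; apply/funext => i; rewrite mxE.
Qed.

Hypothesis d1 : (1 <= d)%N.

Lemma cube_coord w x i : cube w x -> 7 / 8 * w < x ord0 i < 9 / 8 * w.
Proof. by move=> /(_ i); rewrite /ball/= => /ltr_normlP[]; lra. Qed.

Lemma cube_enorm w x : 0 < w -> cube w x -> w / 2 <= enorm x <= 2 * d%:R * w.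
Proof.
move=> w0 xw; have wi i := cube_coord i xw.
apply/andP; split.
  have := wi (Ordinal d1); have := coord_le_enorm x (Ordinal d1).
  by move=> /ler_normlP[]; lra.
apply: (le_trans (enorm_le_norm x)); rewrite -mulrA mulrCA ler_wpM2l//.
rewrite [leLHS]mx_normrE; apply: bigmax_le; first by rewrite mulr_ge0// ltW.
by move=> [i j] _ /=; rewrite (ord1 i) ler_norml; have := wi j; lra.
Qed.

Lemma cube_dist w x y : 0 < w -> cube w x -> cube (2 * w) y ->
  w / 2 < enorm (x - y) <= 2 * d%:R * w.
Proof.
move=> w0 xw yw; have xi i := cube_coord i xw; have yi i := cube_coord i yw.
apply/andP; split.
  have := coord_le_enorm (x - y) (Ordinal d1); rewrite !mxE.
  have := xi (Ordinal d1); have := yi (Ordinal d1).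
  by move=> ? ? /ler_normlP[]; lra.
apply: (le_trans (enorm_le_norm _)); rewrite -mulrA mulrCA ler_wpM2l//.
rewrite [leLHS]mx_normrE; apply: bigmax_le; first by rewrite mulr_ge0// ltW.
by move=> [i j] _ /=; rewrite (ord1 i) !mxE ler_norml; have := xi j; have := yi j; lra.
Qed.

Definition capacity_theta (a : R) : R := 2 `^ (- ((d%:R - a) / 2)).

(** The factors come from the kernel at distance 2dw, from the product (w/4)^d (w/2)^d of the
    volumes of consecutive cubes, and from the squared gap between averages; the powers of w and
    theta combine into rho^(d-a). *)
Definition capacity_cst (a : R) : R :=
  ((2 * d%:R) `^ (d%:R + a))^-1 * 8 ^- d * ((1 - capacity_theta a) / 4) ^+ 2.

Variable a : R.
Hypotheses (a02 : 0 < a < 2) (ad : a < d%:R).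

Lemma capacity_theta_lt1 : 0 < capacity_theta a < 1.
Proof. by apply: powR2_lt1; rewrite divr_gt0// subr_gt0. Qed.

Lemma capacity_cst_gt0 : 0 < capacity_cst a.
Proof.
have /andP[t0 t1] := capacity_theta_lt1.
have dd : 0 < d%:R :> R by rewrite ltr0n.
apply: mulr_gt0; last by rewrite exprn_gt0// divr_gt0// subr_gt0.
by rewrite mulr_gt0// invr_gt0 ?exprn_gt0// powR_gt0// mulr_gt0.
Qed.

Let a0 : 0 < a. Proof. by case/andP: a02. Qed.
Let a2 : a < 2. Proof. by case/andP: a02. Qed.

Lemma intg2_energy (g : 'rV[R]_d -> R) M e : 0 < e -> 0 <= M ->
  measurable_fun [set: leb_rV R d] g -> (forall x, 0 <= g x <= 1) ->
  (forall x, M <= enorm x -> g x = 0) ->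
  intg2 (fun z : leb_rV R d * leb_rV R d => (g z.1 - g z.2) ^+ 2 * tkern a e z.1 z.2).
Proof.
move=> e0 M0 mg g01 gM.
have mg12 : measurable_fun [set: leb_rV R d * leb_rV R d] (fun z => (g z.1 - g z.2) ^+ 2).
  apply: measurable_funX; apply: measurable_funB.
    exact: measurable_fst_fun.
  exact: measurable_snd_fun.
apply: (intg2_mul_tkern a02 e0 M0 mg12 ler01) => -[x y] /=.
rewrite mul1r ger0_norm ?sqr_ge0// !indicE.
have gB z : z \notin eball 0 M -> g z = 0.
  by rewrite notin_setE /eball/= subr0 => /negP; rewrite -leNgt; exact: gM.
have gx := g01 x; have gy := g01 y.
have [|/gB ->] := boolP (x \in _); have [|/gB ->] := boolP (y \in _).
- by move=> _ _ /=; rewrite expr2; nra.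
- by move=> _; rewrite subr0 addr0 /=; rewrite expr2; nra.
- by move=> _; rewrite sub0r sqrrN add0r /=; rewrite expr2; nra.
- by rewrite subr0 expr0n addr0.
Qed.

(* Averages of g over cubes escaping to infinity along a geometric sequence of
   scales go from 1/2 to 0, so by the pigeonhole principle two consecutive ones
   differ by at least const * theta^k; theta is chosen so that the resulting
   energy bound does not depend on k. *)
Lemma capacity_lower_bound (g : 'rV[R]_d -> R) M e rho : 0 < e -> 0 <= M ->
  0 < rho -> e <= rho / 2 -> measurable_fun [set: leb_rV R d] g ->
  (forall x, 0 <= g x <= 1) -> (forall x, M <= enorm x -> g x = 0) ->
  (forall x, cube rho x -> 1 / 2 <= g x) ->
  capacity_cst a * rho `^ (d%:R - a) <=
  \int[(mu \x mu)%E]_z ((g z.1 - g z.2) ^+ 2 * tkern a e z.1 z.2).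
Proof.
move=> e0 M0 rho0 erho mg g01 gM grho.
have i2 := intg2_energy e0 M0 mg g01 gM.
have ig : intg g := intg_cutoff mg g01 gM M0.
pose w k := 2 ^+ k * rho.
have w0 k : 0 < w k by rewrite mulr_gt0 ?exprn_gt0.
have wS k : w k.+1 = 2 * w k by rewrite /w exprS mulrA.
pose v k := (w k / 4) ^+ d.
have v0 k : 0 < v k by rewrite exprn_gt0 ?divr_gt0.
pose m k := (\int[mu]_x (g x * \1_(cube (w k)) x)) / v k.
have muv k : mu (cube (w k)) = (v k)%:E := lebesgue_rV_cube_diag (w0 k).
have dd : 0 < d%:R :> R by rewrite ltr0n.
have da : 0 <= d%:R + a by rewrite addr_ge0// ltW.
have igc k : intg (fun x => g x * \1_(cube (w k)) x).
  exact: intg_mul_indic (measurable_cube _) ig.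
have ic k : intg (\1_(cube (w k)) : 'rV[R]_d -> R).
  by apply: intg_indic; [exact: measurable_cube|rewrite muv ltry].
have Ic k : \int[mu]_x \1_(cube (w k)) x = v k.
  rewrite /Rintegral (integral_indic _ measurableT (measurable_cube _)) setIT.
  exact: (congr1 fine (muv k)).
have wr0 : w 0%N = rho by rewrite /w expr0 mul1r.
have m0 : 1 / 2 <= m 0%N.
  rewrite /m ler_pdivlMr// -[in leLHS]Ic -(RintegralZl _ measurableT (ic 0%N)).
  apply: le_Rint; [exact: intgZl|exact: igc|move=> x].
  rewrite indicE; have [|_] := boolP (x \in _); rewrite ?mulr0// inE wr0 !mulr1.
  exact: grho.
have mex : exists k, m k <= 1 / 4.
  pose G := \int[mu]_x g x.
  have mG k : m k <= G / v k.
    rewrite /m ler_pM2r ?invr_gt0//; apply: le_Rint => // x.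
    rewrite indicE; have /andP[gx0 _] := g01 x.
    by case: (x \in _); rewrite ?mulr1// mulr0.
  pose n := Num.truncn (4 * G / (rho / 4) ^+ d); exists n.
  apply: (le_trans (mG n)).
  have r4 : 0 < (rho / 4) ^+ d by rewrite exprn_gt0 ?divr_gt0.
  rewrite ler_pdivrMr//; suff : 4 * G <= v n by lra.
  apply: (@le_trans _ _ (n.+1%:R * (rho / 4) ^+ d)).
    by rewrite -ler_pdivrMr//; apply/ltW/truncnS_gt.
  have -> : v n = (2 ^+ n) ^+ d * (rho / 4) ^+ d.
    by rewrite /v /w -mulrA exprMn.
  rewrite ler_wpM2r ?(ltW r4)//.
  apply: (@le_trans _ _ (2 ^+ n)); first by rewrite -natrX ler_nat ltn_expl.
  by rewrite -[leLHS]expr1 ler_weXn2l// exprn_ege1// ler1n.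
have [k Hk] := telescoping_gap capacity_theta_lt1 m0 mex.
pose kap := ((2 * d%:R * w k) `^ (d%:R + a))^-1.
have kap0 : 0 <= kap by rewrite invr_ge0 powR_ge0.
have kapK x y : cube (w k) x -> cube (w k.+1) y -> kap <= tkern a e x y.
  rewrite wS => xw yw; have /andP[l1 l2] := cube_dist (w0 k) xw yw.
  have rw : rho <= w k by rewrite /w ler_peMl ?(ltW rho0)// exprn_ege1// ler1n.
  have e1 : e < enorm (x - y) by lra.
  by rewrite /tkern e1; apply: kern_ge => //; exact: lt_trans e1.
have := mean_gap_energy (measurable_cube (w k)) (measurable_cube (w k.+1)) (muv k)
  (muv k.+1) (v0 k) (v0 k.+1) ig kap0 (@tkern_ge0 R d a e) kapK i2.
rewrite -/(m k) -/(m k.+1); apply: le_trans.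
have /andP[th0 th1] := capacity_theta_lt1.
have Hk0 : 0 <= (1 - capacity_theta a) / 4 * capacity_theta a ^+ k.
  by rewrite mulr_ge0 ?exprn_ge0 ?divr_ge0 ?subr_ge0 ?(ltW th0) ?(ltW th1).
apply: (@le_trans _ _ (kap * v k * v k.+1 *
    ((1 - capacity_theta a) / 4 * capacity_theta a ^+ k) ^+ 2)); last first.
  rewrite ler_wpM2l ?mulr_ge0 ?(ltW (v0 _))// lerXn2r ?nnegrE// (le_trans Hk0)//.
have E1 : kap * v k * v k.+1 =
    ((2 * d%:R) `^ (d%:R + a))^-1 * 8 ^- d * w k `^ (d%:R - a).
  rewrite /kap /v wS (@powRM R (2 * d%:R) (w k)) ?(ltW (w0 k)) ?mulr_ge0// [(_ * w k `^ _)^-1]invfM.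
  have -> : (2 * w k / 4) ^+ d = 2 ^+ d * (w k / 4) ^+ d.
    by rewrite -exprMn; congr (_ ^+ _); ring.
  rewrite !expr_div_n powRB; last by rewrite (gt_eqF (w0 k)) implybT.
  have P := powR_volume (d := d) a (w0 k).
  rewrite powR_mulrn ?(ltW (w0 k))//.
  rewrite powRN in P.
  have -> : (8 : R) ^- d = 2 ^+ d * (4 ^- d) * (4 ^- d).
    have -> : (8 : R) = 4 * 4 / 2 by field.
    by rewrite expr_div_n exprMn invf_div invfM; ring.
  rewrite -P; field.
  by rewrite expf_neq0// !gt_eqF// powR_gt0// mulr_gt0.
have E2 : w k `^ (d%:R - a) * (capacity_theta a ^+ k) ^+ 2 = rho `^ (d%:R - a).
  rewrite /w powRM ?exprn_ge0 ?(ltW rho0)// exp_powR2 /capacity_theta mulrAC.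
  rewrite -exprM mulnC exprM -exprMn.
  have -> : 2 `^ (d%:R - a) * (2 `^ (- ((d%:R - a) / 2))) ^+ 2 = 1 :> R.
    rewrite powR_exp -powRD; last by rewrite pnatr_eq0 implybT.
    have -> : d%:R - a + - ((d%:R - a) / 2) * 2 = 0 by field.
    by rewrite powRr0.
  by rewrite expr1n mul1r.
rewrite E1 exprMn /capacity_cst -E2 le_eqVlt; apply/orP; left; apply/eqP; ring.
Qed.

End capacity.

(** * Testing the inequality with a paraboloid *)

Section test_with_paraboloid.
Context {R : realType} {d : nat}.
Implicit Types (x y h : 'rV[R]_d) (e g rho r : R).
Local Notation mu := (lebesgue_rV R d).
Local Notation intg f := (mu.-integrable setT (EFin \o f)).
Local Notation intg2 F := ((mu \x mu)%E.-integrable setT (EFin \o F)).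

Variables (a : R) (u : 'rV[R]_d -> R).
Hypotheses (d1 : (1 <= d)%N) (a02 : 0 < a < 2) (cu : continuous u)
  (u0 : forall x, 0 <= u x) (wu : weighted_L1 a u).

Let a0 : 0 < a. Proof. by case/andP: a02. Qed.
Let a2 : a < 2. Proof. by case/andP: a02. Qed.

Lemma intg_diff_tkern (psi : 'rV[R]_d -> R) e x : 0 < e ->
  measurable_fun [set: leb_rV R d] psi -> (forall x, 0 <= psi x <= 1) ->
  intg (fun y => (psi x - psi y) * tkern a e x y).
Proof.
move=> e0 mpsi p01; have itk := @intg_tkern R d a e x a0 a2 e0.
apply: (le_intg _ itk).
  apply: measurable_funM; last exact: measurable_tkernL.
  by apply: measurable_funB; [exact: measurable_cst|exact: mpsi].
move=> y; rewrite normrM [X in _ * X]ger0_norm ?tkern_ge0//.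
rewrite ler_piMl ?tkern_ge0// ler_norml.
by have := p01 x; have := p01 y; lra.
Qed.

Lemma trunc_fraclap_cutoff_duality (psi : 'rV[R]_d -> R) M e : 0 < e -> 0 <= M ->
  measurable_fun [set: leb_rV R d] psi -> (forall x, 0 <= psi x <= 1) ->
  (forall x, M <= enorm x -> psi x = 0) ->
  intg (fun x => u x * trunc_fraclap a e psi x) /\
  \int[mu]_x (psi x * trunc_fraclap a e u x) = \int[mu]_x (u x * trunc_fraclap a e psi x).
Proof.
move=> e0 M0 mpsi p01 pM.
have [S S0 HS] := bounded_on_eball cu M.
have iF := intg2_cutoff a02 cu u0 wu mpsi p01 pM M0 e0.
have mu' := continuous_measurable_leb_rV cu.
have mA : measurable_fun [set: leb_rV R d * leb_rV R d] (fun z => psi z.1 * u z.1).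
  by apply: measurable_funM; exact: measurable_fst_fun.
have iA : intg2 (fun z : leb_rV R d * leb_rV R d => psi z.1 * u z.1 * tkern a e z.1 z.2).
  apply: (intg2_mul_tkern a02 e0 M0 mA (ltW S0)) => -[x y] /=.
  have /andP[px0 px1] := p01 x.
  rewrite ger0_norm ?mulr_ge0// !indicE.
  have [|] := boolP (x \in eball 0 M).
    rewrite inE /eball/= subr0 => xM; apply: (@le_trans _ _ S).
      by apply: (@le_trans _ _ (u x)); [rewrite ler_piMl|exact/HS/ltW].
    by rewrite ler_peMr ?(ltW S0)//= lerDl.
  rewrite notin_setE /eball/= subr0 => /negP; rewrite -leNgt => /pM ->.
  by rewrite mul0r mulr_ge0// ltW.
(* The integrand of [iB] is psi(x) u(y) times the kernel; swapped and subtracted from that of [iA],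
   it leaves u(x) (psi(x) - psi(y)), whose integrability is not immediate because u may be
   unbounded. *)
have iB := intgB iA iF.
have iBs := intg2_swap iB.
have iG : intg2 (fun z : leb_rV R d * leb_rV R d =>
    u z.1 * (psi z.1 - psi z.2) * tkern a e z.1 z.2).
  have := intgB iA iBs.
  congr (integrable _ _ _); apply/funext => -[x y] /=; congr EFin.
  by rewrite (tkernC a e y x); ring.
have ik x := intg_diff_tkern x e0 mpsi p01.
have [_ E1] := dirichlet_cutoff a02 cu u0 wu mpsi p01 pM M0 e0.
have [_ E2] := @dirichlet _ _ _ mu (tkern a e) (@tkernC R d a e) u psi iG ik.
split.
  have iGx x : intg (fun y => u x * (psi x - psi y) * tkern a e x y).
    have := intgZl (u x) (ik x).
    by congr (integrable _ _ _); apply/funext => y /=; rewrite mulrA.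
  have [H _] := Rintegral_prod iG iGx.
  suff -> : (fun x => u x * trunc_fraclap a e psi x) =
      (fun x => \int[mu]_y (u x * (psi x - psi y) * tkern a e x y)) by exact: H.
  apply/funext => x; rewrite /trunc_fraclap -(RintegralZl (u x) measurableT (ik x)).
  by apply: eq_Rintegral => y _; rewrite mulrA.
have two : (2 : R) != 0 by rewrite pnatr_eq0.
apply: (mulfI two); apply: (etrans (esym E1)); apply: (etrans _ E2).
by apply: eq_Rintegral => -[x y] _ /=; rewrite [_ * (u x - u y)]mulrC.
Qed.

Lemma trunc_fraclap_le0 (psi : 'rV[R]_d -> R) e x : 0 < e ->
  measurable_fun [set: leb_rV R d] psi -> (forall y, 0 <= psi y <= 1) ->
  psi x = 0 -> trunc_fraclap a e psi x <= 0.
Proof.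
move=> e0 mpsi p01 px.
have i0 : intg (fun _ : leb_rV R d => 0 : R) := integrable0 _ _.
have : trunc_fraclap a e psi x <= \int[mu]_(y in [set: leb_rV R d]) (0 : R).
  apply: (le_Rint (intg_diff_tkern x e0 mpsi p01) i0) => y.
  have /andP[py _] := p01 y.
  by rewrite px sub0r mulNr oppr_le0 mulr_ge0 ?tkern_ge0.
by rewrite /Rintegral integral0.
Qed.

Hypotheses (hu : holder_plus exterior a u)
  (su : forall x, exterior x -> 0 < fraclap a u x).

Definition source_cst : R :=
  @fraclap_const R d a * (@kern_cst R d a 2 * 2 `^ a).

(** The truncated operator is moved onto the paraboloid, where it is at most [kern_cst] (r/2)^(-a),
    and nonpositive at points where the paraboloid vanishes. The part of u outside B(0, 4r) thus
    only helps, and only its mass in that ball remains. *)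
Lemma source_le (f : 'rV[R]_d -> R) r x :
  measurable_fun [set: leb_rV R d] f -> (forall x, 0 <= f x) ->
  (forall x, exterior x -> f x <= fraclap a u x) ->
  16 <= r -> enorm x = r ->
  (\int[mu]_y (paraboloid x (r / 2) y * f y)%:E <=
    (source_cst * r `^ (- a) * mass u (4 * r))%:E)%E.
Proof.
move=> mf f0 fL r16 xr; have r0 : 0 < r by lra.
have rho0 : 0 < r / 2 by rewrite divr_gt0.
pose psi := paraboloid x (r / 2).
have mp := measurable_paraboloid x (r / 2).
have mpsi : measurable_fun [set: leb_rV R d] psi := measurable_borel_lebesgue mp.
have p01 y : 0 <= psi y <= 1 by rewrite paraboloid_ge0 paraboloid_le1.
have r40 : 0 <= 4 * r by rewrite mulr_ge0// ltW.
have pM y : 4 * r <= enorm y -> psi y = 0.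
  move=> ry; rewrite /psi paraboloid_eq0//.
  by have := enorm_sub_ge y x; lra.
have pr1 y : enorm y < 2 -> psi y = 0.
  move=> ry; rewrite /psi paraboloid_eq0//.
  by have := enorm_sub_ge x y; rewrite enormB; lra.
have -> : source_cst * r `^ (- a) * mass u (4 * r) =
    @fraclap_const R d a * (@kern_cst R d a 2 * (r / 2) `^ (- a) * mass u (4 * r)).
  rewrite powRM ?(ltW r0)// -[2^-1]powR_inv1// -powRrM mulN1r opprK /source_cst; ring.
apply: (fatou_cutoff a02 cu u0 wu mpsi p01 pM r40 hu su _ pr1 mf f0 fL).
  by rewrite ltr1n.
exists 1 => // e e0 _.
have [i1 ->] := trunc_fraclap_cutoff_duality e0 r40 mpsi p01 pM.
have im := intg_mass cu u0 0 r40.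
rewrite /mass -(RintegralZl _ measurableT im).
apply: (le_Rint i1); first exact: intgZl.
move=> y; rewrite mulrCA ler_wpM2l//.
have c0 : 0 <= @kern_cst R d a 2 * (r / 2) `^ (- a).
  by rewrite mulr_ge0 ?powR_ge0// ltW// kern_cst_gt0.
have [y4|y4] := leP (4 * r) (enorm y).
  apply: (le_trans (trunc_fraclap_le0 e0 mpsi p01 (pM _ y4))).
  by rewrite mulr_ge0// indicE.
rewrite indicE mem_set ?mulr1; last by rewrite /eball/= subr0.
have := @trunc_fraclap_le R d a e (r / 2) 2 psi y a02 e0 rho0 mp p01.
rewrite divff ?mul1r//; apply => //.
by move=> z; exact: paraboloid_second_difference.
Qed.

End test_with_paraboloid.

Section dirichlet_intg.
Context d (T : measurableType d) (R : realType)
  (mu : {sigma_finite_measure set T -> \bar R}).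
Local Notation intg f := (mu.-integrable setT (EFin \o f)).
Local Notation intg2 F := ((mu \x mu)%E.-integrable setT (EFin \o F)).

Lemma dirichlet_intg (f g : T -> R) (K : T -> T -> R) :
  intg2 (fun z => f z.1 * (g z.1 - g z.2) * K z.1 z.2) ->
  (forall x, intg (fun y => (g x - g y) * K x y)) ->
  intg (fun x => f x * \int[mu]_y ((g x - g y) * K x y)).
Proof.
move=> iF iFx.
have iF' x : intg (fun y => f x * (g x - g y) * K x y).
  have := intgZl (f x) (iFx x); congr (integrable _ _ _).
  by apply/funext => y /=; rewrite mulrA.
have [H _] := Rintegral_prod iF iF'.
suff -> : (fun x => f x * \int[mu]_y ((g x - g y) * K x y)) =
    (fun x => \int[mu]_y (f x * (g x - g y) * K x y)) by exact: H.
apply/funext => x; rewrite -(RintegralZl (f x) measurableT (iFx x)).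
by apply: eq_Rintegral => y _; rewrite mulrA.
Qed.

Lemma Rint_symm_le (F : T * T -> R) (B : R) : intg2 F ->
  \int[(mu \x mu)%E]_z F z <= B ->
  intg2 (fun z => F z + F (z.2, z.1)) /\
  \int[(mu \x mu)%E]_z (F z + F (z.2, z.1)) <= 2 * B.
Proof.
move=> iF FB; have iS := intg2_swap iF.
split; first exact: (intgD iF iS).
by rewrite (RintegralD measurableT iF iS) (Rintegral_swap iF); lra.
Qed.

End dirichlet_intg.

(** * Energy of the cutoff *)

Section cutoff_energy.
Context {R : realType} {d : nat}.
Implicit Types (x y : 'rV[R]_d) (e rho r : R).
Local Notation mu := (lebesgue_rV R d).
Local Notation intg f := (mu.-integrable setT (EFin \o f)).
Local Notation intg2 F := ((mu \x mu)%E.-integrable setT (EFin \o F)).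
Variable a : R.
Hypothesis a02 : 0 < a < 2.

Let a0 : 0 < a. Proof. by case/andP: a02. Qed.
Let a2 : a < 2. Proof. by case/andP: a02. Qed.

Lemma Rint_paraboloid_diff_le e r x : 0 < e -> 0 < r ->
  intg (fun y => (paraboloid 0 r x - paraboloid 0 r y) ^+ 2 * tkern a e x y) /\
  \int[mu]_y ((paraboloid 0 r x - paraboloid 0 r y) ^+ 2 * tkern a e x y) <=
    4 * (@kern_cst R d a 2 * r `^ (- a)).
Proof.
move=> e0 r0; have mp := measurable_borel_lebesgue (@measurable_paraboloid R d 0 r).
have mtk := measurable_borel_lebesgue (@measurable_trunc_kern R d a 2 r x).
have /measurable_EFinP mtk' := mtk.
have H := integral_trunc_kern_le x a0 a2 r0.
have it : intg (fun y => trunc_pow 2 r x y * kern a x y).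
  apply: (ge0_intg mtk' _ H); last exact: ltry.
  by move=> y; rewrite mulr_ge0 ?trunc_pow_ge0 ?kern_ge0.
have it4 := intgZl 4 it.
have pw y : (paraboloid 0 r x - paraboloid 0 r y) ^+ 2 * tkern a e x y <=
    4 * (trunc_pow 2 r x y * kern a x y).
  rewrite mulrA ler_pM ?sqr_ge0 ?tkern_ge0 ?tkern_le_kern//.
  exact: paraboloid_lipschitz.
have i1 : intg (fun y => (paraboloid 0 r x - paraboloid 0 r y) ^+ 2 * tkern a e x y).
  apply: (le_intg _ it4).
    apply: measurable_funM; last exact: measurable_tkernL.
    apply: measurable_funX; apply: measurable_funB; last exact: mp.
    exact: measurable_cst.
  by move=> y; rewrite ger0_norm// mulr_ge0 ?sqr_ge0 ?tkern_ge0.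
split => //; apply: (le_trans (le_Rint i1 it4 pw)).
rewrite (RintegralZl _ measurableT it) ler_wpM2l//.
by have /Rintegral_leP := H; apply.
Qed.

(** Keeping the weight h charges the energy to the mass of h instead of the volume of the ball. It
    is used with a truncation of u, whose mass is to be bounded below, and with h = 1. *)
Lemma paraboloid_energy_le (h : 'rV[R]_d -> R) e r : 0 < e -> 0 < r ->
  measurable_fun [set: leb_rV R d] h -> (forall x, 0 <= h x <= 1) ->
  intg2 (fun z : leb_rV R d * leb_rV R d => h z.1 * \1_(eball 0 r) z.1 *
    (paraboloid 0 r z.1 - paraboloid 0 r z.2) ^+ 2 * tkern a e z.1 z.2) /\
  \int[(mu \x mu)%E]_z (h z.1 * \1_(eball 0 r) z.1 *
    (paraboloid 0 r z.1 - paraboloid 0 r z.2) ^+ 2 * tkern a e z.1 z.2) <=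
  4 * (@kern_cst R d a 2 * r `^ (- a)) * mass h r.
Proof.
move=> e0 r0 mh h01.
have mp : measurable_fun [set: leb_rV R d] (@paraboloid R d 0 r).
  exact: (measurable_borel_lebesgue (@measurable_paraboloid R d 0 r)).
have mI : measurable_fun [set: leb_rV R d] (\1_(eball 0 r) : 'rV[R]_d -> R).
  by apply: measurable_indic; exact: measurable_eball.
have mF : measurable_fun [set: leb_rV R d * leb_rV R d] (fun z => h z.1 *
    \1_(eball 0 r) z.1 * (paraboloid 0 r z.1 - paraboloid 0 r z.2) ^+ 2 : R).
  apply: measurable_funM.
    by apply: measurable_funM; exact: measurable_fst_fun.
  apply: measurable_funX; apply: measurable_funB.
    exact: measurable_fst_fun.
  exact: measurable_snd_fun.
have iF := intg2_mul_tkern a02 e0 (ltW r0) mF ler01.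
have {}iF : intg2 (fun z : leb_rV R d * leb_rV R d => h z.1 * \1_(eball 0 r) z.1 *
    (paraboloid 0 r z.1 - paraboloid 0 r z.2) ^+ 2 * tkern a e z.1 z.2).
  apply: iF => -[x y] /=; rewrite mul1r.
  have /andP[hx0 hx1] := h01 x.
  have p1 := paraboloid_ge0 0 r x; have p2 := paraboloid_le1 0 r x.
  have p3 := paraboloid_ge0 0 r y; have p4 := paraboloid_le1 0 r y.
  have s1 : (paraboloid 0 r x - paraboloid 0 r y) ^+ 2 <= 1 by rewrite expr2; nra.
  rewrite !indicE; case: (x \in _) => /=; last by rewrite !(mulr0, mul0r) normr0 add0r.
  rewrite mulr1 ger0_norm; last exact: mulr_ge0 hx0 (sqr_ge0 _).
  apply: (@le_trans _ _ 1); last by rewrite lerDl.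
  exact: (mulr_ile1 hx0 (sqr_ge0 _) hx1 s1).
split; first exact: iF.
have ix x : intg (fun y => h x * \1_(eball 0 r) x *
    (paraboloid 0 r x - paraboloid 0 r y) ^+ 2 * tkern a e x y).
  have := intgZl (h x * \1_(eball 0 r) x) (Rint_paraboloid_diff_le x e0 r0).1.
  by congr (integrable _ _ _); apply/funext => y /=; rewrite mulrA.
have [i1 E] := Rintegral_prod iF ix.
rewrite -E; have ie := intg_eball (0 : 'rV[R]_d) (ltW r0).
have ihe : intg (fun y => h y * \1_(eball 0 r) y).
  apply: (le_intg _ ie); first by apply: measurable_funM.
  move=> y; have /andP[hy0 hy1] := h01 y.
  by rewrite ger0_norm ?indicE ?mulr_ge0// ler_piMl.
rewrite /mass -(RintegralZl _ measurableT ihe).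
apply: le_Rint; [exact: i1|exact: (intgZl _ ihe)|move=> x].
rewrite /=.
have -> : \int[mu]_y (h x * \1_(eball 0 r) x *
    (paraboloid 0 r x - paraboloid 0 r y) ^+ 2 * tkern a e x y) =
  h x * \1_(eball 0 r) x * \int[mu]_y
    ((paraboloid 0 r x - paraboloid 0 r y) ^+ 2 * tkern a e x y).
  rewrite -(RintegralZl _ measurableT (Rint_paraboloid_diff_le x e0 r0).1).
  by apply: eq_Rintegral => y _; rewrite mulrA.
rewrite mulrC ler_wpM2r//; last exact: (Rint_paraboloid_diff_le x e0 r0).2.
by have /andP[hx0 _] := h01 x; rewrite mulr_ge0// indicE.
Qed.

End cutoff_energy.

(** * Lower bound on the growth of the mass *)

Section mass_lower_bound.
Context {R : realType} {d : nat}.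
Implicit Types (x y : 'rV[R]_d) (e rho r : R).
Local Notation mu := (lebesgue_rV R d).
Local Notation intg f := (mu.-integrable setT (EFin \o f)).
Local Notation intg2 F := ((mu \x mu)%E.-integrable setT (EFin \o F)).

(** The algebra of testing with (1 - Y) c^2: the two sides differ by nonnegative terms and by
    products that vanish by hypothesis. The square of Yx cx - Yy cy will give a capacity, the square
    of cx - cy is the cost of the cutoff, and the terms in z are jumps between the ball of radius 2
    and the support of the test function. *)
Lemma dirichlet_pointwise_le (eps Yx Yy zx zy px py cx cy : R) : 0 <= eps ->
  0 <= px -> 0 <= py -> Yx <= 1 -> Yy <= 1 ->
  (1 - Yx) * px = 0 -> (1 - Yy) * py = 0 ->
  (1 - Yx) * zx = 0 -> (1 - Yy) * zy = 0 ->
  ((1 - Yx) * cx ^+ 2 - (1 - Yy) * cy ^+ 2) *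
    (eps * (Yx - zx) + px - (eps * (Yy - zy) + py)) <=
  eps * ((Yx - Yy) * (cx ^+ 2 - cy ^+ 2) - (Yx * cx - Yy * cy) ^+ 2 +
    Yx * Yy * (cx - cy) ^+ 2 +
    (zx * ((1 - Yy) * cy ^+ 2) + zy * ((1 - Yx) * cx ^+ 2))).
Proof.
move=> e0 px0 py0 Yx1 Yy1 xp yp xz yz; rewrite -subr_ge0.
have -> : eps * ((Yx - Yy) * (cx ^+ 2 - cy ^+ 2) - (Yx * cx - Yy * cy) ^+ 2 +
    Yx * Yy * (cx - cy) ^+ 2 +
    (zx * ((1 - Yy) * cy ^+ 2) + zy * ((1 - Yx) * cx ^+ 2))) -
  ((1 - Yx) * cx ^+ 2 - (1 - Yy) * cy ^+ 2) *
    (eps * (Yx - zx) + px - (eps * (Yy - zy) + py)) =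
  ((1 - Yx) * py * cx ^+ 2 + (1 - Yy) * px * cy ^+ 2) -
  ((1 - Yx) * px) * cx ^+ 2 - ((1 - Yy) * py) * cy ^+ 2 +
  eps * (((1 - Yx) * zx) * cx ^+ 2 + ((1 - Yy) * zy) * cy ^+ 2) by ring.
rewrite xp yp xz yz !mul0r addr0 mulr0 addr0 !subr0.
have A : 0 <= 1 - Yx by rewrite subr_ge0.
have B : 0 <= 1 - Yy by rewrite subr_ge0.
by rewrite addr_ge0// (mulr_ge0 _ (sqr_ge0 _))// mulr_ge0.
Qed.

Lemma intg_mul_indic_bounded (h : 'rV[R]_d -> R) r :
  measurable_fun [set: leb_rV R d] h -> (forall x, 0 <= h x <= 1) -> 0 <= r ->
  intg (fun y => h y * \1_(eball 0 r) y).
Proof.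
move=> mh h01 r0; have ie := intg_eball (0 : 'rV[R]_d) r0.
apply: (le_intg _ ie).
  by apply: measurable_funM; [exact: mh|exact: (intg_measurable ie)].
move=> y; have /andP[hy0 hy1] := h01 y.
by rewrite ger0_norm ?indicE ?mulr_ge0// ler_piMl.
Qed.

Variables (a : R) (u : 'rV[R]_d -> R).
Hypotheses (d1 : (1 <= d)%N) (a02 : 0 < a < 2) (ad : a < d%:R) (cu : continuous u)
  (u0 : forall x, 0 <= u x) (wu : weighted_L1 a u).

Let a0 : 0 < a. Proof. by case/andP: a02. Qed.
Let a2 : a < 2. Proof. by case/andP: a02. Qed.

Lemma Rint_eball_tkern_le r rho : 0 < r -> 0 < rho ->
  intg2 (fun z : leb_rV R d * leb_rV R d => \1_(eball 0 r) z.1 * tkern a rho z.1 z.2) /\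
  \int[(mu \x mu)%E]_z (\1_(eball 0 r) z.1 * tkern a rho z.1 z.2) <=
    @kern_cst R d a 2 * rho `^ (- a) * (r *+ 2) ^+ d.
Proof.
move=> r0 rho0; have ie := intg_eball (0 : 'rV[R]_d) (ltW r0).
have mI := measurable_fst_fun (intg_measurable ie).
have iF := intg2_mul_tkern a02 rho0 (ltW r0) mI ler01.
have {}iF : intg2 (fun z : leb_rV R d * leb_rV R d =>
    \1_(eball 0 r) z.1 * tkern a rho z.1 z.2).
  by apply: iF => z; rewrite mul1r ger0_norm !indicE//= lerDl.
split; first exact: iF.
have it x := @intg_tkern R d a rho x a0 a2 rho0.
have [i1 <-] := Rintegral_prod iF (fun x => intgZl (\1_(eball 0 r) x) (it x)).
pose C := @kern_cst R d a 2 * rho `^ (- a).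
have C0 : 0 <= C by rewrite mulr_ge0 ?powR_ge0// ltW// kern_cst_gt0.
apply: (@le_trans _ _ (\int[mu]_x (C * \1_(eball 0 r) x))).
  apply: le_Rint; [exact: i1|exact: (intgZl C ie)|move=> x].
  rewrite /= (RintegralZl _ measurableT (it x)) mulrC ler_wpM2r ?indicE//.
  by have /Rintegral_leP := @integral_tkern_le R d a rho x a0 a2 rho0; apply.
rewrite (RintegralZl _ measurableT ie) -/C ler_wpM2l// Rint_eball ?(ltW r0)//.
have le2 := lebesgue_rV_eball_le (0 : 'rV[R]_d) (ltW r0).
by rewrite -lee_fin fineK// ge0_fin_numE//; apply: le_lt_trans le2 _; exact: ltry.
Qed.

Section truncation.
Variables (eps rho P r : R).
Hypotheses (eps0 : 0 < eps) (rho2 : 2 <= rho) (PE : P = 4 * d%:R * rho) (rP : P <= r)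
  (ueps : forall x, 2 <= enorm x <= P -> eps <= u x).

(* u = eps (Y - z1) + p with p = (u - eps)^+ supported where Y = 1; truncating u at
   eps only outside the ball of radius 2 makes the test function (1 - Y) chi^2
   vanish near the unit ball, where nothing is known about u. *)
Let zt x : R := Num.max 0 (1 - u x / eps).
Let z1 x : R := if enorm x < 2 then zt x else 0.
Let Y x : R := if enorm x < 2 then 1 else 1 - zt x.
Let p x : R := Num.max 0 (u x - eps).
Let chi : 'rV[R]_d -> R := paraboloid 0 r.

Definition truncation := Y.
Definition truncation_test x : R := (1 - Y x) * chi x ^+ 2.
Local Notation psi := truncation_test.

Let rho0 : 0 < rho. Proof. by move: rho2; apply: lt_le_trans. Qed.
Let d10 : 1 <= d%:R :> R. Proof. by rewrite ler1n. Qed.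
Let P8 : 8 <= P. Proof. by rewrite PE; have := rho2; have := d10; nra. Qed.
Let r0 : 0 < r. Proof. by apply: lt_le_trans rP; apply: lt_le_trans P8. Qed.

Lemma zt_bounds x : 0 <= zt x <= 1.
Proof.
rewrite /zt le_max lexx/= ge_max ler01/= gerBl divr_ge0//; exact: ltW.
Qed.

Lemma truncation_bounds x : 0 <= Y x <= 1.
Proof. by have := zt_bounds x; rewrite /Y; case: ifP => _; lra. Qed.

Lemma truncation_decomposition x :
  [/\ u x = eps * (Y x - z1 x) + p x, 0 <= p x, (1 - Y x) * p x = 0,
      (1 - Y x) * z1 x = 0 & 0 <= z1 x <= 1].
Proof.
have [ztE pE] : u x = eps * (1 - zt x) + p x /\ zt x * p x = 0.
  rewrite /zt /p; have [ue|ue] := leP (u x) eps.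
    rewrite (@max_l _ _ 0 (u x - eps)) ?subr_le0// mulr0 addr0; split=> //.
    rewrite max_r; first by field; rewrite gt_eqF.
    by rewrite subr_ge0 ler_pdivrMr// mul1r.
  rewrite (@max_r _ _ 0 (u x - eps)) ?subr_ge0 ?(ltW ue)//.
  rewrite max_l ?mul0r; first by split => //; ring.
  by rewrite subr_le0 ler_pdivlMr// mul1r ltW.
have p0 : 0 <= p x by rewrite /p le_max lexx.
have zb := zt_bounds x.
by rewrite /Y /z1; case: ifP => _; split;
  rewrite ?ztE ?subrr ?subr0 ?mul0r ?mulr0 ?subKr ?lexx ?ler01//; lra.
Qed.

Lemma truncation_test_bounds x : 0 <= psi x <= 1.
Proof.
have Yb := truncation_bounds x; rewrite /psi.
have c0 := paraboloid_ge0 0 r x; have c1 := paraboloid_le1 0 r x.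
rewrite mulr_ge0 ?sqr_ge0//=; last by lra.
rewrite mulr_ile1 ?sqr_ge0//; [lra|lra|].
by rewrite expr_le1.
Qed.

Lemma truncation_test_near x : enorm x < P -> psi x = 0.
Proof.
move=> xP; rewrite /psi /Y; case: ltP => [_|x2]; first by rewrite subrr mul0r.
rewrite subKr /zt max_l ?mul0r// subr_le0 ler_pdivlMr// mul1r ueps// x2/=; exact: ltW.
Qed.

Lemma truncation_test_far x : r <= enorm x -> psi x = 0.
Proof. by move=> rx; rewrite /psi /chi paraboloid_eq0 ?subr0// expr0n mulr0. Qed.

Lemma measurable_truncation : measurable_fun [set: leb_rV R d] Y.
Proof.
have me : measurable_fun [set: leb_rV R d] (@enorm R d).
  exact: (measurable_borel_lebesgue (@measurable_enorm R d)).
have mz : measurable_fun [set: leb_rV R d] zt.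
  apply: measurable_maxr; first exact: measurable_cst.
  apply: measurable_funB; first exact: measurable_cst.
  by apply: measurable_funM; [exact: continuous_measurable_leb_rV|exact: measurable_cst].
apply: measurable_fun_ifT.
- by apply: measurable_fun_ltr; [exact: me|exact: measurable_cst].
- exact: measurable_cst.
- by apply: measurable_funB; [exact: measurable_cst|exact: mz].
Qed.

Let mchi : measurable_fun [set: leb_rV R d] chi.
Proof. exact: (measurable_borel_lebesgue (@measurable_paraboloid R d 0 r)). Qed.

Let mchi2 : measurable_fun [set: leb_rV R d] (fun x => chi x ^+ 2).
Proof. exact: measurable_funX mchi. Qed.

Lemma measurable_truncation_test : measurable_fun [set: leb_rV R d] psi.
Proof.
apply: measurable_funM; last exact: mchi2.
by apply: measurable_funB; [exact: measurable_cst|exact: measurable_truncation].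
Qed.

Let chib x : 0 <= chi x <= 1.
Proof. by rewrite /chi paraboloid_ge0 paraboloid_le1. Qed.

Let chi2b x : 0 <= chi x ^+ 2 <= 1.
Proof. by have := chib x; rewrite sqr_ge0 expr2; nra. Qed.

Let chi0 x : r <= enorm x -> chi x = 0.
Proof. by move=> rx; rewrite /chi paraboloid_eq0// subr0. Qed.

Let chiB x : x \notin eball 0 r -> chi x = 0.
Proof. by rewrite notin_setE /eball/= subr0 => /negP; rewrite -leNgt; exact: chi0. Qed.

Let rho1 : 1 <= rho / 2. Proof. by rewrite ler_pdivlMr// mul1r. Qed.

Let g x : R := Y x * chi x.

Let g01 x : 0 <= g x <= 1.
Proof.
have /andP[Y0 Y1] := truncation_bounds x; have /andP[c0 c1] := chib x.
by rewrite /g mulr_ge0// mulr_ile1.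
Qed.

Let gr x : r <= enorm x -> g x = 0.
Proof. by move=> rx; rewrite /g chi0// mulr0. Qed.

Let g_cube x : cube rho x -> 1 / 2 <= g x.
Proof.
move=> xc; have /andP[x1 x2] := cube_enorm d1 rho0 xc.
have xP : enorm x <= P / 2 by rewrite PE; lra.
have chix : 3 / 4 <= chi x.
  have := @paraboloid_ge R d 0 r x (1 / 2) r0; rewrite subr0.
  have -> : 1 - (1 / 2) ^+ 2 = 3 / 4 :> R by field.
  by apply; [lra|have := rP; lra].
have Yx : Y x = 1.
  rewrite /Y; case: ltP => // x22; rewrite /zt max_l ?subr0//.
  by rewrite subr_le0 ler_pdivlMr// mul1r ueps// x22/=; have := P8; lra.
by rewrite /g Yx mul1r; lra.
Qed.

Let diff_bound x y :
  `|Y x * (chi x ^+ 2 - chi y ^+ 2)| <= \1_(eball 0 r) x + \1_(eball 0 r) y.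
Proof.
have /andP[Y0 Y1] := truncation_bounds x.
rewrite normrM (ger0_norm Y0) !indicE.
apply: (@le_trans _ _ `|chi x ^+ 2 - chi y ^+ 2|); first by rewrite ler_piMl.
have /andP[cx0 cx1] := chi2b x; have /andP[cy0 cy1] := chi2b y.
have [_|/chiB xz] := boolP (x \in _).
  apply: (@le_trans _ _ 1); last by rewrite lerDl.
  by rewrite ler_norml; apply/andP; split; lra.
have [_|/chiB yz] := boolP (y \in _).
  by rewrite xz expr0n/= sub0r normrN ger0_norm// add0r.
by rewrite xz yz subrr normr0 addr0.
Qed.

Let product_bound x y : Y x * Y y * (chi x - chi y) ^+ 2 <=
  Y x * \1_(eball 0 r) x * (chi x - chi y) ^+ 2 +
  Y y * \1_(eball 0 r) y * (chi y - chi x) ^+ 2.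
Proof.
have /andP[Yx0 Yx1] := truncation_bounds x; have /andP[Yy0 Yy1] := truncation_bounds y.
rewrite -[(chi y - chi x) ^+ 2]sqrrN opprB -mulrDl.
have [->|cxy] := eqVneq (chi x) (chi y); first by rewrite subrr expr0n/= !mulr0.
rewrite ler_wpM2r ?sqr_ge0// !indicE.
have [_|/chiB xz] := boolP (x \in eball 0 r).
  by rewrite mulr1 (@le_trans _ _ (Y x)) ?ler_piMr// lerDl mulr_ge0.
have [_|/chiB yz] := boolP (y \in eball 0 r); last by rewrite xz yz eqxx in cxy.
by rewrite mulr0 add0r mulr1 ler_piMl.
Qed.

(** The test function vanishes in B(0, P) and z1 outside B(0, 2), so only jumps longer than P - 2 >
    rho contribute; on those the kernels truncated at e and at rho coincide, which makes the bound
    uniform in e. *)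
Let cross_bound e x y : 0 < e -> e < 1 ->
  z1 x * psi y * tkern a e x y <= \1_(eball 0 2) x * tkern a rho x y.
Proof.
move=> e0 e1; have k1 := tkern_ge0 a rho x y.
have [_ _ _ _ /andP[z0 z11]] := truncation_decomposition x.
have /andP[p0 p1] := truncation_test_bounds y.
have rhs0 : 0 <= \1_(eball 0 2) x * tkern a rho x y by rewrite mulr_ge0// indicE.
have [x2|x2] := ltP (enorm x) 2; last by rewrite /z1 ltNge x2/= !mul0r.
have [yP|yP] := ltP (enorm y) P.
  by rewrite truncation_test_near// mulr0 mul0r.
have far : rho < enorm (x - y).
  have := enorm_sub_ge y x; rewrite enormB => h; apply: lt_le_trans h.
  have h2 : 4 * rho <= P by rewrite PE mulrAC ler_peMr// mulr_ge0// ltW.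
  by have := rho2; lra.
have eK : tkern a e x y = tkern a rho x y.
  by rewrite /tkern far (lt_trans _ far)//; have := rho2; lra.
rewrite eK ler_wpM2r// indicE mem_set; last by rewrite /eball/= subr0.
exact: mulr_ile1.
Qed.

Let pointwise_bound e x y : 0 < e -> e < 1 ->
  (psi x - psi y) * (u x - u y) * tkern a e x y <=
  eps * ((Y x - Y y) * (chi x ^+ 2 - chi y ^+ 2) * tkern a e x y -
  (g x - g y) ^+ 2 * tkern a e x y +
  (Y x * \1_(eball 0 r) x * (chi x - chi y) ^+ 2 * tkern a e x y +
   Y y * \1_(eball 0 r) y * (chi y - chi x) ^+ 2 * tkern a e y x) +
  (\1_(eball 0 2) x * tkern a rho x y + \1_(eball 0 2) y * tkern a rho y x)).
Proof.
move=> e0 e1.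
have [ux px0 pYx zYx zbx] := truncation_decomposition x.
have [uy py0 pYy zYy zby] := truncation_decomposition y.
have /andP[Yx0 Yx1] := truncation_bounds x; have /andP[Yy0 Yy1] := truncation_bounds y.
have D := dirichlet_pointwise_le (chi x) (chi y) (ltW eps0) px0 py0 Yx1 Yy1 pYx pYy zYx zYy.
have k0 := tkern_ge0 a e x y.
rewrite -ux -uy in D.
apply: (le_trans (ler_wpM2r k0 D)).
rewrite -[leLHS]mulrA ler_wpM2l ?(ltW eps0)//.
have T1k := ler_wpM2r k0 (product_bound x y).
have T2x := cross_bound x y e0 e1; have T2y := cross_bound y x e0 e1.
rewrite [tkern a e y x]tkernC in T2y *.
rewrite mulrDl in T1k.
rewrite mulrDl [X in X + _ <= _]mulrDl [X in X + _ + _ <= _]mulrBl.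
apply: lerD; first by apply: lerD; [|exact: T1k].
by rewrite mulrDl; exact: (lerD T2x T2y).
Qed.

(** The capacity enters with a negative sign, and that is what will force the mass of Y to be large.
    The constant is 12 = 2 * 2 + 2 * 4: the product of the differences of Y and chi^2 is moved by
    duality onto the operator of chi^2, bounded by 2 [kern_cst] r^(-a), and the cutoff energy is
    counted twice by symmetry. *)
Lemma truncation_energy e : 0 < e -> e < 1 ->
  \int[mu]_x (psi x * trunc_fraclap a e u x) <= eps / 2 *
    (12 * (@kern_cst R d a 2 * r `^ (- a)) * mass Y r
     - @capacity_cst R d a * rho `^ (d%:R - a)
     + 2 * (@kern_cst R d a 2 * rho `^ (- a) * (2 *+ 2) ^+ d)).
Proof.
move=> e0 e1; pose cst := @kern_cst R d a 2.
have er2 : e <= rho / 2 by apply: le_trans rho1; exact: ltW.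
have mY := measurable_truncation; have mpsi := measurable_truncation_test.
have Yb := truncation_bounds; have pb := truncation_test_bounds.
have cst0 : 0 <= cst * r `^ (- a) by rewrite mulr_ge0 ?powR_ge0// ltW// kern_cst_gt0.
have mF1 : measurable_fun [set: leb_rV R d * leb_rV R d]
    (fun z => Y z.1 * (chi z.1 ^+ 2 - chi z.2 ^+ 2)).
  apply: measurable_funM; first exact: measurable_fst_fun.
  by apply: measurable_funB; [exact: (measurable_fst_fun mchi2)|exact: (measurable_snd_fun mchi2)].
have iF1 : intg2 (fun z : leb_rV R d * leb_rV R d =>
    Y z.1 * (chi z.1 ^+ 2 - chi z.2 ^+ 2) * tkern a e z.1 z.2).
  apply: (intg2_mul_tkern a02 e0 (ltW r0) mF1 ler01) => -[x y] /=; rewrite mul1r.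
  exact: diff_bound.
have ik1 x := intg_diff_tkern a02 x e0 mchi2 chi2b.
have [iG1 EG1] := @dirichlet _ _ _ mu (tkern a e) (@tkernC R d a e) Y
  (fun x => chi x ^+ 2) iF1 ik1.
have iYl := dirichlet_intg iF1 ik1.
have iYm : intg (fun y => Y y * \1_(eball 0 r) y).
  exact: (intg_mul_indic_bounded mY Yb (ltW r0)).
have G1 : \int[mu]_x (Y x * trunc_fraclap a e (fun x => chi x ^+ 2) x) <=
    2 * (cst * r `^ (- a)) * mass Y r.
  rewrite /mass -(RintegralZl _ measurableT iYm).
  apply: le_Rint; [exact: iYl|exact: (intgZl _ iYm)|move=> x].
  have /andP[Y0 _] := Yb x; rewrite mulrCA ler_wpM2l//.
  have [rx|rx] := leP r (enorm x).
    apply: (@le_trans _ _ 0); last by apply: mulr_ge0; [rewrite mulr_ge0|rewrite indicE].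
    by apply: (trunc_fraclap_le0 a02 e0 mchi2 chi2b); rewrite chi0// expr0n.
  rewrite indicE mem_set ?mulr1; last by rewrite /eball/= subr0.
  have mb : measurable_fun [set: @borel_rV R d] (fun x => chi x ^+ 2).
    by apply: measurable_funX; exact: measurable_paraboloid.
  have := @trunc_fraclap_le R d a e r 4 (fun x => chi x ^+ 2) x a02 e0 r0 mb chi2b.
  have -> : (4 : R) / 2 = 2 by rewrite (_ : (4 : R) = 2 * 2) ?mulfK//; ring.
  by rewrite -mulrA; apply => // y; exact: paraboloid2_second_difference.
have mg : measurable_fun [set: leb_rV R d] g.
  by apply: measurable_funM; [exact: mY|exact: mchi].
have iG2 := intg2_energy a02 e0 (ltW r0) mg g01 gr.
have G2 := capacity_lower_bound d1 a02 ad e0 (ltW r0) rho0 er2 mg g01 gr g_cube.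
have [iQ Q] := paraboloid_energy_le a02 e0 r0 mY Yb.
have [iG3 G3] := Rint_symm_le iQ Q.
have r20 : 0 < (2 : R) by [].
have [iS S] := Rint_eball_tkern_le r20 rho0.
have [iG4 G4] := Rint_symm_le iS S.
have iG12 := intgB iG1 iG2.
have iG123 := intgD iG12 iG3.
have iG1234 := intgD iG123 iG4.
pose GG (z : leb_rV R d * leb_rV R d) : R :=
  (Y z.1 - Y z.2) * (chi z.1 ^+ 2 - chi z.2 ^+ 2) * tkern a e z.1 z.2 -
  (g z.1 - g z.2) ^+ 2 * tkern a e z.1 z.2 +
  (Y z.1 * \1_(eball 0 r) z.1 * (chi z.1 - chi z.2) ^+ 2 * tkern a e z.1 z.2 +
   Y z.2 * \1_(eball 0 r) z.2 * (chi z.2 - chi z.1) ^+ 2 * tkern a e z.2 z.1) +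
  (\1_(eball 0 2) z.1 * tkern a rho z.1 z.2 +
   \1_(eball 0 2) z.2 * tkern a rho z.2 z.1).
have iGG : intg2 GG := iG1234.
have GGle : \int[(mu \x mu)%E]_z GG z <=
    2 * (2 * (cst * r `^ (- a)) * mass Y r)
     - @capacity_cst R d a * rho `^ (d%:R - a)
     + 2 * (4 * (cst * r `^ (- a)) * mass Y r)
     + 2 * (cst * rho `^ (- a) * (2 *+ 2) ^+ d).
  rewrite (RintegralD measurableT iG123 iG4) (RintegralD measurableT iG12 iG3).
  rewrite (RintegralB measurableT iG1 iG2).
  apply: lerD; last exact: G4.
  apply: lerD; last exact: G3.
  apply: lerB; last exact: G2.
  by rewrite EG1 ler_pM2l//; exact: G1.
have [iL EL] := dirichlet_cutoff a02 cu u0 wu mpsi pb truncation_test_far (ltW r0) e0.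
have key : 2 * \int[mu]_x (psi x * trunc_fraclap a e u x) <= eps * \int[(mu \x mu)%E]_z GG z.
  rewrite -EL -(RintegralZl _ measurableT iGG).
  apply: (le_Rint iL (intgZl eps iGG)) => -[x y].
  exact: pointwise_bound.
rewrite -(@ler_pM2l _ 2)//; apply: (le_trans key).
apply: (le_trans (ler_wpM2l (ltW eps0) GGle)).
have fin : forall A B C D : R, eps * (2 * (2 * A * B) - C + 2 * (4 * A * B) + 2 * D) =
    2 * (eps / 2 * (12 * A * B - C + 2 * D)).
  by move=> A B C D; field.
by rewrite fin.
Qed.

End truncation.

Hypotheses (hu : holder_plus exterior a u)
  (su : forall x, exterior x -> 0 < fraclap a u x)
  (up : forall x, exterior x -> 0 < u x).

Lemma annulus_lower_bound (P : R) : exists2 eps, 0 < eps &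
  forall x, 2 <= enorm x <= P -> eps <= u x.
Proof.
have [[x0 x0P]|nx] := pselect (exists x : 'rV[R]_d, 2 <= enorm x <= P); last first.
  by exists 1 => // x xP; exfalso; apply: nx; exists x.
have [||c cA Hc] := @EVT_min_rV R d u [set x | 2 <= enorm x <= P] _ (@compact_annulus R d 2 P).
- by exists x0.
- exact: continuous_subspaceT.
exists (u c); last by move=> x xP; apply: Hc; rewrite inE.
apply: up; apply/exterior_gt1; move: cA; rewrite inE/= => /andP[c2 _]; lra.
Qed.

Definition source_gap rho : R :=
  @capacity_cst R d a * rho `^ (d%:R - a) -
  2 * (@kern_cst R d a 2 * rho `^ (- a) * (2 *+ 2) ^+ d).

(* The capacity of a ball of radius rho beats the jumps into the ball of radius 2. *)
Lemma source_gap_gt0 : exists2 rho, 2 <= rho & 0 < source_gap rho.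
Proof.
have cap0 := capacity_cst_gt0 d1 ad.
pose K := 2 * (@kern_cst R d a 2 * (2 *+ 2) ^+ d).
pose rho := `|K| / @capacity_cst R d a + 2.
have K0 : 0 <= `|K| / @capacity_cst R d a by rewrite divr_ge0// ltW.
have rho2 : 2 <= rho by rewrite /rho lerDr.
have rho0 : 0 < rho by apply: lt_le_trans rho2.
exists rho => //; rewrite /source_gap powRD; last by rewrite (gt_eqF rho0) implybT.
have -> : @capacity_cst R d a * (rho `^ d%:R * rho `^ (- a)) -
   2 * (@kern_cst R d a 2 * rho `^ (- a) * (2 *+ 2) ^+ d) =
   (@capacity_cst R d a * rho `^ d%:R - K) * rho `^ (- a) by rewrite /K; ring.
rewrite mulr_gt0 ?powR_gt0// subr_gt0 (le_lt_trans (ler_norm K))//.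
rewrite mulrC -ltr_pdivrMr// powR_mulrn ?(ltW rho0)//.
apply: (@lt_le_trans _ _ rho); first by rewrite /rho ltrDl.
by rewrite -[leLHS]expr1 ler_weXn2l//; apply: le_trans rho2; rewrite ler1n.
Qed.

(** The integral of the test function against a nonnegative operator cannot be negative, so the
    energy bound forces the mass of Y to be at least of order r^a. Outside the ball of radius 2 one
    has Y = min(1, u / eps), which passes the bound on to u. *)
Lemma mass_lower_bound : exists2 c, 0 < c & exists r0, forall r, r0 <= r ->
  c * r `^ a <= mass u r.
Proof.
have [rho rho2 gap0] := source_gap_gt0.
pose P := 4 * d%:R * rho.
have [eps eps0 ueps] := annulus_lower_bound P.
pose cst := @kern_cst R d a 2.
have cst0 : 0 < cst by exact: kern_cst_gt0.
pose k := source_gap rho / (12 * cst).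
have k0 : 0 < k by rewrite divr_gt0// mulr_gt0.
have d10 : 1 <= d%:R :> R by rewrite ler1n.
have P8 : 8 <= P by rewrite /P; nra.
have main r : P <= r -> k * r `^ a <= mass (truncation eps) r.
  move=> rP; have r0 : 0 < r by apply: lt_le_trans rP; apply: lt_le_trans P8.
  have pb := truncation_test_bounds r eps0.
  have mpsi := measurable_truncation_test eps r.
  have near := truncation_test_near r eps0 ueps.
  have far := truncation_test_far eps rho2 erefl rP.
  have z0 : forall x : 'rV[R]_d, exterior x -> 0 <= fraclap a u x.
    by move=> x /su/ltW.
  pose B : R := eps / 2 * (12 * (cst * r `^ (- a)) * mass (truncation eps) r -
    @capacity_cst R d a * rho `^ (d%:R - a) +
    2 * (cst * rho `^ (- a) * (2 *+ 2) ^+ d)).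
  have HB : exists2 e1, 0 < e1 & forall e, 0 < e -> e < e1 ->
      \int[mu]_x (truncation_test eps r x * trunc_fraclap a e u x) <= B.
    by exists 1 => // e e0 e1; exact: truncation_energy.
  have P1 : 1 < P by apply: lt_le_trans P8; rewrite ltr1n.
  have m0 : measurable_fun [set: leb_rV R d] (fun _ : 'rV[R]_d => 0 : R).
    exact: measurable_cst.
  (* Fatou's lemma with source f = 0: the energy bound itself is nonnegative. *)
  have := fatou_cutoff a02 cu u0 wu mpsi pb far (ltW r0) hu su P1 near m0 (fun=> lexx 0) z0 HB.
  have -> : (\int[mu]_x (truncation_test eps r x * 0)%:E)%E = 0%E.
    by under eq_integral do rewrite mulr0; rewrite integral0.
  have c0 := @fraclap_const_gt0 R d a a02.
  have e2 : 0 < eps / 2 by rewrite divr_gt0.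
  rewrite lee_fin pmulr_rge0// /B pmulr_rge0// => H.
  have {}H : source_gap rho <= 12 * cst * (r `^ (- a) * mass (truncation eps) r).
    by move: H; rewrite /source_gap -/cst; lra.
  rewrite /k mulrAC ler_pdivrMr ?mulr_gt0// -ler_pdivlMr ?powR_gt0//.
  by apply: (le_trans H); rewrite powRN mulrC -mulrA [_^-1 * _]mulrC mulrA mulrAC.
pose m := (2 *+ 2) ^+ d : R.
have m0 : 0 < m by rewrite exprn_gt0.
have massY r : P <= r -> mass (truncation eps) r <= mass u r / eps + m.
  move=> rP; have r0 : 0 <= r by apply: le_trans rP; apply: le_trans P8.
  have Yb := truncation_bounds eps0.
  have iY := intg_mul_indic_bounded (measurable_truncation eps) Yb r0.
  have iu := intg_mass cu u0 0 r0.
  have ie := intg_eball (0 : 'rV[R]_d) (ler0n R 2).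
  have iue := intgZl eps^-1 iu.
  have pw : \int[mu]_y (truncation eps y * \1_(eball 0 r) y) <=
     \int[mu]_y (eps^-1 * (u y * \1_(eball 0 r) y) + \1_(eball 0 2) y).
    apply: (le_Rint iY (intgD iue ie)) => y.
    have i1 : 0 <= \1_(eball 0 r) y :> R by rewrite indicE.
    have i2 : \1_(eball 0 r) y <= 1 :> R by rewrite indicE; case: (_ \in _).
    have ue : 0 <= eps^-1 * u y by rewrite mulr_ge0// invr_ge0 ltW.
    rewrite /truncation; case: ltP => [y2|y2].
      have -> : \1_(eball 0 2) y = 1 :> R by rewrite indicE mem_set// /eball/= subr0.
      by rewrite mul1r mulrA (le_trans i2)// lerDr mulr_ge0.
    rewrite mulrA; apply: (@le_trans _ _ (eps^-1 * u y * \1_(eball 0 r) y)).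
      rewrite ler_wpM2r// lerBlDr -lerBlDl [_^-1 * _]mulrC.
      by rewrite le_max lexx orbT.
    by rewrite lerDl indicE.
  apply: (le_trans pw).
  rewrite (RintegralD measurableT iue ie) (RintegralZl _ measurableT iu) mulrC lerD2l.
  rewrite Rint_eball//.
  have le2 := lebesgue_rV_eball_le (0 : 'rV[R]_d) (ler0n R 2).
  by rewrite -lee_fin fineK// ge0_fin_numE//; apply: le_lt_trans le2 _; exact: ltry.
exists (eps * k / 2); first by rewrite !divr_gt0// mulr_gt0.
(* Beyond the second radius k r^a >= 2m, so the ball of radius 2 accounts for at most half of the
   lower bound. *)
exists (Num.max P ((2 * m / k) `^ a^-1)) => r; rewrite ge_max => /andP[rP rm].
have r0 : 0 <= r by apply: le_trans rP; apply: le_trans P8.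
have mk0 : 0 <= 2 * m / k by rewrite divr_ge0 ?(ltW k0)// mulr_ge0// ltW.
have ram : 2 * m / k <= r `^ a.
  have := ge0_ler_powR (ltW a0) _ _ rm; rewrite !nnegrE powR_ge0 r0 => /(_ isT isT).
  by rewrite -powRrM mulVf ?gt_eqF// powRr1.
have := le_trans (main r rP) (massY r rP).
rewrite -lerBlDr ler_pdivlMr// => /(le_trans _); apply.
move: ram; rewrite ler_pdivrMr// => ram.
have : eps * (2 * m) <= eps * (r `^ a * k) by rewrite ler_wpM2l// ltW.
lra.
Qed.

End mass_lower_bound.

(** * Supersolutions do not blow up at infinity *)

Section not_blow_up.
Context {R : realType} {d : nat}.
Implicit Types (x y : 'rV[R]_d) (e rho r : R).
Local Notation mu := (lebesgue_rV R d).

(** For |x| < 2 the paraboloid of radius 4 is at least 3/4, so its double saturates the minimum; for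
    |x| >= 4 it vanishes. The energy of this cutoff is that of the paraboloid up to a factor 4. *)
Definition annular_cutoff x : R := 1 - Num.min 1 (2 * paraboloid 0 4 x).
Local Notation kappa := annular_cutoff.

Lemma annular_cutoff_bounds x : 0 <= kappa x <= 1.
Proof.
have p0 := paraboloid_ge0 0 4 x; rewrite /kappa subr_ge0 ge_min lexx/=.
by rewrite gerBl le_min ler01/= mulr_ge0.
Qed.

Lemma annular_cutoff_near x : enorm x < 2 -> kappa x = 0.
Proof.
move=> x2; rewrite /kappa min_l ?subrr//.
have := @paraboloid_ge R d 0 4 x (1 / 2) (ltr0n R 4); rewrite subr0.
have -> : 1 - (1 / 2) ^+ 2 = 3 / 4 :> R by field.
by move=> h; have := h (divr_ge0 ler01 (ler0n R 2)) ltac:(lra); lra.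
Qed.

Lemma annular_cutoff_far x : 4 <= enorm x -> kappa x = 1.
Proof.
move=> x4; rewrite /kappa paraboloid_eq0 ?subr0// mulr0.
by rewrite min_r ?subr0// ler01.
Qed.

Lemma annular_cutoff_lipschitz x y :
  (kappa x - kappa y) ^+ 2 <= 4 * (paraboloid 0 4 x - paraboloid 0 4 y) ^+ 2.
Proof.
rewrite /kappa; move: (paraboloid 0 4 x) (paraboloid 0 4 y) => s t.
have -> : 1 - Num.min 1 (2 * s) - (1 - Num.min 1 (2 * t)) =
  Num.min 1 (2 * t) - Num.min 1 (2 * s) by ring.
have -> : 4 * (s - t) ^+ 2 = (2 * t - 2 * s) ^+ 2 by ring.
move: (2 * t) (2 * s) => {}t {}s.
have [h|h] := leP 1 t; have [k|k] := leP 1 s => //.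
- by rewrite subrr expr0n/= sqr_ge0.
- by rewrite lerXn2r ?nnegrE; lra.
- by rewrite -sqrrN opprB -[leRHS]sqrrN opprB lerXn2r ?nnegrE; lra.
Qed.

Lemma measurable_annular_cutoff : measurable_fun [set: leb_rV R d] kappa.
Proof.
apply: measurable_funB; first exact: measurable_cst.
apply: measurable_minr; first exact: measurable_cst.
apply: measurable_funM; first exact: measurable_cst.
exact: (measurable_borel_lebesgue (@measurable_paraboloid R d 0 4)).
Qed.

(** To be read with z = (1 - u / T)^+ and p = (u - T)^+. Since zx px = zy py = 0, the two sides
    differ exactly by the nonnegative terms zx py cx^2 + zy px cy^2. *)
Lemma sublevel_pointwise_le (T zx zy px py cx cy : R) : 0 <= T ->
  0 <= zx -> 0 <= zy -> 0 <= px -> 0 <= py -> zx * px = 0 -> zy * py = 0 ->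
  (zx * cx ^+ 2 - zy * cy ^+ 2) *
    (T * (1 - zx) + px - (T * (1 - zy) + py)) <=
  T * (zx * zy * (cx - cy) ^+ 2 - (zx * cx - zy * cy) ^+ 2).
Proof.
move=> T0 zx0 zy0 px0 py0 xp yp; rewrite -subr_ge0.
have -> : T * (zx * zy * (cx - cy) ^+ 2 - (zx * cx - zy * cy) ^+ 2) -
   (zx * cx ^+ 2 - zy * cy ^+ 2) * (T * (1 - zx) + px - (T * (1 - zy) + py)) =
  (zx * py * cx ^+ 2 + zy * px * cy ^+ 2) -
  (zx * px) * cx ^+ 2 - (zy * py) * cy ^+ 2 by ring.
rewrite xp yp !mul0r !subr0.
by rewrite addr_ge0// (mulr_ge0 _ (sqr_ge0 _))// mulr_ge0.
Qed.

Variables (a : R) (u : 'rV[R]_d -> R).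
Hypotheses (d1 : (1 <= d)%N) (a02 : 0 < a < 2) (ad : a < d%:R) (cu : continuous u)
  (u0 : forall x, 0 <= u x) (wu : weighted_L1 a u).

(** 8 = 4 * 2, from the Lipschitz bound on [annular_cutoff] and from the symmetrization. It depends
    on d and a only, whereas the capacity it competes with grows with rho. *)
Definition annulus_energy_cst : R :=
  8 * (4 * (@kern_cst R d a 2 * 4 `^ (- a)) * mass (fun _ : 'rV[R]_d => 1) 4).

Section sublevel.
Variables (T rho r : R).
Hypotheses (T0 : 0 < T) (rho8 : 8 <= rho) (r0 : 0 < r)
  (uT : forall x, enorm x <= 2 * d%:R * rho -> u x <= T / 2)
  (ur : forall x, r <= enorm x -> T <= u x).

Let z x : R := Num.max 0 (1 - u x / T).
Let p x : R := Num.max 0 (u x - T).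
Definition sublevel_test x : R := z x * kappa x ^+ 2.
Local Notation psi := sublevel_test.
Let g x : R := z x * kappa x.

Let zb x : 0 <= z x <= 1.
Proof.
rewrite /z le_max lexx/= ge_max ler01/= gerBl divr_ge0//; exact: ltW.
Qed.

Let decomposition x : [/\ u x = T * (1 - z x) + p x, 0 <= p x & z x * p x = 0].
Proof.
rewrite /z /p; have [ue|ue] := leP (u x) T.
  rewrite (@max_l _ _ 0 (u x - T)) ?subr_le0// mulr0 addr0; split=> //.
  rewrite max_r; first by field; rewrite gt_eqF.
  by rewrite subr_ge0 ler_pdivrMr// mul1r.
rewrite (@max_r _ _ 0 (u x - T)) ?subr_ge0 ?(ltW ue)//.
rewrite max_l ?mul0r; first by split => //; ring.
by rewrite subr_le0 ler_pdivlMr// mul1r ltW.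
Qed.

Let z_far x : r <= enorm x -> z x = 0.
Proof. by move=> /ur uTx; rewrite /z max_l// subr_le0 ler_pdivlMr// mul1r. Qed.

Lemma sublevel_test_bounds x : 0 <= psi x <= 1.
Proof.
have /andP[z0 z1] := zb x; have /andP[c0 c1] := annular_cutoff_bounds x.
by rewrite /psi mulr_ge0 ?sqr_ge0//= mulr_ile1 ?sqr_ge0// expr_le1.
Qed.

Lemma sublevel_test_near x : enorm x < 2 -> psi x = 0.
Proof. by move=> x2; rewrite /psi annular_cutoff_near// expr0n mulr0. Qed.

Lemma sublevel_test_far x : r <= enorm x -> psi x = 0.
Proof. by move=> xr; rewrite /psi z_far// mul0r. Qed.

Let mz : measurable_fun [set: leb_rV R d] z.
Proof.
apply: measurable_maxr; first exact: measurable_cst.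
apply: measurable_funB; first exact: measurable_cst.
by apply: measurable_funM; [exact: continuous_measurable_leb_rV|exact: measurable_cst].
Qed.

Let mk := measurable_annular_cutoff.

Lemma measurable_sublevel_test : measurable_fun [set: leb_rV R d] psi.
Proof. by apply: measurable_funM; [exact: mz|exact: (measurable_funX 2 mk)]. Qed.

Let gb x : 0 <= g x <= 1.
Proof.
have /andP[z0 z1] := zb x; have /andP[c0 c1] := annular_cutoff_bounds x.
by rewrite /g mulr_ge0// mulr_ile1.
Qed.

Let gr x : r <= enorm x -> g x = 0.
Proof. by move=> xr; rewrite /g z_far// mul0r. Qed.

Let rho0 : 0 < rho. Proof. by apply: lt_le_trans rho8. Qed.

Let g_cube x : cube rho x -> 1 / 2 <= g x.
Proof.
move=> xc; have /andP[x1 x2] := cube_enorm d1 rho0 xc.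
rewrite /g annular_cutoff_far ?mulr1; last by have := rho8; lra.
rewrite /z le_max; apply/orP; right.
have : u x / T <= 1 / 2 by rewrite ler_pdivrMr// mulrC mulrA mulr1; exact: uT.
lra.
Qed.

Let product_bound x y : z x * z y * (kappa x - kappa y) ^+ 2 <=
  4 * (1 * \1_(eball 0 4) x * (paraboloid 0 4 x - paraboloid 0 4 y) ^+ 2 +
       1 * \1_(eball 0 4) y * (paraboloid 0 4 y - paraboloid 0 4 x) ^+ 2).
Proof.
have /andP[zx0 zx1] := zb x; have /andP[zy0 zy1] := zb y.
have far s : s \notin eball (0 : 'rV[R]_d) 4 -> kappa s = 1.
  by rewrite notin_setE /eball/= subr0 => /negP; rewrite -leNgt; exact: annular_cutoff_far.
apply: (@le_trans _ _ ((kappa x - kappa y) ^+ 2)).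
  by rewrite ler_piMl ?sqr_ge0// mulr_ile1.
rewrite -[(paraboloid 0 4 y - _) ^+ 2]sqrrN [- (paraboloid 0 4 y - _)]opprB -mulrDl !mul1r.
have [xy|xy] := eqVneq (kappa x) (kappa y).
  by rewrite xy subrr expr0n/= mulr_ge0// (mulr_ge0 _ (sqr_ge0 _))// !indicE.
apply: (le_trans (annular_cutoff_lipschitz x y)).
rewrite ler_wpM2l// ler_peMl ?sqr_ge0// !indicE.
have [_|/far xz] := boolP (x \in eball 0 4); first by rewrite lerDl.
have [_|/far yz] := boolP (y \in eball 0 4); first by rewrite lerDr.
by rewrite xz yz eqxx in xy.
Qed.

Let pointwise_bound e x y :
  (psi x - psi y) * (u x - u y) * tkern a e x y <=
  T * (4 * (1 * \1_(eball 0 4) x * (paraboloid 0 4 x - paraboloid 0 4 y) ^+ 2 *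
        tkern a e x y +
       1 * \1_(eball 0 4) y * (paraboloid 0 4 y - paraboloid 0 4 x) ^+ 2 *
        tkern a e y x) -
  (g x - g y) ^+ 2 * tkern a e x y).
Proof.
have [ux px0 zpx] := decomposition x; have [uy py0 zpy] := decomposition y.
have /andP[zx0 _] := zb x; have /andP[zy0 _] := zb y.
have D := sublevel_pointwise_le (kappa x) (kappa y) (ltW T0) zx0 zy0 px0 py0 zpx zpy.
have k0 := tkern_ge0 a e x y.
rewrite -ux -uy in D.
apply: (le_trans (ler_wpM2r k0 D)).
rewrite -[leLHS]mulrA ler_wpM2l ?(ltW T0)// mulrBl lerD2r.
rewrite [tkern a e y x]tkernC -mulrDl mulrA.
exact: (ler_wpM2r k0 (product_bound x y)).
Qed.

(** The radius r beyond which u >= T makes the test function compactly supported without entering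
    the bound. The level T comes out as a factor, so only the sign of the difference between the two
    energies matters. *)
Lemma sublevel_energy e : 0 < e -> e < 1 ->
  \int[mu]_x (psi x * trunc_fraclap a e u x) <=
    T / 2 * (annulus_energy_cst - @capacity_cst R d a * rho `^ (d%:R - a)).
Proof.
move=> e0 e1.
have er2 : e <= rho / 2 by have := rho8; lra.
have r40 : 0 < (4 : R) by [].
have m1 : measurable_fun [set: leb_rV R d] (fun _ : 'rV[R]_d => 1 : R).
  exact: measurable_cst.
have b1 : forall x : 'rV[R]_d, 0 <= (1 : R) <= 1 by move=> _; rewrite ler01 lexx.
have mg : measurable_fun [set: leb_rV R d] g.
  by apply: measurable_funM; [exact: mz|exact: mk].
have iG2 := intg2_energy a02 e0 (ltW r0) mg gb gr.
have G2 := capacity_lower_bound d1 a02 ad e0 (ltW r0) rho0 er2 mg gb gr g_cube.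
have [iQ Q] := paraboloid_energy_le a02 e0 r40 m1 b1.
have [iS S] := Rint_symm_le iQ Q.
have iS4 := intgZl 4 iS.
have iGG := intgB iS4 iG2.
have [iL EL] := dirichlet_cutoff a02 cu u0 wu measurable_sublevel_test
  sublevel_test_bounds sublevel_test_far (ltW r0) e0.
rewrite -(@ler_pM2l _ 2)// -EL.
apply: (le_trans (le_Rint iL (intgZl T iGG) (fun zz => pointwise_bound e zz.1 zz.2))).
rewrite (RintegralZl _ measurableT iGG) (RintegralB measurableT iS4 iG2).
rewrite (RintegralZl _ measurableT iS).
have -> : 2 * (T / 2 * (annulus_energy_cst - @capacity_cst R d a * rho `^ (d%:R - a))) =
  T * (annulus_energy_cst - @capacity_cst R d a * rho `^ (d%:R - a)) by field.
rewrite ler_wpM2l ?(ltW T0)//; apply: lerB; last exact: G2.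
rewrite /annulus_energy_cst (_ : 8 = 4 * 2 :> R); last by rewrite -natrM.
by rewrite -[leRHS]mulrA ler_wpM2l.
Qed.

End sublevel.

Hypotheses (hu : holder_plus exterior a u)
  (su : forall x, exterior x -> 0 < fraclap a u x).

(* The level sets {u < T} would contain arbitrarily large balls, of unbounded
   capacity, while testing with them bounds that capacity independently of T. *)
Lemma not_blow_up :
  ~ (forall T, exists r, forall x, r <= enorm x -> T <= u x).
Proof.
move=> blow.
have cap0 := capacity_cst_gt0 d1 ad.
have da : 0 < d%:R - a by rewrite subr_gt0.
pose K := `|annulus_energy_cst| / @capacity_cst R d a + 1.
have K0 : 0 < K by rewrite ltr_wpDl// divr_ge0// ltW.
pose rho := Num.max 8 (K `^ (d%:R - a)^-1).
have rho8 : 8 <= rho by rewrite le_max lexx.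
have gap : annulus_energy_cst < @capacity_cst R d a * rho `^ (d%:R - a).
  apply: (le_lt_trans (ler_norm _)); rewrite mulrC -ltr_pdivrMr//.
  apply: (@lt_le_trans _ _ K); first by rewrite /K ltrDl.
  have -> : K = (K `^ (d%:R - a)^-1) `^ (d%:R - a).
    by rewrite -powRrM mulVf ?gt_eqF// powRr1// ltW.
  apply: (ge0_ler_powR (ltW da)); rewrite ?nnegrE ?powR_ge0//.
    by apply: le_trans rho8.
  by rewrite le_max lexx orbT.
have [S S0 uS] := bounded_on_eball cu (2 * d%:R * rho).
(* A level twice the bound on u in a ball containing the cube of scale rho makes 1 - u / T at least
   1/2 on that cube, as the capacity bound demands. *)
pose T := 2 * S.
have T0 : 0 < T by rewrite mulr_gt0.
have [r' ur'] := blow T.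
pose r := Num.max 1 r'.
have r0 : 0 < r by rewrite lt_max ltr01.
have ur x : r <= enorm x -> T <= u x by rewrite ge_max => /andP[_]; exact: ur'.
have uT x : enorm x <= 2 * d%:R * rho -> u x <= T / 2.
  by move=> /uS; rewrite /T mulrC mulrA mulVf ?mul1r.
have pb := sublevel_test_bounds T0.
have far := sublevel_test_far T0 ur.
have mpsi := measurable_sublevel_test T.
have near := @sublevel_test_near T.
have z0 : forall x : 'rV[R]_d, exterior x -> 0 <= fraclap a u x.
  by move=> x /su/ltW.
have m0 : measurable_fun [set: leb_rV R d] (fun _ : 'rV[R]_d => 0 : R).
  exact: measurable_cst.
have HB : exists2 e1, 0 < e1 & forall e, 0 < e -> e < e1 ->
    \int[mu]_x (sublevel_test T x * trunc_fraclap a e u x) <=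
    T / 2 * (annulus_energy_cst - @capacity_cst R d a * rho `^ (d%:R - a)).
  by exists 1 => // e e0 e1; exact: sublevel_energy T0 rho8 r0 uT ur _ _ _.
have l12 : 1 < (2 : R) by rewrite ltr1n.
have := fatou_cutoff a02 cu u0 wu mpsi pb far (ltW r0) hu su l12 near m0
  (fun=> lexx 0) z0 HB.
have -> : (\int[mu]_x (sublevel_test T x * 0)%:E)%E = 0%E.
  by under eq_integral do rewrite mulr0; rewrite integral0.
have c0 := @fraclap_const_gt0 R d a a02.
have e2 : 0 < T / 2 by rewrite divr_gt0.
by rewrite lee_fin pmulr_rge0// pmulr_rge0// subr_ge0 leNgt gap.
Qed.

End not_blow_up.

(** * Growth of the densities and the Liouville theorem *)

Lemma ge0_integral_sub_le d (T : measurableType d) (R : realType)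
    (mu : {measure set T -> \bar R}) (D : set T) (f g : T -> R) (c M : R) :
  measurable D -> measurable_fun setT f -> measurable_fun setT g ->
  0 <= c -> (forall x, 0 <= f x) -> (forall x, 0 <= g x) ->
  (forall x, D x -> c * f x <= g x) ->
  (\int[mu]_x (g x)%:E <= M%:E)%E ->
  (c%:E * \int[mu]_(x in D) (f x)%:E <= M%:E)%E.
Proof.
move=> mD mf mg c0 f0 g0 fg gM.
have mfD : measurable_fun D (EFin \o f).
  by apply/measurable_EFinP; exact: measurable_funTS.
have mgD : measurable_fun D (EFin \o g).
  by apply/measurable_EFinP; exact: measurable_funTS.
rewrite -ge0_integralZl//; last by move=> x _; rewrite lee_fin.
apply: le_trans gM.
apply: (@le_trans _ _ (\int[mu]_(x in D) (g x)%:E)%E).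
  apply: ge0_le_integral => //.
  - by move=> x _; rewrite -EFinM lee_fin mulr_ge0.
  - exact: measurable_funeM.
apply: ge0_subset_integral => //; first exact/measurable_EFinP.
by move=> x _; rewrite lee_fin.
Qed.

Section density.
Context {R : realType} {d : nat}.
Implicit Types (x y : 'rV[R]_d) (r : R).
Local Notation mu := (lebesgue_rV R d).

Definition density (u : 'rV[R]_d -> R) r : R := mass u (4 * r) / r ^+ d.

Lemma exists_enorm r : (1 <= d)%N -> 0 <= r -> exists x, enorm x = r.
Proof.
move=> d1 r0; pose z : 'rV[R]_d := const_mx 1.
have z0 : 0 < enorm z.
  apply: enorm_gt0; apply/eqP => /rowP /(_ (Ordinal d1)) /eqP.
  by rewrite !mxE oner_eq0.
exists ((r / enorm z) *: z); rewrite enormZ ger0_norm; last by rewrite divr_ge0// ltW.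
by rewrite divfK// gt_eqF.
Qed.

Lemma source_cst_gt0 (a : R) : 0 < a < 2 -> 0 < @source_cst R d a.
Proof.
move=> a02; rewrite /source_cst mulr_gt0 ?fraclap_const_gt0//.
by have /andP[a0 a2] := a02; rewrite mulr_gt0 ?kern_cst_gt0 ?powR_gt0.
Qed.

Lemma Phi_ge0 (W : 'rV[R]_d -> R) r : (forall x, 0 <= W x) -> (0 <= Phi W r)%E.
Proof.
move=> W0; apply: le_ereal_inf_tmp => _ [x _ <-].
by apply: integral_ge0 => y _; rewrite lee_fin.
Qed.

Lemma density_gt0 (u : 'rV[R]_d -> R) r : (1 <= d)%N -> continuous u ->
  (forall x, 0 <= u x) -> (forall x, exterior x -> 0 < u x) ->
  1 <= r -> 0 < density u r.
Proof.
move=> d1 cu u0 up r1; have r0 : 0 < r by apply: lt_le_trans r1.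
have [x xr] := exists_enorm d1 (mulr_ge0 (ler0n R 2) (ltW r0)).
rewrite /density divr_gt0 ?exprn_gt0//; apply: (mass_gt0 cu u0 (x := x)).
  by rewrite xr ltr_pM2r// ltr_nat.
by apply: up; apply/exterior_gt1; rewrite xr; lra.
Qed.

Section positive_supersolution.
Variables (a b p q : R) (u v W : 'rV[R]_d -> R).
Hypotheses (d1 : (1 <= d)%N) (a02 : 0 < a < 2) (b02 : 0 < b < 2)
  (p0 : 0 <= p) (q0 : 0 <= q)
  (cu : continuous u) (u0 : forall x, 0 <= u x) (wu : weighted_L1 a u)
  (hu : holder_plus exterior a u)
  (su : forall x, exterior x -> 0 < fraclap a u x)
  (up : forall x, exterior x -> 0 < u x)
  (cv : continuous v) (v0 : forall x, 0 <= v x) (wv : weighted_L1 b v)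
  (sv : forall x, exterior x -> 0 < fraclap b v x)
  (vp : forall x, exterior x -> 0 < v x)
  (W0 : forall x, 0 <= W x) (mW : lebesgue_measurable W)
  (uW : forall x, exterior x -> W x * u x `^ p * v x `^ q <= fraclap a u x).

Definition density_source_cst : R :=
  @harnack_cst R d a `^ p * @harnack_cst R d b `^ q * (3 / 4) / @source_cst R d a.

Lemma density_source_cst_gt0 : 0 < density_source_cst.
Proof.
rewrite /density_source_cst divr_gt0 ?source_cst_gt0// mulr_gt0 ?divr_gt0//.
by rewrite mulr_gt0// powR_gt0// harnack_cst_gt0.
Qed.

(** One centre with |x| = r is enough, [Phi] being an infimum. On B(x, r/4) the paraboloid of radius
    r / 2 is at least 3/4 and the Harnack bounds hold for both functions, which bounds the tested
    source below by a multiple of [Phi W r]. *)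
Lemma density_source_le r : 16 <= r -> exists2 phi, 0 <= phi & Phi W r = phi%:E /\
  density_source_cst * (phi * r `^ (- (d%:R - a))) *
    density u r `^ p * density v r `^ q <= density u r.
Proof.
move=> r16; have r0 : 0 < r by lra.
have [x xr] := exists_enorm d1 (ltW r0).
have r1 : 1 <= r by lra.
have Agt := density_gt0 d1 cu u0 up r1; have Bgt := density_gt0 d1 cv v0 vp r1.
have A0 := ltW Agt; have B0 := ltW Bgt.
have ha0 := @harnack_cst_gt0 R d a a02; have hb0 := @harnack_cst_gt0 R d b b02.
pose m : R := (@harnack_cst R d a * density u r) `^ p *
  (@harnack_cst R d b * density v r) `^ q.
have m0 : 0 <= m by rewrite mulr_ge0 ?powR_ge0.
pose f y := W y * u y `^ p * v y `^ q.
have f0 y : 0 <= f y by rewrite !mulr_ge0 ?powR_ge0.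
have mf : measurable_fun [set: leb_rV R d] f.
  apply: measurable_funM; first apply: measurable_funM.
  - exact: mW.
  - exact: (measurableT_comp (measurable_powR p) (continuous_measurable_leb_rV cu)).
  - exact: (measurableT_comp (measurable_powR q) (continuous_measurable_leb_rV cv)).
have S := source_le a02 cu u0 wu hu su mf f0 uW r16 xr.
have mp : measurable_fun [set: leb_rV R d] (paraboloid x (r / 2)).
  exact: (measurable_borel_lebesgue (measurable_paraboloid x (r / 2))).
have pf0 y : 0 <= paraboloid x (r / 2) y * f y by rewrite mulr_ge0 ?paraboloid_ge0.
have c0 : 0 <= m * (3 / 4) by rewrite mulr_ge0.
have near y : eball x (r / 4) y -> m * (3 / 4) * W y <= paraboloid x (r / 2) y * f y.
  rewrite /eball/= => yx.
  have yb : r / 4 <= enorm y <= 2 * r.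
    have := enorm_sub_ge x y; have := enorm_sub_ge y x.
    by rewrite (enormB x y) xr => h1 h2; apply/andP; split; lra.
  have P : 3 / 4 <= paraboloid x (r / 2) y.
    have -> : 3 / 4 = 1 - (1 / 2) ^+ 2 :> R by field.
    by apply: paraboloid_ge; lra.
  have fm : m * W y <= f y.
    rewrite mulrC /f -mulrA ler_wpM2l// ler_pM ?powR_ge0//.
      apply: (ge0_ler_powR p0); rewrite ?nnegrE ?(mulr_ge0 (ltW ha0) A0)//.
      exact: (weak_harnack d1 a02 cu u0 wu su up r16 yb).
    apply: (ge0_ler_powR q0); rewrite ?nnegrE ?(mulr_ge0 (ltW hb0) B0)//.
    exact: (weak_harnack d1 b02 cv v0 wv sv vp r16 yb).
  rewrite mulrAC mulrC; apply: ler_pM => //; exact: mulr_ge0.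
have I := ge0_integral_sub_le (measurable_eball x (r / 4)) mW
  (measurable_funM mp mf) c0 W0 pf0 near S.
have mgt : 0 < m * (3 / 4).
  by rewrite mulr_gt0// ?divr_gt0// mulr_gt0// powR_gt0// mulr_gt0.
pose M : R := @source_cst R d a * r `^ (- a) * mass u (4 * r).
(* This also yields finiteness of [Phi W r]: M is real and m, a product of powers of positive
   densities, is positive. *)
have Pl : (Phi W r <= (M / (m * (3 / 4)))%:E)%E.
  apply: (@le_trans _ _ (\int[mu]_(y in eball x (r / 4)) (W y)%:E)%E).
    by apply: ereal_inf_lbound; exists x => //=; apply/andP; split; lra.
  by rewrite EFinM muleC lee_pdivlMl.
have PF : Phi W r \is a fin_num.
  by rewrite ge0_fin_numE ?Phi_ge0//; apply: le_lt_trans Pl (ltry _).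
exists (fine (Phi W r)); first by rewrite fine_ge0// Phi_ge0.
split; first by rewrite fineK.
move: Pl; rewrite -(fineK PF) lee_fin; set phi := fine _.
rewrite ler_pdivlMr// => phiM.
have sc0 := source_cst_gt0 a02.
have -> : density_source_cst * (phi * r `^ (- (d%:R - a))) *
    density u r `^ p * density v r `^ q =
  phi * (m * (3 / 4)) * (r `^ (- (d%:R - a)) / @source_cst R d a).
  rewrite /m (powRM p (ltW ha0) A0) (powRM q (ltW hb0) B0) /density_source_cst.
  have E : forall c1 c2 s ph e A B : R, c1 * c2 * (3 / 4) / s * (ph * e) * A * B =
    ph * (c1 * A * (c2 * B) * (3 / 4)) * (e / s) by move=> *; ring.
  exact: E.
have c1 : 0 <= r `^ (- (d%:R - a)) / @source_cst R d a.
  by rewrite divr_ge0 ?powR_ge0// ltW.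
apply: (le_trans (ler_wpM2r c1 phiM)).
have -> : r `^ (- (d%:R - a)) = r `^ a / r ^+ d.
  rewrite opprB powRD; last by rewrite (gt_eqF r0) implybT.
  by rewrite powRN powR_mulrn ?ltW.
have ra : r `^ (- a) * r `^ a = 1.
  by rewrite powRN mulVf// gt_eqF// powR_gt0.
have -> : M * (r `^ a / r ^+ d / @source_cst R d a) =
  (r `^ (- a) * r `^ a) * (@source_cst R d a / @source_cst R d a) * density u r.
  by rewrite /M /density; ring.
by rewrite ra divff ?gt_eqF// !mul1r.
Qed.

End positive_supersolution.
End density.

(** * Scalar inequalities between the two densities *)

(** The bound B >= c t is spent on the factor B^q2 alone; the second inequality then reads B >= G
    A^q1, and its p2-th power is inserted into the first. *)
Lemma powR_elimination (R : realType) (p1 p2 q1 q2 k1 k2 c s t phi psi A B : R) :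
  0 <= p2 -> 0 <= q2 -> 0 <= k1 -> 0 <= k2 -> 0 <= c -> 0 < t -> 0 <= s ->
  0 <= phi -> 0 <= psi -> 0 < A -> 0 < B ->
  k1 * (phi * s) * A `^ p1 * B `^ p2 <= A ->
  k2 * (psi * t) * B `^ q2 * A `^ q1 <= B -> c * t <= B ->
  k1 * (k2 * c `^ q2) `^ p2 * ((psi * t `^ (1 + q2)) `^ p2 * (phi * s)) <=
    A `^ (1 - (p2 * q1 + p1)).
Proof.
move=> p20 q20 k10 k20 c0 t0 s0 f0 g0 A0 B0 EA EB cB.
have A1 := lt_eqF (powR_gt0 (p2 * q1 + p1) A0).
have pos : 0 < A `^ (p2 * q1 + p1) by exact: powR_gt0.
have ct0 : 0 <= c * t by rewrite mulr_ge0// ltW.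
have ct : (c * t) `^ q2 <= B `^ q2.
  by apply: ge0_ler_powR; rewrite ?nnegrE// ltW.
pose G := k2 * (psi * t) * (c * t) `^ q2.
have kt0 : 0 <= k2 * (psi * t) by rewrite !mulr_ge0// ltW.
have G0 : 0 <= G by rewrite mulr_ge0// powR_ge0.
have GB : G `^ p2 * A `^ (p2 * q1) <= B `^ p2.
  have -> : A `^ (p2 * q1) = (A `^ q1) `^ p2 by rewrite -powRrM mulrC.
  rewrite -powRM ?powR_ge0//; apply: ge0_ler_powR; rewrite ?nnegrE ?(ltW B0)//.
    by rewrite mulr_ge0// powR_ge0.
  apply: le_trans EB; rewrite ler_wpM2r ?powR_ge0//.
  by rewrite /G ler_wpM2l.
have GE : G = (k2 * c `^ q2) * (psi * t `^ (1 + q2)).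
  rewrite /G powRM ?(ltW t0)// powRD; last by rewrite (gt_eqF t0) implybT.
  by rewrite powRr1 ?(ltW t0)//; ring.
have -> : A `^ (1 - (p2 * q1 + p1)) = A / A `^ (p2 * q1 + p1).
  rewrite powRD; last by rewrite (gt_eqF A0) implybT.
  by rewrite powRr1 ?(ltW A0)// powRN.
rewrite ler_pdivlMr//; apply: le_trans EA.
have -> : A `^ (p2 * q1 + p1) = A `^ (p2 * q1) * A `^ p1.
  by rewrite powRD// (gt_eqF A0) implybT.
have kf0 : 0 <= k1 * (phi * s) * A `^ p1.
  by rewrite mulr_ge0 ?powR_ge0// !mulr_ge0.
apply: le_trans (ler_wpM2l kf0 GB).
rewrite GE (@powRM _ (k2 * c `^ q2)) ?mulr_ge0 ?powR_ge0//.
have E : forall w x y z' g h : R, w * x * (y * z') * (g * h) = w * z' * h * (x * y * g).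
  by move=> *; ring.
by rewrite E.
Qed.

Lemma gt0_limf_einf (R : realType) (f : R -> \bar R) (F : set_system R) :
  Filter F -> (0 < limf_einf f F)%E ->
  exists2 c : R, 0 < c & \forall x \near F, (c%:E <= f x)%E.
Proof.
move=> FF; rewrite limf_einfE => /ereal_sup_gt[_ [V FV <-]] f0.
have [c c0 cV] : exists2 c : R, 0 < c & (c%:E <= ereal_inf (f @` V))%E.
  move: f0; case: (ereal_inf _) => [c|_|//]; last by exists 1 => //; exact: leey.
  by rewrite lte_fin => c0; exists c.
exists c => //; apply: filterS FV => x Vx; apply: (le_trans cV).
by apply: ereal_inf_lbound; exists x.
Qed.

(** In the extended reals the inverse of 0 is +oo, so a small quotient excludes a zero denominator;
    an infinite denominator satisfies the conclusion at once. *)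
Lemma maxe_div_cvg0 (R : realType) (t1 t2 : R -> R) (f1 f2 : R -> \bar R) (M : R) :
  (forall r, 0 < r -> 0 < t1 r) -> (forall r, 0 < r -> 0 < t2 r) ->
  (forall r, (0 <= f1 r)%E) -> (forall r, (0 <= f2 r)%E) ->
  maxe ((t1 r)%:E / f1 r)%E ((t2 r)%:E / f2 r)%E @[r --> +oo] --> 0%E ->
  \forall r \near +oo, ((M * t1 r)%:E <= f1 r)%E /\ ((M * t2 r)%:E <= f2 r)%E.
Proof.
move=> t10 t20 f10 f20 /fine_cvgP[fin cv].
pose e : R := (`|M| + 1)^-1.
have M1 : 0 < `|M| + 1 by rewrite ltr_wpDl.
have e0 : 0 < e by rewrite invr_gt0.
have key (t : R) (f : \bar R) : 0 < t -> (0 <= f)%E -> (t%:E / f < e%:E)%E ->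
    ((M * t)%:E <= f)%E.
  move=> t0; case: f => [f|_ _|//]; last exact: leey.
  rewrite lee_fin => f0; rewrite inver; case: eqVneq => [->|fn0].
    by rewrite gt0_muley ?lte_fin.
  have fgt : 0 < f by rewrite lt_neqAle eq_sym fn0.
  rewrite -EFinM lte_fin lee_fin ltr_pdivrMr// mulrC ltr_pdivlMr// => h.
  rewrite mulrC; apply: le_trans (ltW h).
  by rewrite ler_wpM2l ?(ltW t0)// (le_trans (ler_norm M))// lerDl.
have near_e : \forall r \near +oo,
    fine (maxe ((t1 r)%:E / f1 r) ((t2 r)%:E / f2 r))%E < e.
  have := @cvgr_lt _ _ _ _ _ _ cv e e0; exact.
near=> r.
have fr : (maxe ((t1 r)%:E / f1 r) ((t2 r)%:E / f2 r))%E \is a fin_num by near: r.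
have lr : (maxe ((t1 r)%:E / f1 r) ((t2 r)%:E / f2 r) < e%:E)%E.
  by rewrite -(fineK fr) lte_fin; near: r.
have r0 : 0 < r by near: r; apply: nbhs_pinfty_gt; rewrite real0.
by move: lr; rewrite gt_max => /andP[l1 l2]; split; apply: key => //; [exact: t10|exact: t20].
Unshelve. all: by end_near. Qed.

Section coupled_growth.
Context {R : realType}.
Implicit Types (r : R).

(** All that is retained of the differential inequalities, with m = d - alpha, n = d - beta, F and G
    the functions [Phi], A and B the densities. Both equations have the same shape, so each scalar
    lemma serves for u and for v. *)
Definition coupled_growth (m n p1 p2 q1 q2 : R) (F G : R -> \bar R) (A B : R -> R) :=
  exists k1 k2 c1 c2 : R, [/\ 0 < k1, 0 < k2, 0 < c1, 0 < c2 &
  \forall r \near +oo, [/\ 0 < A r, 0 < B r, c1 * r `^ (- m) <= A r,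
    c2 * r `^ (- n) <= B r & exists phi psi : R,
    [/\ 0 <= phi, 0 <= psi, F r = phi%:E, G r = psi%:E &
     k1 * (phi * r `^ (- m)) * A r `^ p1 * B r `^ p2 <= A r /\
     k2 * (psi * r `^ (- n)) * B r `^ q2 * A r `^ q1 <= B r]]].

Lemma coupled_growth_sym m n p1 p2 q1 q2 F G A B :
  coupled_growth m n p1 p2 q1 q2 F G A B -> coupled_growth n m q2 q1 p2 p1 G F B A.
Proof.
move=> [k1 [k2 [c1 [c2 [k10 k20 c10 c20 H]]]]].
exists k2, k1, c2, c1; split => //; apply: filterS H => r.
by move=> [A0 B0 cA cB [phi [psi [f0 g0 Fr Gr [E1 E2]]]]]; split => //; exists psi, phi.
Qed.

(** Elimination gives k S <= A^(1 - th). For th < 1 the positive lower limit bounds S, hence A, from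
    below. For th >= 1 the exponent is nonpositive and the decay bound on A limits the growth of S,
    against the divergence hypothesis: that case does not occur. *)
Lemma coupled_growth_bounded_below m n p1 p2 q1 q2 F G A B :
  0 <= p2 -> 0 <= q2 ->
  coupled_growth m n p1 p2 q1 q2 F G A B ->
  (p2 * q1 + p1 < 1 ->
      (0 < limf_einf (fun r : R =>
         (G r / (r `^ (n * (1 + q2)))%:E) `^ p2 *
         (F r / (r `^ m)%:E)) (+oo%R : set_system R))%E) ->
  (1 <= p2 * q1 + p1 ->
      ((r `^ (m * (p2 * q1 + p1)))^-1%:E *
       (r `^ (n * (p2 * q2 + p2)))^-1%:E *
       (G r `^ p2 * F r))%E @[r --> +oo] --> +oo%E) ->
  exists2 c, 0 < c & \forall r \near +oo, c <= A r.
Proof.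
move=> p20 q20 [k1 [k2 [c1 [c2 [k10 k20 c10 c20 H]]]]] ci ciii.
set th := p2 * q1 + p1 in ci ciii *.
pose k := k1 * (k2 * c2 `^ q2) `^ p2.
have k0 : 0 < k by rewrite mulr_gt0// powR_gt0// mulr_gt0// powR_gt0.
pose S r (phi psi : R) := (psi * (r `^ (- n)) `^ (1 + q2)) `^ p2 * (phi * r `^ (- m)).
have H' : \forall r \near +oo, [/\ 0 < r, 0 < A r, c1 * r `^ (- m) <= A r &
    exists phi psi : R, [/\ 0 <= phi, 0 <= psi, F r = phi%:E, G r = psi%:E &
      k * S r phi psi <= A r `^ (1 - th)]].
  near=> r; have r0 : 0 < r by near: r; apply: nbhs_pinfty_gt; rewrite real0.
  have [//|A0 B0 cA cB [phi [psi [f0 g0 Fr Gr [E1 E2]]]]] := near H r.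
  split => //; exists phi, psi; split => //.
  by apply: (powR_elimination p20 q20 (ltW k10) (ltW k20) (ltW c20) _ _ f0 g0 A0 B0 E1 E2 cB);
    rewrite ?powR_gt0// powR_ge0.
have [th1|th1] := ltP th 1.
  have [c c0 Hc] := gt0_limf_einf _ (ci th1).
  have th0 : 0 < 1 - th by rewrite subr_gt0.
  exists ((k * c) `^ (1 - th)^-1); first by rewrite powR_gt0// mulr_gt0.
  near=> r.
  have [//|r0 A0 cA [phi [psi [f0 g0 Fr Gr E]]]] := near H' r.
  have : (c%:E <= (G r / (r `^ (n * (1 + q2)))%:E) `^ p2 * (F r / (r `^ m)%:E))%E.
    by near: r.
  rewrite Fr Gr !inver !gt_eqF ?powR_gt0// -!EFinM lee_fin.
  rewrite -!powRN => h.
  have {}h : k * c <= A r `^ (1 - th).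
    apply: (le_trans _ E).
    rewrite (ler_pM2l k0).
    apply: (le_trans h).
    have rn : (r `^ (- n)) `^ (1 + q2) = r `^ (- (n * (1 + q2))).
      by rewrite -mulNr powRrM.
    by rewrite /S rn.
  have -> : A r = (A r `^ (1 - th)) `^ (1 - th)^-1.
    by rewrite -powRrM divff ?gt_eqF// powRr1// ltW.
  apply: ge0_ler_powR; rewrite ?nnegrE ?powR_ge0 ?invr_ge0 ?(ltW th0)//.
  by rewrite mulr_ge0// ltW.
exfalso.
have Hb := @cvgey_gt _ _ _ _ _ (ciii th1) (c1 `^ (1 - th) / k).
suff : \forall r \near (+oo%R : set_system R), False by move=> /filter_ex[].
near=> r.
have [//|r0 A0 cA [phi [psi [f0 g0 Fr Gr E]]]] := near H' r.
have : ((c1 `^ (1 - th) / k)%:E < (r `^ (m * th))^-1%:E *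
       (r `^ (n * (p2 * q2 + p2)))^-1%:E * (G r `^ p2 * F r))%E by near: r; exact: Hb.
rewrite Fr Gr poweR_EFin -!EFinM lte_fin ltr_pdivrMr// => h.
have rm0 : 0 < r `^ (- m) by exact: powR_gt0.
have cr0 : 0 < c1 * r `^ (- m) by rewrite mulr_gt0.
(* The map x -> x^(1 - th) is nonincreasing here, so the lower bound on A becomes an upper bound. It
   has the power of r that turns S into the expression assumed to diverge. *)
have Ale : A r `^ (1 - th) <= (c1 * r `^ (- m)) `^ (1 - th).
  rewrite -[1 - th]opprB (powRN (A r)) (powRN (c1 * _)) lef_pV2 ?posrE ?powR_gt0//.
  by apply: ge0_ler_powR; rewrite ?nnegrE ?subr_ge0 ?(ltW A0) ?(ltW cr0).
have := le_trans E Ale; rewrite powRM ?(ltW c10) ?(ltW rm0)// => hE.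
have X : 0 < (r `^ (- m)) `^ (1 - th) by exact: powR_gt0.
suff EQ : k * S r phi psi = (r `^ (m * th))^-1 * (r `^ (n * (p2 * q2 + p2)))^-1 *
    (psi `^ p2 * phi) * k * (r `^ (- m)) `^ (1 - th).
  by move: hE; rewrite EQ ler_pM2r// leNgt h.
have e1 : ((r `^ (- n)) `^ (1 + q2)) `^ p2 = (r `^ (n * (p2 * q2 + p2)))^-1.
  by rewrite -2!powRrM -powRN; congr (_ `^ _); ring.
have e2 : r `^ (- m) = (r `^ (m * th))^-1 * (r `^ (- m)) `^ (1 - th).
  rewrite -powRrM -powRN -powRD; last by rewrite (gt_eqF r0) implybT.
  by congr (_ `^ _); ring.
rewrite /S powRM ?powR_ge0// e1 {1}e2.
have EE : forall w x y z' g h : R, w * (x * y * (z' * (g * h))) = g * y * (x * z') * w * h.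
  by move=> *; ring.
exact: EE.
Unshelve. all: by end_near. Qed.

Lemma coupled_growth_blow_up m n p1 p2 q1 q2 F G A B (c : R) :
  0 <= p1 -> 0 <= p2 -> 0 < c ->
  coupled_growth m n p1 p2 q1 q2 F G A B ->
  (forall M : R, \forall r \near +oo, ((M * r `^ m)%:E <= F r)%E) ->
  (\forall r \near +oo, c <= A r) -> (\forall r \near +oo, c <= B r) ->
  forall M, \forall r \near +oo, M <= A r.
Proof.
move=> p10 p20 c0 [k1 [k2 [c1 [c2 [k10 k20 c10 c20 H]]]]] HF cA cB M.
pose K := k1 * c `^ p1 * c `^ p2.
have K0 : 0 < K by rewrite !mulr_gt0// powR_gt0.
near=> r.
have r0 : 0 < r by near: r; apply: nbhs_pinfty_gt; rewrite real0.
have [//|A0 B0 _ _ [phi [psi [f0 g0 Fr Gr [E1 E2]]]]] := near H r.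
have cAr : c <= A r by near: r.
have cBr : c <= B r by near: r.
have : ((`|M| / K * r `^ m)%:E <= F r)%E by near: r.
rewrite Fr lee_fin => h.
have X : `|M| / K <= phi * r `^ (- m).
  by rewrite powRN ler_pdivlMr// powR_gt0.
apply: le_trans E1; apply: (le_trans (ler_norm M)).
have pA : c `^ p1 <= A r `^ p1 by apply: ge0_ler_powR; rewrite ?nnegrE ?(ltW c0) ?(ltW A0).
have pB : c `^ p2 <= B r `^ p2 by apply: ge0_ler_powR; rewrite ?nnegrE ?(ltW c0) ?(ltW B0).
apply: (@le_trans _ _ (k1 * (`|M| / K) * c `^ p1 * c `^ p2)).
  have EE : forall w x y z' : R, w * x * y * z' = x * (w * y * z') by move=> *; ring.
  by rewrite EE -/K divfK ?gt_eqF.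
have MK : 0 <= `|M| / K by rewrite divr_ge0// ltW.
have kMK : 0 <= k1 * (`|M| / K) by rewrite mulr_ge0// ltW.
have kc0 : 0 <= k1 * (`|M| / K) * c `^ p1 by apply: mulr_ge0 => //; exact: powR_ge0.
apply: (ler_pM kc0 (powR_ge0 _ _) _ pB).
apply: (ler_pM kMK (powR_ge0 _ _) _ pA).
by rewrite ler_pM2l.
Unshelve. all: by end_near. Qed.

End coupled_growth.

(** * Asymptotics of the densities and conclusion *)

Section density_asymptotics.
Context {R : realType} {d : nat}.
Variables (a : R) (u : 'rV[R]_d -> R).
Hypotheses (d1 : (1 <= d)%N) (a02 : 0 < a < 2) (ad : a < d%:R) (cu : continuous u)
  (u0 : forall x, 0 <= u x) (wu : weighted_L1 a u) (hu : holder_plus exterior a u)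
  (su : forall x, exterior x -> 0 < fraclap a u x)
  (up : forall x, exterior x -> 0 < u x).

Lemma density_lower_bound : exists2 c, 0 < c &
  \forall r \near +oo, c * r `^ (- (d%:R - a)) <= density u r.
Proof.
have [c c0 [r0 H]] := mass_lower_bound d1 a02 ad cu u0 wu hu su up.
exists c => //; near=> r.
have rp : 0 < r by near: r; apply: nbhs_pinfty_gt; rewrite real0.
have rr : r0 <= r by near: r; apply: nbhs_pinfty_ge; rewrite num_real.
have r4 : r <= 4 * r by rewrite ler_peMl ?(ltW rp)// ler1n.
have a0 : 0 <= a by case/andP: a02 => /ltW.
rewrite /density ler_pdivlMr ?exprn_gt0//; apply: le_trans (H _ (le_trans rr r4)).
have -> : c * r `^ (- (d%:R - a)) * r ^+ d = c * r `^ a.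
  rewrite -(powR_mulrn _ (ltW rp)) -mulrA -powRD; last by rewrite (gt_eqF rp) implybT.
  by congr (_ * _ `^ _); ring.
rewrite ler_pM2l//; apply: (ge0_ler_powR a0) => //; rewrite nnegrE ?(ltW rp)//.
by rewrite mulr_ge0// ltW.
Unshelve. all: by end_near. Qed.

Lemma density_not_blow_up : ~ (forall M, \forall r \near +oo, M <= density u r).
Proof.
move=> blow; apply: (not_blow_up d1 a02 ad cu u0 wu hu su) => T.
have ha := @harnack_cst_gt0 R d a a02.
have [N [_ HN]] := blow (T / @harnack_cst R d a).
exists (Num.max 16 (N + 1)) => x; rewrite ge_max => /andP[x16 xN].
have xb : enorm x / 4 <= enorm x <= 2 * enorm x by apply/andP; split; lra.
apply: le_trans (weak_harnack d1 a02 cu u0 wu su up x16 xb).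
by rewrite mulrC -ler_pdivrMr//; apply: HN; lra.
Qed.

End density_asymptotics.

Theorem theorem2p4 (R : realType) (d : nat) (alpha beta p1 p2 q1 q2 : R)
    (U V : 'rV[R]_d -> R)
    (d_ge1 : (1 <= d)%N)
    (alpha_range : 0 < alpha < Num.min 2 d%:R)
    (beta_range : 0 < beta < Num.min 2 d%:R)
    (p1_ge0 : 0 <= p1) (q2_ge0 : 0 <= q2) (p2_gt0 : 0 < p2) (q1_gt0 : 0 < q1)
    (U_gt0 : forall x, 0 < U x) (V_gt0 : forall x, 0 < V x)
    (U_meas : lebesgue_measurable U) (V_meas : lebesgue_measurable V)
    (Phi_growth :
      maxe ((r `^ (d%:R - alpha))%:E / Phi U r)%E
           ((r `^ (d%:R - beta))%:E / Phi V r)%E @[r --> +oo] --> 0%E)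
    (case_i : p2 * q1 + p1 < 1 ->
      (0 < limf_einf (fun r : R =>
         (Phi V r / (r `^ ((d%:R - beta) * (1 + q2)))%:E) `^ p2 *
         (Phi U r / (r `^ (d%:R - alpha))%:E)) (+oo%R : set_system R))%E)
    (case_ii : p2 * q1 + q2 < 1 ->
      (0 < limf_einf (fun r : R =>
         (Phi U r / (r `^ ((d%:R - alpha) * (1 + p1)))%:E) `^ q1 *
         (Phi V r / (r `^ (d%:R - beta))%:E)) (+oo%R : set_system R))%E)
    (case_iii : 1 <= p2 * q1 + p1 ->
      ((r `^ ((d%:R - alpha) * (p2 * q1 + p1)))^-1%:E *
       (r `^ ((d%:R - beta) * (p2 * q2 + p2)))^-1%:E *
       (Phi V r `^ p2 * Phi U r))%E @[r --> +oo] --> +oo%E)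
    (case_iv : 1 <= p2 * q1 + q2 ->
      ((r `^ ((d%:R - beta) * (p2 * q1 + q2)))^-1%:E *
       (r `^ ((d%:R - alpha) * (p1 * q1 + q1)))^-1%:E *
       (Phi V r * Phi U r `^ q1))%E @[r --> +oo] --> +oo%E)
    (u v : 'rV[R]_d -> R)
    (uv_sol : classical_supersolution alpha beta p1 p2 q1 q2 U V u v) :
  (forall x, u x = 0) \/ (forall x, v x = 0).
Proof.
have [[[hu cu wu] [hv cv wv]] uv0 eu ev] := uv_sol.
have u0 x : 0 <= u x by have [] := uv0 x.
have v0 x : 0 <= v x by have [] := uv0 x.
have [a02 ad] : 0 < alpha < 2 /\ alpha < d%:R.
  by move: alpha_range; rewrite lt_min => /and3P[-> -> ->].
have [b02 bd] : 0 < beta < 2 /\ beta < d%:R.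
  by move: beta_range; rewrite lt_min => /and3P[-> -> ->].
have U0 x : 0 <= U x by exact: ltW.
have V0 x : 0 <= V x by exact: ltW.
have [u_zero|u_pos] := pselect (exists x, exterior x /\ u x = 0).
  left; have [x [xe ux]] := u_zero.
  apply: (strong_maximum_principle a02 cu u0 wu hu xe _ ux).
  by apply: le_trans (eu _ xe); rewrite !mulr_ge0 ?powR_ge0.
have [v_zero|v_pos] := pselect (exists x, exterior x /\ v x = 0).
  right; have [x [xe vx]] := v_zero.
  apply: (strong_maximum_principle b02 cv v0 wv hv xe _ vx).
  by apply: le_trans (ev _ xe); rewrite !mulr_ge0 ?powR_ge0.
exfalso.
have up x : exterior x -> 0 < u x.
  by move=> xe; rewrite lt_neqAle u0 andbT eq_sym; apply/eqP => ux; apply: u_pos; exists x.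
have vp x : exterior x -> 0 < v x.
  by move=> xe; rewrite lt_neqAle v0 andbT eq_sym; apply/eqP => vx; apply: v_pos; exists x.
(* Positivity of u and v makes the source, hence [fraclap], strictly positive; this guarantees that
   the principal values converge. *)
have su x : exterior x -> 0 < fraclap alpha u x.
  move=> xe; apply: lt_le_trans (eu _ xe).
  by rewrite !mulr_gt0 ?powR_gt0 ?up ?vp.
have sv x : exterior x -> 0 < fraclap beta v x.
  move=> xe; apply: lt_le_trans (ev _ xe).
  by rewrite !mulr_gt0 ?powR_gt0 ?up ?vp.
have ev' x : exterior x -> V x * v x `^ q2 * u x `^ q1 <= fraclap beta v x.
  by move=> /ev; rewrite mulrAC.
have [c1 c10 Lu] := density_lower_bound d_ge1 a02 ad cu u0 wu hu su up.
have [c2 c20 Lv] := density_lower_bound d_ge1 b02 bd cv v0 wv hv sv vp.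
have growth : coupled_growth (d%:R - alpha) (d%:R - beta) p1 p2 q1 q2
    (Phi U) (Phi V) (density u) (density v).
  exists (@density_source_cst R d alpha beta p1 p2),
    (@density_source_cst R d beta alpha q2 q1), c1, c2.
  split => //; [exact: density_source_cst_gt0|exact: density_source_cst_gt0|].
  near=> r.
  have r16 : 16 <= r by near: r; apply: nbhs_pinfty_ge; rewrite num_real.
  have r1 : 1 <= r by lra.
  split; [exact: density_gt0|exact: density_gt0|by near: r|by near: r|].
  have [phi phi0 [Ur Eu]] := density_source_le d_ge1 a02 b02 p1_ge0 (ltW p2_gt0)
    cu u0 wu hu su up cv v0 wv sv vp U0 U_meas eu r16.
  have [psi psi0 [Vr Ev]] := density_source_le d_ge1 b02 a02 q2_ge0 (ltW q1_gt0)
    cv v0 wv hv sv vp cu u0 wu su up V0 V_meas ev' r16.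
  by exists phi, psi.
have [cA cA0 HA] := coupled_growth_bounded_below (ltW p2_gt0) q2_ge0 growth case_i case_iii.
(* Conditions (ii) and (iv) are (i) and (iii) after exchanging u with v, p1 with q2 and p2 with q1,
   up to the order of the products. *)
have [cB cB0 HB] : exists2 c, 0 < c & \forall r \near +oo, c <= density v r.
  apply: (coupled_growth_bounded_below (ltW q1_gt0) p1_ge0 (coupled_growth_sym growth)).
    by rewrite (mulrC q1).
  rewrite (mulrC q1 p2) (mulrC q1 p1).
  by under eq_fun do rewrite [(Phi U _ `^ q1 * _)%E]muleC.
have posU r : (0 <= Phi U r)%E by exact: Phi_ge0.
have posV r : (0 <= Phi V r)%E by exact: Phi_ge0.
have big M : \forall r \near +oo, ((M * r `^ (d%:R - alpha))%:E <= Phi U r)%E.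
  have H := maxe_div_cvg0 M (fun r => powR_gt0 (d%:R - alpha)) (fun r => powR_gt0 (d%:R - beta))
    posU posV Phi_growth.
  by apply: filterS H => r [].
pose c := Num.min cA cB.
apply: (density_not_blow_up d_ge1 a02 ad cu u0 wu hu su up).
apply: (coupled_growth_blow_up (c := c) p1_ge0 (ltW p2_gt0) _ growth big).
- by rewrite lt_min cA0.
- by apply: filterS HA => r; apply: le_trans; rewrite ge_min lexx.
- by apply: filterS HB => r; apply: le_trans; rewrite ge_min lexx orbT.
Unshelve. all: by end_near. Qed.
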